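(* Let $(M,\alpha,\omega_1,\omega_2,\omega_3)$ be a $5$-dimensional $\mathrm{SU}(2)$-manifold. Assume that: 1. the $\mathrm{SU}(3)$-structure $(\kappa,\widetilde J,\varepsilon)$ induced on the cone $C(M)=M\times\mathbb{R}^+$ is symplectic half-flat; 2. the metric $g$ induced by $(\alpha,\omega_1,\omega_2,\omega_3)$ is $\alpha$-Einstein. Then $(M,\alpha,\omega_1,\omega_2,\omega_3)$ is Sasaki-Einstein.
   Context: An $\mathrm{SU}(2)$-structure on a smooth $5$-manifold $M$ is a reduction of the frame bundle to $\mathrm{SU}(2)$; equivalently, a quadruple $(\alpha,\omega_1,\omega_2,\omega_3)$ with $\alpha$ a nowhere vanishing $1$-form and $\omega_1,\omega_2,\omega_3$ $2$-forms with $\omega_i\wedge\omega_j=\delta_{ij}v$ for a $4$-form $v$ with $v\wedge\alpha\ne0$ everywhere, and such that $\iota_X\omega_1=\iota_Y\omega_2$ implies $\omega_3(X,Y)\ge 0$. An $\mathrm{SU}(2)$-manifold is a manifold with such a structure. Near each point there are adapted coframes $e^1,\dots,e^5$ with $\alpha=e^5$, $\omega_1=e^{12}+e^{34}$, $\omega_2=e^{13}-e^{24}$, $\omega_3=e^{14}+e^{23}$ (where $e^{ij}=e^i\wedge e^j$). The induced Riemannian metric is $g=\sum_{i=1}^5 e^i\otimes e^i=g^T+\alpha\otimes\alpha$, with $g^T=\sum_{i=1}^4e^i\otimes e^i$. The Reeb field $R_\alpha$ is defined by $\alpha(R_\alpha)=1$, $\iota_{R_\alpha}\omega_1=0$. The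 endomorphism $J_1$ of $TM$ is given by $J_1R_\alpha=0$ and, on $\ker\alpha$, by $\omega_1(X,J_1Y)=g^T(X,Y)$ (so $J_1e_1=e_2$, $J_1e_3=e_4$ in the dual frame). Cone: on $C(M)=M\times\mathbb{R}^+_t$ the induced $\mathrm{SU}(3)$-structure $(\kappa,\widetilde J,\varepsilon)$ is $\kappa=t^2\omega_1+t\,\alpha\wedge dt$, $\varepsilon=t^2(\omega_2+i\omega_3)\wedge(t\alpha+i\,dt)$, with $\widetilde JX=J_1X$ for $X\in\ker\alpha$ and $\widetilde JR_\alpha=t\,\partial/\partial t$; $\varepsilon$ is of type $(3,0)$ for $\widetilde J$. An $\mathrm{SU}(3)$-structure $(\kappa,J,\varepsilon)$ on a $6$-manifold is symplectic half-flat if $d\kappa=0$, $\overline\partial_J\varepsilon=0$ (the $(3,1)$-part of $d\varepsilon$ vanishes) and $d\,\mathrm{Re}\,\varepsilon=0$. The $\mathrm{SU}(2)$-structure is Sasaki-Einstein if $d\alpha=-2\omega_1$, $d\omega_2=3\alpha\wedge\omega_3$, $d\omega_3=-3\alpha\wedge\omega_2$. $\alpha$-Einstein: $g$ is $\alpha$-Einstein if the component $\mathrm{Ric}_0$ vanishes in the decomposition $\mathrm{Ric}=\frac{\lambda}{4}g^T+\mu\,\alpha\otimes\alpha+\mathrm{Ric}_0$, where $\lambda$ is the $g^T$-trace of $\mathrm{Ric}$ restricted to $\ker\alpha$ and $\mu=\mathrm{Ric}(R_\alpha,R_\alpha)$; that is, if $\mathrm{Ric}=\frac{\lambda}{4}g^T+\mu\,\alpha\otimes\alpha$.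 *)

(* Defs.v *)
From HB Require Import structures.
From mathcomp Require Import all_boot all_order all_algebra all_fingroup.
From mathcomp Require Import complex.
From mathcomp Require Import all_classical all_reals all_analysis.
Set Implicit Arguments.
Unset Strict Implicit.
Unset Printing Implicit Defensive.
Import Order.TTheory GRing.Theory Num.Theory.
Import numFieldNormedType.Exports.
Local Open Scope classical_set_scope.
Local Open Scope complex_scope.
Local Open Scope ring_scope.

(* Vectors of R^n are row vectors, linear maps act on the right, and the k
   arguments of a k-form are the rows of a k x n matrix. *)

Section SmoothFunctions.
Context {R : realType} {n : nat}.
Implicit Types (f : 'rV[R]_n -> R) (U : set 'rV[R]_n).

Definition partial (i : 'I_n) f : 'rV[R]_n -> R :=
  fun x => 'D_(delta_mx 0 i) f x.

(* C^oo on an open set U: all iterated partial derivatives exist and are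
   continuous at every point of U. *)
Definition smooth_on U f : Prop :=
  forall (s : seq 'I_n) (x : 'rV[R]_n), U x ->
    {for x, continuous (foldr partial f s)} /\
    forall i : 'I_n, derivable (foldr partial f s) x (delta_mx 0 i).

End SmoothFunctions.

Section Atlas.
Context {R : realType}.

(* The family of charts is indexed; [param c] is only meaningful as the inverse
   of [coord c] on [chart_range c]. *)
Record atlas (n : nat) (T : Type) := Atlas {
  chart : Type;
  chart_dom : chart -> set T;
  coord : chart -> T -> 'rV[R]_n;
  param : chart -> 'rV[R]_n -> T }.

Definition chart_range n T (A : atlas n T) (c : chart A) : set 'rV[R]_n :=
  coord c @` chart_dom c.

Definition transition n T (A : atlas n T) (c d : chart A) :
  'rV[R]_n -> 'rV[R]_n := coord d \o param c.

Record smooth_atlas n (T : topologicalType) (A : atlas n T) : Prop := {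
  atlas_cover : forall p : T, exists c : chart A, chart_dom c p;
  atlas_open_dom : forall c : chart A, open (chart_dom c);
  atlas_open_range : forall c : chart A, open (chart_range c);
  atlas_coordK : forall (c : chart A) p,
    chart_dom c p -> param c (coord c p) = p;
  atlas_coord_continuous : forall c : chart A,
    {within chart_dom c, continuous (coord c)};
  atlas_param_continuous : forall c : chart A,
    {within chart_range c, continuous (param c)};
  atlas_transition_smooth : forall (c d : chart A) (k : 'I_n),
    smooth_on (coord c @` (chart_dom c `&` chart_dom d))
      (fun x => transition c d x 0 k) }.

Record smooth_manifold (n : nat) := SmoothManifold {
  carrier : topologicalType;
  manifold_hausdorff : hausdorff_space carrier;
  manifold_second_countable : @second_countable carrier;
  manifold_atlas :> atlas n carrier;
  manifold_smooth : smooth_atlas manifold_atlas }.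

End Atlas.
Arguments atlas R n T : clear implicits.
Arguments smooth_manifold R n : clear implicits.

Section LocalForms.
Context {R : realType} {n : nat}.

(* Normalised so that (a \w b)(X, Y) = a(X) b(Y) - a(Y) b(X) for 1-forms. *)
Definition wedge (F : fieldType) k l
    (a : 'M[R]_(k, n) -> F) (b : 'M[R]_(l, n) -> F) : 'M[R]_(k + l, n) -> F :=
  fun v => (k`! * l`!)%:R^-1 *
    \sum_(s : 'S_(k + l))
      (-1) ^+ s * (a (usubmx (row_perm s v)) * b (dsubmx (row_perm s v))).

(* d w (v_0, .., v_k) = \sum_i (-1)^i D_{v_i} (w (v_0, .., ^v_i, .., v_k)) *)
Definition ext_deriv k (w : 'rV[R]_n -> 'M[R]_(k, n) -> R) :
    'rV[R]_n -> 'M[R]_(k.+1, n) -> R :=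
  fun x v => \sum_(i < k.+1)
    (-1) ^+ i * 'D_(row i v) (fun y => w y (row' i v)) x.

Definition ext_derivC k (w : 'rV[R]_n -> 'M[R]_(k, n) -> R[i]) :
    'rV[R]_n -> 'M[R]_(k.+1, n) -> R[i] :=
  fun x v => ext_deriv (fun y u => complex.Re (w y u)) x v
         +i* ext_deriv (fun y u => complex.Im (w y u)) x v.

Definition set_row k (i : 'I_k) (u : 'rV[R]_n) (v : 'M[R]_(k, n)) :
    'M[R]_(k, n) := \matrix_(j < k) (if j == i then u else row j v).

Definition multilinear_form k (a : 'M[R]_(k, n) -> R) : Prop :=
  forall (i : 'I_k) (v : 'M[R]_(k, n)) (t : R) (u w : 'rV[R]_n),
    a (set_row i (t *: u + w) v) = t * a (set_row i u v) + a (set_row i w v).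

Definition alternating_form k (a : 'M[R]_(k, n) -> R) : Prop :=
  forall (v : 'M[R]_(k, n)) (i j : 'I_k),
    i != j -> row i v = row j v -> a v = 0.

(* C-multilinear extension of a to complex vectors: expand a(.., x_j + i y_j, ..). *)
Definition complexify k (a : 'M[R]_(k, n) -> R[i]) (z : 'M[R[i]]_(k, n)) : R[i] :=
  \sum_(Y : {set 'I_k}) 'i%C ^+ #|Y| *
    a (\matrix_(j < k) (if j \in Y then row j (map_mx (@complex.Im R) z)
                                  else row j (map_mx (@complex.Re R) z))).

(* Projections of real vectors onto T^{1,0} and T^{0,1}. *)
Definition proj10 (J : 'M[R]_n) : 'M[R[i]]_n :=
  2%:R^-1 *: (1%:M - 'i%C *: map_mx (real_complex R) J).
Definition proj01 (J : 'M[R]_n) : 'M[R[i]]_n :=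
  2%:R^-1 *: (1%:M + 'i%C *: map_mx (real_complex R) J).

(* Component of type (p, q) with respect to J of a complex (p + q)-form. *)
Definition type_component (J : 'M[R]_n) (p q : nat)
    (a : 'M[R]_(p + q, n) -> R[i]) : 'M[R]_(p + q, n) -> R[i] :=
  fun v => \sum_(S : {set 'I_(p + q)} | #|S| == p)
    complexify a (\matrix_(j < p + q)
      (row j (map_mx (real_complex R) v)
         *m (if j \in S then proj10 J else proj01 J))).

End LocalForms.

Notation "a \w b" := (wedge a b) (at level 40, left associativity) : ring_scope.

Section Forms.
Context {R : realType}.

(* A differential k-form, given by its expressions in all charts. *)
Record diff_form n (M : smooth_manifold R n) (k : nat) := DiffForm {
  form_at :> chart M -> 'rV[R]_n -> 'M[R]_(k, n) -> R;
  form_multilinear : forall c x, chart_range c x ->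
    multilinear_form (form_at c x);
  form_alternating : forall c x, chart_range c x ->
    alternating_form (form_at c x);
  form_smooth : forall c (v : 'M[R]_(k, n)),
    smooth_on (chart_range c) (fun x => form_at c x v);
  form_compatible : forall (c d : chart M) (p : carrier M),
    chart_dom c p -> chart_dom d p -> forall v : 'M[R]_(k, n),
    form_at d (coord d p) (v *m jacobian (transition c d) (coord c p)) =
    form_at c (coord c p) v }.

End Forms.

Section Riemannian.
Context {R : realType} {n : nat} (g : 'rV[R]_n -> 'rV[R]_n -> 'rV[R]_n -> R).

Definition gram (x : 'rV[R]_n) : 'M[R]_n :=
  \matrix_(i < n, j < n) g x (delta_mx 0 i) (delta_mx 0 j).

Definition dgram (k i j : 'I_n) (x : 'rV[R]_n) : R :=
  partial k (fun y => gram y i j) x.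

(* Christoffel symbol Gamma^k_{ij} of the Levi-Civita connection *)
Definition christoffel (k i j : 'I_n) (x : 'rV[R]_n) : R :=
  2%:R^-1 * \sum_(l < n)
    invmx (gram x) k l * (dgram i j l x + dgram j i l x - dgram l i j x).

(* Ric(Y, Z) = tr (X |-> Rm(X, Y) Z) with
   Rm(X, Y) = [nabla_X, nabla_Y] - nabla_[X, Y] *)
Definition ricci_mx (x : 'rV[R]_n) : 'M[R]_n := \matrix_(i < n, j < n)
  \sum_(k < n) (partial k (christoffel k i j) x - partial i (christoffel k k j) x
    + \sum_(l < n) (christoffel k k l x * christoffel l i j x
                    - christoffel k i l x * christoffel l k j x)).

Definition ricci (x X Y : 'rV[R]_n) : R := (X *m ricci_mx x *m Y^T) 0 0.

End Riemannian.

Section SU2.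
Context {R : realType}.

Record su2_structure (M : smooth_manifold R 5) := SU2Structure {
  alpha : diff_form M 1;
  omega : 'I_3 -> diff_form M 2;
  alpha_nonzero : forall (c : chart M) x, chart_range c x ->
    exists X, alpha c x X != 0;
  omega_wedge : exists v : diff_form M 4,
    forall (c : chart M) x, chart_range c x ->
      (forall (i j : 'I_3) (X : 'M[R]_(4, 5)),
        (omega i c x \w omega j c x) X = if i == j then v c x X else 0) /\
      (exists X : 'M[R]_(5, 5), (v c x \w alpha c x) X != 0);
  omega_positive : forall (c : chart M) x, chart_range c x ->
    forall X Y : 'rV[R]_5,
      (forall Z : 'rV[R]_5, omega (@Ordinal 3 0 isT) c x (col_mx X Z) =
                            omega (@Ordinal 3 1 isT) c x (col_mx Y Z)) ->
      0 <= omega (@Ordinal 3 2 isT) c x (col_mx X Y) }.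

Context (M : smooth_manifold R 5) (S : su2_structure M).

Definition omega1 := omega S (@Ordinal 3 0 isT).
Definition omega2 := omega S (@Ordinal 3 1 isT).
Definition omega3 := omega S (@Ordinal 3 2 isT).

(* The columns of E are the covectors e^1, .., e^5. *)
Definition covector (E : 'M[R]_5) (k : 'I_5) : 'rV[R]_5 -> R :=
  fun X => (X *m E) 0 k.

Definition adapted_coframe (c : chart M) (x : 'rV[R]_5) (E : 'M[R]_5) : Prop :=
  let e1 := covector E (@Ordinal 5 0 isT) in
  let e2 := covector E (@Ordinal 5 1 isT) in
  let e3 := covector E (@Ordinal 5 2 isT) in
  let e4 := covector E (@Ordinal 5 3 isT) in
  let e5 := covector E (@Ordinal 5 4 isT) in
  [/\ E \in unitmx,
      alpha S c x = e5,
      omega1 c x = (e1 \w e2) \+ (e3 \w e4),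
      omega2 c x = (e1 \w e3) \- (e2 \w e4) &
      omega3 c x = (e1 \w e4) \+ (e2 \w e3)].

(* Adapted coframes at a point form an SU(2)-orbit, so that the metrics and the
   trace below do not depend on the choice made here. *)
Definition coframe (c : chart M) (x : 'rV[R]_5) : 'M[R]_5 :=
  xget 0 [set E | adapted_coframe c x E].

Definition dual_frame (c : chart M) (x : 'rV[R]_5) (k : 'I_5) : 'rV[R]_5 :=
  row k (invmx (coframe c x)).

Definition metric (c : chart M) (x X Y : 'rV[R]_5) : R :=
  \sum_(k < 5) covector (coframe c x) k X * covector (coframe c x) k Y.

Definition metricT (c : chart M) (x X Y : 'rV[R]_5) : R :=
  \sum_(k < 5 | (k < 4)%N)
    covector (coframe c x) k X * covector (coframe c x) k Y.

Definition reeb (c : chart M) (x : 'rV[R]_5) : 'rV[R]_5 :=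
  xget 0 [set X | alpha S c x X = 1 /\
                  forall Y : 'rV[R]_5, omega1 c x (col_mx X Y) = 0].

Definition J1 (c : chart M) (x : 'rV[R]_5) : 'M[R]_5 :=
  xget 0 [set J : 'M[R]_5 | reeb c x *m J = 0 /\
    forall Y : 'rV[R]_5, alpha S c x Y = 0 ->
      alpha S c x (Y *m J) = 0 /\
      forall X : 'rV[R]_5, alpha S c x X = 0 ->
        omega1 c x (col_mx X (Y *m J)) = metricT c x X Y].

Definition ric (c : chart M) : 'rV[R]_5 -> 'rV[R]_5 -> 'rV[R]_5 -> R :=
  ricci (metric c).

Definition ric_lambda (c : chart M) (x : 'rV[R]_5) : R :=
  \sum_(k < 5 | (k < 4)%N) ric c x (dual_frame c x k) (dual_frame c x k).

Definition ric_mu (c : chart M) (x : 'rV[R]_5) : R :=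
  ric c x (reeb c x) (reeb c x).

Definition ric0 (c : chart M) (x X Y : 'rV[R]_5) : R :=
  ric c x X Y - (ric_lambda c x / 4%:R * metricT c x X Y
                 + ric_mu c x * (alpha S c x X * alpha S c x Y)).

Definition alpha_Einstein : Prop :=
  forall (c : chart M) x, chart_range c x -> forall X Y, ric0 c x X Y = 0.

Definition sasaki_einstein : Prop :=
  forall (c : chart M) x, chart_range c x ->
    [/\ forall X, ext_deriv (alpha S c) x X = - 2%:R * omega1 c x X,
        forall X, ext_deriv (omega2 c) x X = 3%:R * (alpha S c x \w omega3 c x) X &
        forall X, ext_deriv (omega3 c) x X =
                  - 3%:R * (alpha S c x \w omega2 c x) X].

End SU2.

Section HalfFlat.
Context {R : realType}.

(* kappa, J and eps are given by their expressions in the charts of N. *)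
Definition symplectic_half_flat T (N : atlas R 6 T)
    (kappa : chart N -> 'rV[R]_6 -> 'M[R]_(2, 6) -> R)
    (J : chart N -> 'rV[R]_6 -> 'M[R]_6)
    (eps : chart N -> 'rV[R]_6 -> 'M[R]_(3, 6) -> R[i]) : Prop :=
  forall (c : chart N) y, chart_range c y ->
    [/\ forall v, ext_deriv (kappa c) y v = 0,
        forall v, @type_component R 6 (J c y) 3 1 (ext_derivC (eps c) y) v = 0 &
        forall v, ext_deriv (fun z u => complex.Re (eps c z u)) y v = 0].

End HalfFlat.

Section Cone.
Context {R : realType} (M : smooth_manifold R 5).

(* The charts of M x R^+ are the products of the charts of M with the identity
   of R^+, with t as last coordinate; M x R^+ is an open subset of M x R. *)
Definition cone : atlas R 6 (carrier M * R) := {|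
  chart := chart M;
  chart_dom := fun c => chart_dom c `*` [set t | 0 < t];
  coord := fun c p => row_mx (coord c p.1) p.2%:M : 'rV[R]_(5 + 1);
  param := fun c (y : 'rV[R]_(5 + 1)) =>
    (param c (lsubmx y), rsubmx y 0 0) |}.

Definition cone_t (y : 'rV[R]_(5 + 1)) : R := rsubmx y 0 0.

Definition cone_dt (v : 'M[R]_(1, 5 + 1)) : R := rsubmx v 0 0.

Definition cone_pullback k (a : diff_form M k) (c : chart M)
    (y : 'rV[R]_(5 + 1)) (v : 'M[R]_(k, 5 + 1)) : R :=
  a c (lsubmx y) (lsubmx v).

Context (S : su2_structure M).

Definition cone_kappa (c : chart cone) (y : 'rV[R]_6) (v : 'M[R]_(2, 6)) : R :=
  let t := cone_t y in
  t ^+ 2 * cone_pullback (omega1 S) c y v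
  + t * (cone_pullback (alpha S) c y \w cone_dt) v.

Definition cone_eps (c : chart cone) (y : 'rV[R]_6) (v : 'M[R]_(3, 6)) : R[i] :=
  let t := cone_t y in
  (t ^+ 2)%:C *
  ((fun u : 'M[R]_(2, 6) => cone_pullback (omega2 S) c y u
                            +i* cone_pullback (omega3 S) c y u)
   \w (fun u : 'M[R]_(1, 6) => (t * cone_pullback (alpha S) c y u)
                               +i* cone_dt u)) v.

(* J X = J1 X on ker alpha and J R_alpha = t d/dt, hence J (d/dt) = - R_alpha / t;
   a tangent vector of the cone is (X, s) = X + s d/dt. *)
Definition cone_J (c : chart cone) (y : 'rV[R]_6) : 'M[R]_6 :=
  let x := lsubmx (y : 'rV[R]_(5 + 1)) in
  let t := cone_t y in
  lin1_mx (fun v : 'rV[R]_(5 + 1) =>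
    let X := lsubmx v in
    let s := rsubmx v 0 0 in
    row_mx (X *m J1 S c x - (s / t) *: reeb S c x)
           (t * alpha S c x X)%:M : 'rV[R]_(5 + 1)).

End Cone.

(* Main.v *)
From HB Require Import structures.
From mathcomp Require Import all_boot all_order all_algebra all_fingroup.
From mathcomp Require Import complex ring lra.
From mathcomp Require Import all_classical all_reals all_analysis.
Require Import Defs.
Set Implicit Arguments.
Unset Strict Implicit.
Unset Printing Implicit Defensive.
Import Order.TTheory GRing.Theory Num.Theory.
Import numFieldNormedType.Exports.
Local Open Scope classical_set_scope.
Local Open Scope ring_scope.

(** Near each point there is a smooth adapted coframe. Let f_0, .., f_4 be its
    dual frame, numbered from 0, with f_4 the Reeb field, and T_a the matrix of
    the Levi-Civita connection in the direction f_a.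

    The cone forms depend polynomially on t. Hence d kappa = 0 splits into
    d alpha = - 2 omega_1 and d omega_1 = 0, and d Re eps = 0 splits into
    d omega_3 = - 3 alpha ^ omega_2 and d (omega_2 ^ alpha) = 0. Two of the three
    Sasaki-Einstein equations are thus immediate ([cone_dalpha],
    [cone_domega3]), and the question is d omega_2.

    In the frame these equations are linear in the T_a. Solving them
    ([torsion_solve]) gives d omega_2 = alpha ^ (3 omega_3 + tau), where tau is
    an anti-self-dual form on ker alpha with three components, encoded by
    p, q - 1 and r, where p, q, r are the entries (0,4), (1,4), (3,4) of T_0. The
    same solution shows that the self-dual part of the horizontal block of the
    T_a has constant coefficients. In the structure equation no derivative of it
    is left, so that the curvature component Om_ab(0,3) + Om_ab(1,2) is a
    quadratic polynomial in the entries T_a(b,4) ([curvature_sd3]).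

    By pair symmetry three trace-free components of the Ricci tensor on ker alpha
    are combinations of these curvature components and of Om_4b(i,4), in which
    the derivatives of the torsion cancel. They turn out to be multiples of
    q - 1, p and r ([torsion_vanishes]). If the metric is alpha-Einstein they
    vanish. Hence tau = 0, which is the remaining equation on the frame, and by
    trilinearity on all vectors.

    The curvature computation requires the metric to be differentiable, although
    it is given by a coframe chosen independently at each point. An adapted
    coframe satisfies quaternionic relations with the forms, from which its
    metric is a a^T - A_1 (A_2 + a a^T)^-1 A_3, where a and the A_k are the
    matrices of alpha and the omega_k ([adapted_metric]). This is a smooth
    expression in the forms. The same relations yield an adapted coframe from
    one vector whose part transverse to the Reeb field has length 1
    ([quat_coframe_adapted]), and thus a smooth one near each point. That adapted coframes exist at all follows
    from the wedge and positivity conditions: the relations express the Leibniz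
    rule for the contraction of omega_k ^ omega_l ^ alpha with a vector
    ([pf_dual_clifford]). *)

(** * Functions of class C^m *)

(** Recursion on the order, rather than quantification over lists of partial
    derivatives, makes closure under products and inverses an induction. *)
Fixpoint class_C_rec (R : realType) (n m : nat) (U : set 'rV[R]_n)
    (f : 'rV[R]_n -> R) : Prop :=
  (forall x, U x -> {for x, continuous f}) /\
  if m is m'.+1 then
    forall i : 'I_n, (forall x, U x -> derivable f x (delta_mx 0 i)) /\
                     class_C_rec m' U (partial i f)
  else True.

(** Locked, as are the differential operators below, so that unification does
    not unfold derivatives into limits. *)
HB.lock Definition class_C (R : realType) (n m : nat) (U : set 'rV[R]_n)
    (f : 'rV[R]_n -> R) : Prop := class_C_rec m U f.

Section FiniteSmoothness.
Context {R : realType} {n : nat}.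
Implicit Types (f g : 'rV[R]_n -> R) (U : set 'rV[R]_n) (x v : 'rV[R]_n).

Lemma derive_line f x v :
  'D_v f x = 'D_1 (fun h : R => f (h *: v + x)) 0.
Proof.
rewrite /derive; set g1 := fun h => h^-1 *: _; set g2 := fun h => h^-1 *: _.
suff -> : g1 = g2 by [].
by rewrite funeqE /g1 /g2 => h /=; rewrite addr0 scale0r add0r [_%:A]mulr1.
Qed.

Lemma open_near_eq U f g x : open U -> U x -> (forall y, U y -> f y = g y) ->
  \near x, f x = g x.
Proof.
move=> oU Ux fg; have : \forall y \near x, U y by exact: open_nbhs_nbhs.
by apply: filterS => y /fg.
Qed.

Lemma open_eq_continuous U f g x : open U -> U x ->
  (forall y, U y -> f y = g y) ->
  {for x, continuous f} -> {for x, continuous g}.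
Proof.
move=> oU Ux fg cf; suff: g @ x --> g x by [].
rewrite -(fg x Ux); apply: cvg_trans cf.
by apply: (@near_eq_cvg _ _ (nbhs x)); apply: (open_near_eq oU Ux) => y /fg.
Qed.

Lemma partial_congr U f g x i : open U -> U x ->
  (forall y, U y -> f y = g y) -> partial i f x = partial i g x.
Proof. by move=> oU Ux fg; apply/near_eq_derive/(open_near_eq oU Ux fg). Qed.

Lemma class_C0P U f :
  class_C 0 U f <-> forall x, U x -> {for x, continuous f}.
Proof. by rewrite class_C.unlock /=; split=> [[]|]. Qed.

Lemma class_CSP m U f : class_C m.+1 U f <->
  (forall x, U x -> {for x, continuous f}) /\
  forall i : 'I_n, (forall x, U x -> derivable f x (delta_mx 0 i)) /\
                   class_C m U (partial i f).
Proof. by rewrite class_C.unlock. Qed.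

Lemma class_C_continuous m U f x : class_C m U f -> U x -> {for x, continuous f}.
Proof. by case: m => [/class_C0P|m /class_CSP[]] cf *; apply: cf. Qed.

Lemma class_C_derivable m U f x :
  class_C m.+1 U f -> U x -> forall i : 'I_n, derivable f x (delta_mx 0 i).
Proof. by case/class_CSP=> _ df Ux i; apply: (df i).1. Qed.

Lemma class_C_partial m U f i : class_C m.+1 U f -> class_C m U (partial i f).
Proof. by case/class_CSP=> _ df; apply: (df i).2. Qed.

Lemma class_CW m U f : class_C m.+1 U f -> class_C m U f.
Proof.
elim: m f => [|m IH] f /class_CSP[cf df]; first exact/class_C0P.
apply/class_CSP; split=> // i; split; first exact: (df i).1.
exact/IH/(df i).2.
Qed.

Lemma class_CS m U V f : U `<=` V -> class_C m V f -> class_C m U f.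
Proof.
move=> UV; elim: m f => [|m IH] f.
  by move=> /class_C0P cf; apply/class_C0P => x /UV; exact: cf.
move=> /class_CSP[cf df]; apply/class_CSP; split=> [x /UV/cf|]//.
by move=> i; have [dfi Cfi] := df i; split=> [x /UV/dfi|]//; apply: IH.
Qed.

Lemma class_C_smooth_on m U f : smooth_on U f -> class_C m U f.
Proof.
elim: m f => [|m IH] f sf.
  by apply/class_C0P => x Ux; have [] := sf [::] x Ux.
apply/class_CSP; split=> [x Ux|i]; first by have [] := sf [::] x Ux.
split; first by move=> x Ux; have [_ /(_ i)] := sf [::] x Ux.
by apply: IH => s x Ux; rewrite -foldr_rcons; exact: sf.
Qed.

Lemma class_C_eq m U f g : open U -> (forall x, U x -> f x = g x) ->
  class_C m U f -> class_C m U g.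
Proof.
move=> oU; elim: m f g => [|m IH] f g fg.
  move=> /class_C0P cf; apply/class_C0P => x Ux.
  by apply: (open_eq_continuous oU Ux fg); apply: cf.
move=> /class_CSP[cf df]; apply/class_CSP; split=> [x Ux|i].
  by apply: (open_eq_continuous oU Ux fg); apply: cf.
split=> [x Ux|].
  by apply: near_eq_derivable ((df i).1 x Ux); apply: open_near_eq fg.
by apply: IH (df i).2 => x Ux; apply: partial_congr fg.
Qed.

Lemma class_C_cst m U (a : R) : class_C m U (fun=> a).
Proof.
have ca (b : R) x : U x -> {for x, continuous (fun=> b : R)}.
  by move=> _; exact: cst_continuous.
elim: m a => [|m IH] a; first by apply/class_C0P => x; exact: ca.
apply/class_CSP; split=> [|i]; first exact: ca.
split=> [x _|]; first exact: derivable_cst.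
have -> : partial i (fun=> a) = fun=> 0; last exact: IH.
by apply/funext => x; exact: derive_cst.
Qed.

Lemma class_CD m U f g : open U -> class_C m U f -> class_C m U g ->
  class_C m U (fun x => f x + g x).
Proof.
move=> oU; elim: m f g => [|m IH] f g.
  move=> /class_C0P cf /class_C0P cg; apply/class_C0P => x Ux.
  by apply: (cvgD (cf x Ux) (cg x Ux)).
move=> /class_CSP[cf df] /class_CSP[cg dg]; apply/class_CSP.
split=> [x Ux|i]; first by apply: (cvgD (cf x Ux) (cg x Ux)).
split=> [x Ux|]; first by apply: derivableD; [apply: (df i).1|apply: (dg i).1].
apply: class_C_eq (IH _ _ (df i).2 (dg i).2) => // x Ux.
by rewrite /partial -deriveD//; [apply: (df i).1|apply: (dg i).1].
Qed.

Lemma class_CM m U f g : open U -> class_C m U f -> class_C m U g ->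
  class_C m U (fun x => f x * g x).
Proof.
move=> oU; elim: m f g => [|m IH] f g Cf Cg.
  move: Cf Cg => /class_C0P cf /class_C0P cg; apply/class_C0P => x Ux.
  by apply: (cvgM (cf x Ux) (cg x Ux)).
have /class_CSP[cf df] := Cf; have /class_CSP[cg dg] := Cg.
apply/class_CSP; split=> [x Ux|i]; first by apply: (cvgM (cf x Ux) (cg x Ux)).
split=> [x Ux|]; first by apply: derivableM; [apply: (df i).1|apply: (dg i).1].
apply: class_C_eq (class_CD oU (IH _ _ (class_CW Cf) (dg i).2)
                               (IH _ _ (class_CW Cg) (df i).2)) => // x Ux.
by rewrite /partial -deriveM//; [apply: (df i).1|apply: (dg i).1].
Qed.

Lemma class_CN m U f : open U -> class_C m U f -> class_C m U (fun x => - f x).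
Proof.
move=> oU Cf; apply: class_C_eq (class_CM oU (class_C_cst m U (-1)) Cf) => //.
by move=> x _; rewrite mulN1r.
Qed.

(** The derivative - f' / f^2 involves 1/f only to a lower order. *)
Lemma class_CV m U f : open U -> (forall x, U x -> f x != 0) ->
  class_C m U f -> class_C m U (fun x => (f x)^-1).
Proof.
move=> oU f0; elim: m => [|m IH] Cf.
  by apply/class_C0P => x Ux; apply: (cvgV (f0 x Ux) (class_C_continuous Cf Ux)).
have /class_CSP[cf df] := Cf; apply/class_CSP.
split=> [x Ux|i]; first by apply: (cvgV (f0 x Ux) (cf x Ux)).
split=> [x Ux|]; first by apply: derivableV; [apply: f0|apply: (df i).1].
have CV := IH (class_CW Cf).
apply: class_C_eq (class_CN oU (class_CM oU (class_CM oU CV CV) (df i).2)) => //.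
move=> x Ux; rewrite /partial deriveV ?f0//; last exact: (df i).1.
by rewrite expr2 invfM [RHS]mulNr.
Qed.

(** As for the inverse: the derivative f' / (2 sqrt f) involves sqrt f only to a
    lower order. *)
Lemma class_C_sqrt m U f : open U -> (forall x, U x -> 0 < f x) ->
  class_C m U f -> class_C m U (fun x => Num.sqrt (f x)).
Proof.
move=> oU f0; elim: m => [|m IH] Cf.
  apply/class_C0P => x Ux; apply: continuous_comp (class_C_continuous Cf Ux) _.
  exact: sqrt_continuous.
have /class_CSP[cf df] := Cf.
have dsqrt i x : U x -> derivable (fun x => Num.sqrt (f x)) x (delta_mx 0 i) /\
    partial i (fun x => Num.sqrt (f x)) x
    = (2 * Num.sqrt (f x))^-1 * partial i f x.
  move=> Ux; have /derivable1P/derivableP di := (df i).1 x Ux.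
  have fx0 : 0 < f (0 *: delta_mx 0 i + x) by rewrite scale0r add0r f0.
  have ds := is_derive1_sqrt fx0.
  have dc := @is_derive1_comp _ Num.sqrt
    (fun h : R => f (h *: delta_mx 0 i + x)) 0 _ _ ds di.
  split; first by apply/derivable1P; case: dc.
  rewrite /partial derive_line; case: dc => _ ->.
  by rewrite [in RHS]derive_line scale0r add0r.
apply/class_CSP; split=> [x Ux|i].
  by apply: continuous_comp (cf x Ux) _; exact: sqrt_continuous.
split=> [x Ux|]; first by have [] := dsqrt i x Ux.
have C2s := class_CM oU (class_C_cst m U 2) (IH (class_CW Cf)).
apply: class_C_eq (class_CM oU (class_CV oU _ C2s) (df i).2) => //.
  by move=> x Ux; have [_ ->] := dsqrt i x Ux.
by move=> x Ux; rewrite mulf_neq0// ?pnatr_eq0// gt_eqF// sqrtr_gt0 f0.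
Qed.

Lemma class_C_sum m U (I : Type) (r : seq I) (P : pred I) (F : I -> 'rV[R]_n -> R) :
  open U -> (forall i, class_C m U (F i)) ->
  class_C m U (fun x => \sum_(i <- r | P i) F i x).
Proof.
move=> oU CF; elim: r => [|a r IH].
  by apply: class_C_eq (class_C_cst m U 0) => // x _; rewrite big_nil.
case Pa: (P a); last first.
  by apply: class_C_eq IH => // x _; rewrite big_cons Pa.
apply: class_C_eq (class_CD oU (CF a) IH) => // x _; by rewrite big_cons Pa.
Qed.

Lemma class_C_prod m U (I : Type) (r : seq I) (F : I -> 'rV[R]_n -> R) :
  open U -> (forall i, class_C m U (F i)) ->
  class_C m U (fun x => \prod_(i <- r) F i x).
Proof.
move=> oU CF; elim: r => [|a r IH].
  by apply: class_C_eq (class_C_cst m U 1) => // x _; rewrite big_nil.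
apply: class_C_eq (class_CM oU (CF a) IH) => // x _; by rewrite big_cons.
Qed.

End FiniteSmoothness.

Arguments class_C_derivable {R n m U f x} Cf Ux i : rename.

(** * Directional derivatives and symmetry of mixed partials *)

Section LineDerivatives.
Context {R : realType} {n : nat}.
Implicit Types (f : 'rV[R]_n -> R) (U : set 'rV[R]_n) (x y u v w : 'rV[R]_n).

Lemma is_derive_line f x v (s : R) : derivable f (s *: v + x) v ->
  is_derive s (1 : R) (fun t : R => f (t *: v + x)) ('D_v f (s *: v + x)).
Proof.
move=> df; apply: DeriveDef.
  move: df; rewrite /derivable.
  set g1 := fun h => h^-1 *: _; set g2 := fun h => h^-1 *: _.
  suff -> : g1 = g2 by [].
  by rewrite funeqE /g1 /g2 => h /=; rewrite [_%:A]mulr1 scalerDl addrA.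
rewrite /derive; set g1 := fun h => h^-1 *: _; set g2 := fun h => h^-1 *: _.
suff -> : g1 = g2 by [].
by rewrite funeqE /g1 /g2 => h /=; rewrite [_%:A]mulr1 scalerDl addrA.
Qed.

Lemma MVT_line f x v (h : R) :
  (forall s, `|s| <= `|h| -> derivable f (s *: v + x) v) ->
  exists2 s, `|s| <= `|h| &
    f (h *: v + x) - f x = h * 'D_v f (s *: v + x).
Proof.
move=> df.
pose phi t := f (t *: v + x).
have phi0 : phi 0 = f x by rewrite /phi scale0r add0r.
have dphi (s : R) : `|s| <= `|h| -> is_derive s (1 : R) phi ('D_v f (s *: v + x)).
  by move=> /df; exact: is_derive_line.
have cphi (a b : R) : (forall s, s \in `[a, b] -> `|s| <= `|h|) ->
    {within `[a, b], continuous phi}.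
  move=> ab; apply: derivable_within_continuous => s /ab /dphi.
  by case.
have [h0|h0] := leP 0 h.
  have inh (s : R) : s \in `[0, h] -> `|s| <= `|h|.
    by rewrite in_itv /= => /andP[s0 sh]; rewrite !ger0_norm.
  have dn (s : R) (sh : s \in `]0, h[) := dphi s (inh s (subset_itv_oo_cc sh)).
  have [s /inh sh] := MVT_segment h0 dn (cphi _ _ inh).
  by rewrite phi0 subr0 mulrC => e; exists s.
have inh (s : R) : s \in `[h, 0] -> `|s| <= `|h|.
  by rewrite in_itv /= => /andP[s0 sh]; rewrite !ler0_norm// ?lerN2// ltW.
have dn (s : R) (sh : s \in `]h, 0[) := dphi s (inh s (subset_itv_oo_cc sh)).
have [s /inh sh] := MVT_segment (ltW h0) dn (cphi _ _ inh).
rewrite phi0 sub0r => e; exists s => //.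
by rewrite -opprB e mulrN opprK mulrC.
Qed.

(** The points at which the mean value theorem along w evaluates a derivative
    are not known, but they are at distance O(h) from x. *)
Lemma near_small x u w (K : R) (P : 'rV[R]_n -> Prop) :
  (\forall y \near x, P y) ->
  \forall h \near (0 : R), forall s, `|s| <= K * `|h| ->
    P (s *: w + (h *: u + x)).
Proof.
move=> /nbhs_ballP[e /= e0 eP].
pose C := `|K| * `|w| + `|u| + 1.
have C0 : 0 < C by rewrite ltr_wpDl// addr_ge0// mulr_ge0.
near=> h => s sh; apply: eP; rewrite -ball_normE /=.
rewrite addrA opprD addrCA subrr addr0 normrN.
apply: le_lt_trans (ler_normD _ _) _; rewrite !normrZ.
have sh' : `|s| <= `|K| * `|h|.
  by apply: le_trans sh _; rewrite ler_wpM2r// ler_norm.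
apply: (@le_lt_trans _ _ (`|h| * C)).
  have := ler_wpM2r (normr_ge0 w) sh'; rewrite /C; have := normr_ge0 h; nra.
rewrite -ltr_pdivlMr//; near: h.
apply/nbhs_ballP; exists (e / C) => /=; first by rewrite divr_gt0.
by move=> h; rewrite -ball_normE /= sub0r normrN.
Unshelve. all: by end_near. Qed.

(** By the mean value theorem along w: the increment in the direction u + s w is
    the increment along u followed by one along w, and the latter is controlled
    by the continuity of the derivative. Adding the coordinate directions one by
    one shows that the directional derivatives of a C^1 function are linear in
    the direction. *)
Lemma is_derive_addZ f x u w (d s : R) :
  is_derive x u f d -> (\forall y \near x, derivable f y w) ->
  {for x, continuous (fun y => 'D_w f y)} ->
  is_derive x (u + s *: w) f (d + s * 'D_w f x).
Proof.
move=> [du <-] dw cw.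
suff lim : (fun h => h^-1 *: (f (h *: (u + s *: w) + x) - f x)) @ 0^' -->
    ('D_u f x + s * 'D_w f x : R).
  by apply: DeriveDef; [apply/cvg_ex; eexists; exact: lim|exact/cvg_lim].
have step : \forall h \near (0 : R)^', exists2 y : R, `|y| <= `|s| * `|h| &
    h^-1 *: (f (h *: (u + s *: w) + x) - f x) =
    h^-1 *: (f (h *: u + x) - f x) + s * 'D_w f (y *: w + (h *: u + x)).
  near=> h.
  have dh : forall y : R, `|y| <= `|s| * `|h| ->
      derivable f (y *: w + (h *: u + x)) w.
    by near: h; apply: cvg_within; exact: (@near_small x u w _ (fun z => derivable f z w)).
  have [|y] := @MVT_line f (h *: u + x) w (h * s).
    by move=> y; rewrite normrM mulrC => /dh.
  rewrite normrM mulrC => yh e; exists y => //.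
  have h0 : h != 0 by near: h; exact: nbhs_dnbhs_neq.
  have -> : h *: (u + s *: w) + x = (h * s) *: w + (h *: u + x).
    by rewrite scalerDr scalerA addrAC addrC.
  rewrite (_ : _ - f x = (f (h *: u + x) - f x) +
      h * (s * 'D_w f (y *: w + (h *: u + x)))); last by rewrite mulrA -e; ring.
  by rewrite scalerDr; congr (_ + _); rewrite [LHS]mulKf.
have cu : (fun h => h^-1 *: (f (h *: u + x) - f x)) @ 0^' --> 'D_u f x by exact: du.
apply/cvgrPdist_lt => e e0.
have e20 : 0 < e / 2 by rewrite divr_gt0.
have es0 : 0 < e / 2 / (`|s| + 1) by rewrite divr_gt0// ltr_wpDl.
move/cvgrPdist_lt : (cu) => /(_ _ e20) {}cu.
move/cvgrPdist_lt : (cw) => /(_ _ es0) {}cw.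
near=> h.
have [|y yh ->] := near step h; first by [].
rewrite opprD addrACA; apply: le_lt_trans (ler_normD _ _) _.
rewrite [e]splitr; apply: ltr_leD; first by near: h.
rewrite -mulrBr normrM.
have lt1 : forall y : R, `|y| <= `|s| * `|h| ->
    `|'D_w f x - 'D_w f (y *: w + (h *: u + x))| < e / 2 / (`|s| + 1).
  by near: h; apply: cvg_within; exact: (near_small u w _ cw).
apply: le_trans (ler_wpM2l (normr_ge0 s) (ltW (lt1 y yh))) _.
rewrite mulrA ler_pdivrMr ?ltr_wpDl// mulrDr mulr1 mulrC lerDl.
exact: ltW.
Unshelve. all: by end_near. Qed.

Lemma is_derive_class_C1 U f x v : open U -> class_C 1 U f -> U x ->
  is_derive x v f (\sum_i v 0 i * partial i f x).
Proof.
move=> oU Cf Ux; rewrite [v in is_derive _ v]row_sum_delta.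
elim: (index_enum _) => [|i r IH]; first by rewrite !big_nil; exact: is_derive0.
rewrite !big_cons addrC [X in is_derive _ _ _ X]addrC.
apply: is_derive_addZ IH _ _.
  have : \forall y \near x, U y by exact: open_nbhs_nbhs.
  by apply: filterS => y Uy; apply: class_C_derivable Cf Uy i.
exact: (class_C_continuous (class_C_partial i Cf) Ux).
Qed.

Lemma derive_class_C1 U f x v : open U -> class_C 1 U f -> U x ->
  'D_v f x = \sum_i v 0 i * partial i f x.
Proof. by move=> oU Cf Ux; case: (is_derive_class_C1 v oU Cf Ux). Qed.

(** By the mean value theorem along v and then along w, the second difference is
    h^2 times the mixed derivative at a point near x. As it is symmetric in v and
    w, the order of differentiation does not matter. *)
Lemma second_difference_cvg f x v w :
  (\forall y \near x, derivable f y v) ->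
  (\forall y \near x, derivable (fun z => 'D_v f z) y w) ->
  {for x, continuous (fun y => 'D_w (fun z => 'D_v f z) y)} ->
  (fun h : R => h ^- 2 *
    (f (h *: (v + w) + x) - f (h *: v + x) - f (h *: w + x) + f x)) @ 0^'
  --> 'D_w (fun z => 'D_v f z) x.
Proof.
move=> dv dw cw; apply/cvgrPdist_lt => e e0.
move/cvgrPdist_lt : (cw) => /(_ _ e0) {}cw.
have near2 (P : 'rV[R]_n -> Prop) : (\forall y \near x, P y) ->
    \forall h \near (0 : R)^', forall s t : R, `|s| <= `|h| -> `|t| <= `|h| ->
      P (t *: w + (s *: v + x)).
  move=> /nbhs_ballP[d /= d0 dP].
  have C0 : 0 < `|w| + `|v| + 1 by rewrite ltr_wpDl// addr_ge0.
  apply: cvg_within; near=> h => s t sh th; apply: dP; rewrite -ball_normE /=.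
  rewrite addrA opprD addrCA subrr addr0 normrN.
  apply: le_lt_trans (ler_normD _ _) _; rewrite !normrZ.
  apply: (@le_lt_trans _ _ (`|h| * (`|w| + `|v| + 1))).
    have := ler_wpM2r (normr_ge0 w) th; have := ler_wpM2r (normr_ge0 v) sh.
    have := normr_ge0 h; nra.
  rewrite -ltr_pdivlMr//; near: h.
  apply/nbhs_ballP; exists (d / (`|w| + `|v| + 1)) => /=.
    by rewrite divr_gt0.
  by move=> h; rewrite -ball_normE /= sub0r normrN.
have {}dv := near2 _ dv; have {}dw := near2 _ dw; have {}cw := near2 _ cw.
near=> h.
have h0 : h != 0 by near: h; exact: nbhs_dnbhs_neq.
have dvh : forall s t : R, `|s| <= `|h| -> `|t| <= `|h| ->
  derivable f (t *: w + (s *: v + x)) v by near: h; exact: dv.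
have dwh : forall s t : R, `|s| <= `|h| -> `|t| <= `|h| ->
  derivable (fun z => 'D_v f z) (t *: w + (s *: v + x)) w.
  by near: h; exact: dw.
pose g y := f (h *: w + y) - f y.
have dg (s : R) : `|s| <= `|h| -> is_derive (s *: v + x) v g
    ('D_v f (h *: w + (s *: v + x)) - 'D_v f (s *: v + x)).
  move=> sh; apply: is_deriveB; last first.
    apply/derivableP; have := dvh s 0 sh; rewrite normr0 scale0r add0r.
    by apply; exact: normr_ge0.
  have /derivableP[d1 e1] := dvh s h sh (lexx _).
  have E : (fun k => k^-1 *: ((f \o (fun y => h *: w + y)) (k *: v + (s *: v + x))
      - (f \o (fun y => h *: w + y)) (s *: v + x))) =
      (fun k => k^-1 *: (f (k *: v + (h *: w + (s *: v + x)))
      - f (h *: w + (s *: v + x)))).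
    by apply/funext => k /=; rewrite addrCA.
  apply: DeriveDef; first by rewrite /derivable E.
  by rewrite /derive E.
have [s sh eg] := MVT_line (fun s sh => @ex_derive _ _ _ _ _ _ _ (dg s sh)).
have [_ Dg] := dg s sh.
have [t th et] := MVT_line (fun t th => dwh s t sh th).
have -> : f (h *: (v + w) + x) - f (h *: v + x) - f (h *: w + x) + f x =
    h ^+ 2 * 'D_w (fun z => 'D_v f z) (t *: w + (s *: v + x)).
  have -> : h *: (v + w) + x = h *: w + (h *: v + x).
    by rewrite scalerDr addrAC addrC.
  rewrite expr2 -mulrA -et -Dg -eg /g; ring.
rewrite mulKf ?expf_neq0//.
have cwh : forall s t : R, `|s| <= `|h| -> `|t| <= `|h| ->
  `|'D_w (fun z => 'D_v f z) x -
    'D_w (fun z => 'D_v f z) (t *: w + (s *: v + x))| < e by near: h.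
exact: cwh.
Unshelve. all: by end_near. Qed.

Lemma partialC U f x i j : open U -> class_C 2 U f -> U x ->
  partial i (partial j f) x = partial j (partial i f) x.
Proof.
move=> oU Cf Ux.
have nU : \forall y \near x, U y by exact: open_nbhs_nbhs.
have main k l : (fun h : R => h ^- 2 *
    (f (h *: (delta_mx 0 k + delta_mx 0 l) + x) - f (h *: delta_mx 0 k + x)
     - f (h *: delta_mx 0 l + x) + f x)) @ 0^' --> partial l (partial k f) x.
  apply: second_difference_cvg.
  - by apply: filterS nU => y Uy; apply: class_C_derivable Cf Uy k.
  - apply: filterS nU => y Uy.
    exact: class_C_derivable (class_C_partial k Cf) Uy l.
  - exact: class_C_continuous (class_C_partial l (class_C_partial k Cf)) Ux.
apply: cvg_unique (main j i) _; first exact: Rhausdorff.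
have -> : (fun h : R => h ^- 2 *
    (f (h *: (delta_mx 0 j + delta_mx 0 i) + x) - f (h *: delta_mx 0 j + x)
     - f (h *: delta_mx 0 i + x) + f x)) = (fun h : R => h ^- 2 *
    (f (h *: (delta_mx 0 i + delta_mx 0 j) + x) - f (h *: delta_mx 0 i + x)
     - f (h *: delta_mx 0 j + x) + f x)).
  by apply/funext => h; rewrite [delta_mx _ _ + _]addrC; ring.
exact: main.
Qed.

End LineDerivatives.

(** * Matrix-valued functions and the Levi-Civita connection *)

(** One-step versions of mxE, which expands every operation at once. *)
Section MatrixEntries.
Context {R : pzRingType} {p q r : nat}.

Lemma addmxE (A B : 'M[R]_(p, q)) i j : (A + B) i j = A i j + B i j.
Proof. by rewrite mxE. Qed.

Lemma oppmxE (A : 'M[R]_(p, q)) i j : (- A) i j = - A i j.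
Proof. by rewrite mxE. Qed.

Lemma mulmxE (A : 'M[R]_(p, q)) (B : 'M[R]_(q, r)) i j :
  (A *m B) i j = \sum_k A i k * B k j.
Proof. by rewrite mxE. Qed.

Lemma scalemxE (a : R) (A : 'M[R]_(p, q)) i j : (a *: A) i j = a * A i j.
Proof. by rewrite mxE. Qed.

Lemma trmxE (A : 'M[R]_(p, q)) i j : A^T i j = A j i.
Proof. by rewrite mxE. Qed.

End MatrixEntries.

HB.lock Definition mpartial (R : realType) (n p q : nat) (i : 'I_n)
    (A : 'rV[R]_n -> 'M[R]_(p, q)) (x : 'rV[R]_n) : 'M[R]_(p, q) :=
  \matrix_(j, k) partial i (fun y => A y j k) x.

HB.lock Definition mclass_C (R : realType) (n p q m : nat) (U : set 'rV[R]_n)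
    (A : 'rV[R]_n -> 'M[R]_(p, q)) : Prop :=
  forall j k, class_C m U (fun y => A y j k).

Section MatrixCalculus.
Context {R : realType} {n : nat}.
Implicit Types (U : set 'rV[R]_n) (x : 'rV[R]_n).

Lemma mclass_CP p q m U (A : 'rV[R]_n -> 'M[R]_(p, q)) :
  mclass_C m U A <-> forall j k, class_C m U (fun y => A y j k).
Proof. by rewrite mclass_C.unlock. Qed.

Lemma eq_partial (f g : 'rV[R]_n -> R) i x :
  f =1 g -> partial i f x = partial i g x.
Proof. by move=> /funext ->. Qed.

Lemma mpartialE p q i (A : 'rV[R]_n -> 'M[R]_(p, q)) x j k :
  mpartial i A x j k = partial i (fun y => A y j k) x.
Proof. by rewrite mpartial.unlock mxE. Qed.

Section Closure.
Variables (U : set 'rV[R]_n).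
Hypothesis oU : open U.

Lemma mclass_C_eq p q m (A B : 'rV[R]_n -> 'M[R]_(p, q)) :
  (forall x, U x -> A x = B x) -> mclass_C m U A -> mclass_C m U B.
Proof.
move=> AB /mclass_CP CA; apply/mclass_CP => j k.
by apply: class_C_eq (CA j k) => // x Ux; rewrite AB.
Qed.

Lemma mclass_CW p q m (A : 'rV[R]_n -> 'M[R]_(p, q)) :
  mclass_C m.+1 U A -> mclass_C m U A.
Proof. by move=> /mclass_CP CA; apply/mclass_CP => j k; apply: class_CW. Qed.

Lemma mclass_C_cst p q m (A : 'M[R]_(p, q)) : mclass_C m U (fun=> A).
Proof. by apply/mclass_CP => j k; exact: class_C_cst. Qed.

Lemma mclass_CD p q m (A B : 'rV[R]_n -> 'M[R]_(p, q)) :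
  mclass_C m U A -> mclass_C m U B -> mclass_C m U (fun x => A x + B x).
Proof.
move=> /mclass_CP CA /mclass_CP CB; apply/mclass_CP => j k.
by apply: class_C_eq (class_CD oU (CA j k) (CB j k)) => // x _; rewrite mxE.
Qed.

Lemma mclass_CN p q m (A : 'rV[R]_n -> 'M[R]_(p, q)) :
  mclass_C m U A -> mclass_C m U (fun x => - A x).
Proof.
move=> /mclass_CP CA; apply/mclass_CP => j k.
by apply: class_C_eq (class_CN oU (CA j k)) => // x _; rewrite mxE.
Qed.

Lemma mclass_CB p q m (A B : 'rV[R]_n -> 'M[R]_(p, q)) :
  mclass_C m U A -> mclass_C m U B -> mclass_C m U (fun x => A x - B x).
Proof. by move=> CA CB; apply: mclass_CD CA (mclass_CN CB). Qed.

Lemma mclass_CM p q r m (A : 'rV[R]_n -> 'M[R]_(p, q))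
    (B : 'rV[R]_n -> 'M[R]_(q, r)) :
  mclass_C m U A -> mclass_C m U B -> mclass_C m U (fun x => A x *m B x).
Proof.
move=> /mclass_CP CA /mclass_CP CB; apply/mclass_CP => j k.
have CS := class_C_sum (index_enum 'I_q) xpredT oU
  (fun l => class_CM oU (CA j l) (CB l k)).
by apply: class_C_eq CS => // x _; rewrite mxE.
Qed.

Lemma mclass_CT p q m (A : 'rV[R]_n -> 'M[R]_(p, q)) :
  mclass_C m U A -> mclass_C m U (fun x => (A x)^T).
Proof.
move=> /mclass_CP CA; apply/mclass_CP => j k.
by apply: class_C_eq (CA k j) => // x _; rewrite mxE.
Qed.

Lemma mclass_CZ p q m (f : 'rV[R]_n -> R) (A : 'rV[R]_n -> 'M[R]_(p, q)) :
  class_C m U f -> mclass_C m U A -> mclass_C m U (fun x => f x *: A x).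
Proof.
move=> Cf /mclass_CP CA; apply/mclass_CP => j k.
by apply: class_C_eq (class_CM oU Cf (CA j k)) => // x _; rewrite mxE.
Qed.

Lemma class_C_det p m (A : 'rV[R]_n -> 'M[R]_p) :
  mclass_C m U A -> class_C m U (fun x => \det (A x)).
Proof.
move=> /mclass_CP CA; apply: class_C_sum => // s; apply: class_CM => //.
  exact: class_C_cst.
by apply: class_C_prod => // i; exact: CA.
Qed.

(** By Cramer's rule the entries of the inverse are rational functions of those
    of the matrix. *)
Lemma mclass_CV p m (A : 'rV[R]_n -> 'M[R]_p) :
  (forall x, U x -> A x \in unitmx) ->
  mclass_C m U A -> mclass_C m U (fun x => invmx (A x)).
Proof.
move=> uA CA.
have CD : class_C m U (fun x => (\det (A x))^-1).
  apply: class_CV => //; last exact: class_C_det.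
  by move=> x /uA; rewrite unitmxE unitfE.
apply: (@mclass_C_eq _ _ _ (fun x => (\det (A x))^-1 *: \adj (A x))).
  by move=> x Ux; rewrite /invmx uA.
apply: mclass_CZ => //; apply/mclass_CP => j k.
apply: (@class_C_eq _ _ _ _ (fun x => cofactor (A x) k j)) => //.
  by move=> x _; rewrite [RHS]mxE.
apply: class_CM => //; first exact: class_C_cst.
apply: class_C_det; apply/mclass_CP => a b.
move/mclass_CP: CA => CA.
by apply: class_C_eq (CA (lift k a) (lift j b)) => // x _; rewrite !mxE.
Qed.

Lemma mclass_C_mpartial p q m i (A : 'rV[R]_n -> 'M[R]_(p, q)) :
  mclass_C m.+1 U A -> mclass_C m U (mpartial i A).
Proof.
move=> /mclass_CP CA; apply/mclass_CP => j k.
apply: class_C_eq (class_C_partial i (CA j k)) => // x _.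
by rewrite mpartialE.
Qed.

Lemma mpartial_congr p q i (A B : 'rV[R]_n -> 'M[R]_(p, q)) x :
  (forall y, U y -> A y = B y) -> U x -> mpartial i A x = mpartial i B x.
Proof.
move=> AB Ux; apply/matrixP => j k; rewrite 2!mpartialE.
by apply: (partial_congr _ oU Ux) => y Uy; rewrite AB.
Qed.

Lemma mpartialD p q i (A B : 'rV[R]_n -> 'M[R]_(p, q)) x :
  mclass_C 1 U A -> mclass_C 1 U B -> U x ->
  mpartial i (fun y => A y + B y) x = mpartial i A x + mpartial i B x.
Proof.
move=> /mclass_CP CA /mclass_CP CB Ux; apply/matrixP => j k; rewrite [RHS]mxE !mpartialE.
rewrite (@eq_partial _ (fun y => A y j k + B y j k)); last by move=> y; rewrite mxE.
apply: (@deriveD _ _ _ (fun y => A y j k) (fun y => B y j k)).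
- exact: class_C_derivable (CA j k) Ux i.
- exact: class_C_derivable (CB j k) Ux i.
Qed.

Lemma mpartialN p q i (A : 'rV[R]_n -> 'M[R]_(p, q)) x :
  mclass_C 1 U A -> U x ->
  mpartial i (fun y => - A y) x = - mpartial i A x.
Proof.
move=> /mclass_CP CA Ux; apply/matrixP => j k; rewrite [RHS]mxE !mpartialE.
rewrite (@eq_partial _ (fun y => - A y j k)); last by move=> y; rewrite mxE.
apply: (@deriveN _ _ _ (fun y => A y j k)).
exact: class_C_derivable (CA j k) Ux i.
Qed.

Lemma mpartialM p q r i (A : 'rV[R]_n -> 'M[R]_(p, q))
    (B : 'rV[R]_n -> 'M[R]_(q, r)) x :
  mclass_C 1 U A -> mclass_C 1 U B -> U x ->
  mpartial i (fun y => A y *m B y) x = mpartial i A x *m B x + A x *m mpartial i B x.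
Proof.
move=> /mclass_CP CA /mclass_CP CB Ux; apply/matrixP => j k; rewrite mpartialE addmxE !mulmxE /partial.
have dA l := class_C_derivable (CA j l) Ux i.
have dB l := class_C_derivable (CB l k) Ux i.
rewrite -big_split /=.
have -> : (fun y => (A y *m B y) j k) =
    \sum_(l < q) ((fun y => A y j l) * (fun y => B y l k)).
  by apply/funext => y; rewrite mxE fct_sumE.
rewrite derive_sum; last by move=> l; exact: derivableM.
apply: eq_bigr => l _; rewrite deriveM// !mpartialE addrC.
by congr (_ + _); exact: mulrC.
Qed.

Lemma mpartialT p q i (A : 'rV[R]_n -> 'M[R]_(p, q)) x :
  mpartial i (fun y => (A y)^T) x = (mpartial i A x)^T.
Proof.
apply/matrixP => j k; rewrite [RHS]mxE !mpartialE.
by apply: eq_partial => y; rewrite mxE.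
Qed.

Lemma mpartial_cst p q i (A : 'M[R]_(p, q)) x : mpartial i (fun=> A) x = 0.
Proof.
apply/matrixP => j k; rewrite mpartialE [RHS]mxE; exact: derive_cst.
Qed.

Lemma mpartialC p q i j (A : 'rV[R]_n -> 'M[R]_(p, q)) x :
  mclass_C 2 U A -> U x ->
  mpartial i (mpartial j A) x = mpartial j (mpartial i A) x.
Proof.
move=> /mclass_CP CA Ux; apply/matrixP => k l.
have e a b : mpartial a (mpartial b A) x k l =
    partial a (partial b (fun y => A y k l)) x.
  by rewrite mpartialE; apply: eq_partial => y; exact: mpartialE.
rewrite [LHS]e [RHS]e.
exact: partialC oU (CA k l) Ux.
Qed.

End Closure.
End MatrixCalculus.

(** Vectors are rows, so that the covariant derivative of a vector field v is
    d_i v + v *m chr g i. *)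
HB.lock Definition chr (R : realType) (n : nat)
    (g : 'rV[R]_n -> 'rV[R]_n -> 'rV[R]_n -> R) (i : 'I_n) (x : 'rV[R]_n) :
    'M[R]_n :=
  \matrix_(j, k) christoffel g k i j x.

(** Row k is the vector R(d_i, d_j) d_k. *)
HB.lock Definition riem (R : realType) (n : nat)
    (g : 'rV[R]_n -> 'rV[R]_n -> 'rV[R]_n -> R) (i j : 'I_n) (x : 'rV[R]_n) :
    'M[R]_n :=
  mpartial i (chr g j) x - mpartial j (chr g i) x
  + chr g j x *m chr g i x - chr g i x *m chr g j x.

Section LeviCivita.
Context {R : realType} {n : nat}.
Variables (g : 'rV[R]_n -> 'rV[R]_n -> 'rV[R]_n -> R) (U : set 'rV[R]_n).
Hypothesis oU : open U.
Hypothesis CG : mclass_C 2 U (gram g).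
Hypothesis uG : forall x, U x -> gram g x \in unitmx.
Hypothesis sG : forall x, U x -> (gram g x)^T = gram g x.

Lemma chr_entry i j k x : chr g i x j k = christoffel g k i j x.
Proof. by rewrite chr.unlock mxE. Qed.

Lemma dgram_sym l i j x : U x -> dgram g l i j x = dgram g l j i x.
Proof.
move=> Ux; apply: (partial_congr _ oU Ux) => y Uy.
by rewrite -(sG Uy) mxE sG.
Qed.

Lemma chr_sym i j k x : U x -> chr g i x j k = chr g j x i k.
Proof.
move=> Ux; rewrite !chr_entry /christoffel; congr (_ * _).
apply: eq_bigr => l _; congr (_ * _); rewrite (dgram_sym l i j Ux); ring.
Qed.

(** The Christoffel symbols with the upper index lowered. *)
Definition dgram_mx (i : 'I_n) x : 'M[R]_n := \matrix_(j, l)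
  (2^-1 * (dgram g i j l x + dgram g j i l x - dgram g l i j x)).

Lemma invgram_sym x : U x -> (invmx (gram g x))^T = invmx (gram g x).
Proof. by move=> Ux; rewrite trmx_inv sG. Qed.

Lemma chrE i x : U x -> chr g i x = dgram_mx i x *m invmx (gram g x).
Proof.
move=> Ux; apply/matrixP => j k.
rewrite chr_entry [RHS]mxE /christoffel mulr_sumr; apply: eq_bigr => l _.
by rewrite -[in RHS](invgram_sym Ux) !mxE; ring.
Qed.

(** The connection is metric because the part of dgram_mx that is antisymmetric
    in its two matrix indices cancels in the sum. *)
Lemma chr_compat i x : U x ->
  mpartial i (gram g) x = chr g i x *m gram g x + gram g x *m (chr g i x)^T.
Proof.
move=> Ux; rewrite chrE// trmx_mul invgram_sym// mulmxKV ?uG// mulKVmx ?uG//.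
apply/matrixP => j k; rewrite mpartialE addmxE trmxE !mxE.
rewrite [partial i _ x](_ : _ = dgram g i j k x) //.
by rewrite (dgram_sym i k j Ux); field.
Qed.

Lemma mclass_C_chr i : mclass_C 1 U (chr g i).
Proof.
apply: (@mclass_C_eq _ _ _ oU _ _ _
    (fun x => dgram_mx i x *m invmx (gram g x))).
  by move=> x Ux; rewrite chrE.
apply: mclass_CM => //; last by apply: mclass_CV => //; exact: mclass_CW.
apply/mclass_CP => j k; apply: (@class_C_eq _ _ _ _ (fun x =>
    2^-1 * (dgram g i j k x + dgram g j i k x - dgram g k i j x))) => //.
  by move=> x _; rewrite mxE.
have Cd a b c : class_C 1 U (dgram g a b c) by apply: class_C_partial; move/mclass_CP: CG.
apply: class_CM => //; first exact: class_C_cst.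
by apply: class_CD => //; [exact: class_CD|exact: class_CN].
Qed.

Lemma riemE i j k l x : riem g i j x k l =
  mpartial i (chr g j) x k l - mpartial j (chr g i) x k l
  + \sum_m chr g j x k m * chr g i x m l - \sum_m chr g i x k m * chr g j x m l.
Proof. by rewrite riem.unlock 3!addmxE 2!oppmxE 2!mulmxE. Qed.

Lemma ricci_mxE i j x : ricci_mx g x i j = \sum_k riem g k i x j k.
Proof.
have chE a b c d : mpartial a (chr g b) x c d = partial a (christoffel g d b c) x.
  by rewrite mpartialE; apply: eq_partial => y; exact: chr_entry.
rewrite mxE; apply: eq_bigr => k _.
rewrite riemE 2!chE sumrB addrA; congr (_ + _ - _); apply: eq_bigr => l _.
  by rewrite (chr_entry i) (chr_entry k) mulrC.
by rewrite (chr_entry i) (chr_entry k) mulrC.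
Qed.

(** All terms cancel in pairs by the symmetry of the Christoffel symbols. *)
Lemma riem_bianchi i j k l x : U x ->
  riem g i j x k l + riem g j k x i l + riem g k i x j l = 0.
Proof.
move=> Ux; rewrite !riemE.
have dchr a b c : mpartial a (chr g b) x c l = mpartial a (chr g c) x b l.
  rewrite 2!mpartialE.
  by apply: (partial_congr _ oU Ux) => y Uy; rewrite chr_sym.
rewrite (dchr i k j) (dchr j i k) (dchr k j i).
have q a b c : \sum_m chr g a x b m * chr g c x m l
    = \sum_m chr g b x a m * chr g c x m l.
  by apply: eq_bigr => m _; rewrite (chr_sym a).
rewrite (q j k i) (q k i j) (q i j k); ring.
Qed.

End LeviCivita.

(** * Connection and curvature in a moving frame *)

(** The matrix of the covariant derivative along the i-th coordinate vector, in
    the frame dual to the coframe E. *)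
HB.lock Definition conn (R : realType) (n : nat)
    (g : 'rV[R]_n -> 'rV[R]_n -> 'rV[R]_n -> R) (E : 'rV[R]_n -> 'M[R]_n)
    (i : 'I_n) (x : 'rV[R]_n) : 'M[R]_n :=
  invmx (E x) *m (chr g i x *m E x - mpartial i E x).

HB.lock Definition curv (R : realType) (n : nat)
    (g : 'rV[R]_n -> 'rV[R]_n -> 'rV[R]_n -> R) (E : 'rV[R]_n -> 'M[R]_n)
    (i j : 'I_n) (x : 'rV[R]_n) : 'M[R]_n :=
  mpartial i (conn g E j) x - mpartial j (conn g E i) x
  - conn g E i x *m conn g E j x + conn g E j x *m conn g E i x.

(** From here on the directions, too, are vectors of the frame. *)
HB.lock Definition fconn (R : realType) (n : nat)
    (g : 'rV[R]_n -> 'rV[R]_n -> 'rV[R]_n -> R) (E : 'rV[R]_n -> 'M[R]_n)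
    (a : 'I_n) (x : 'rV[R]_n) : 'M[R]_n :=
  \sum_i invmx (E x) a i *: conn g E i x.

HB.lock Definition fcurv (R : realType) (n : nat)
    (g : 'rV[R]_n -> 'rV[R]_n -> 'rV[R]_n -> R) (E : 'rV[R]_n -> 'M[R]_n)
    (a b : 'I_n) (x : 'rV[R]_n) : 'M[R]_n :=
  \sum_i \sum_j (invmx (E x) a i * invmx (E x) b j) *: curv g E i j x.

HB.lock Definition fder (R : realType) (n p q : nat) (E : 'rV[R]_n -> 'M[R]_n)
    (a : 'I_n) (A : 'rV[R]_n -> 'M[R]_(p, q)) (x : 'rV[R]_n) : 'M[R]_(p, q) :=
  \sum_i invmx (E x) a i *: mpartial i A x.

Section MovingFrame.
Context {R : realType} {n : nat}.
Variables (g : 'rV[R]_n -> 'rV[R]_n -> 'rV[R]_n -> R) (U : set 'rV[R]_n).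
Variable E : 'rV[R]_n -> 'M[R]_n.
Hypothesis oU : open U.
Hypothesis CE : mclass_C 2 U E.
Hypothesis uE : forall x, U x -> E x \in unitmx.
Hypothesis gE : forall x, U x -> gram g x = E x *m (E x)^T.

Lemma frame_gram_class : mclass_C 2 U (gram g).
Proof.
apply: (@mclass_C_eq _ _ _ oU _ _ _ (fun x => E x *m (E x)^T)).
  by move=> x Ux; rewrite gE.
by apply: mclass_CM => //; apply: mclass_CT.
Qed.

Lemma frame_gram_unit x : U x -> gram g x \in unitmx.
Proof. by move=> Ux; rewrite gE// unitmx_mul unitmx_tr uE. Qed.

Lemma frame_gram_sym x : U x -> (gram g x)^T = gram g x.
Proof. by move=> Ux; rewrite gE// trmx_mul trmxK. Qed.

Let CG := frame_gram_class.
Let uG := frame_gram_unit.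
Let sG := frame_gram_sym.

Lemma coframe_mpartial i x : U x ->
  mpartial i E x = chr g i x *m E x - E x *m conn g E i x.
Proof.
by move=> Ux; rewrite conn.unlock mulKVmx ?uE// opprB addrC subrK.
Qed.

(** The connection is metric and the frame is orthonormal. *)
Lemma conn_antisym i x : U x -> (conn g E i x)^T = - conn g E i x.
Proof.
move=> Ux; have := chr_compat oU uG sG i Ux.
rewrite (mpartial_congr oU _ gE Ux).
have CET : mclass_C 1 U (fun y => (E y)^T).
  by apply: mclass_CT => //; exact: mclass_CW.
rewrite (mpartialM _ (mclass_CW CE) CET) // mpartialT coframe_mpartial// gE//.
have := uE Ux.
move: (conn _ _ _ _) (E x) (chr g i x) => K e c ue H.
have eK : e *m (K^T + K) *m e^T = 0.
  move: H; rewrite linearB /= !trmx_mul mulmxBl mulmxBr mulmxDr mulmxDl !mulmxA.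
  move: (c *m e *m e^T) (e *m K *m e^T) (e *m e^T *m c^T) (e *m K^T *m e^T).
  move=> p a q b; rewrite addrACA => /eqP.
  by rewrite -subr_eq0 [X in X - _]addrC addrK -opprD oppr_eq0 addrC => /eqP.
have eT : e^T \in unitmx by rewrite unitmx_tr.
apply/eqP; rewrite -addr_eq0; apply/eqP.
by rewrite -(mulKmx ue (K^T + K)) -(mulmxK eT (e *m _)) eK mul0mx mulmx0.
Qed.

Lemma mclass_C_invE : mclass_C 2 U (fun x => invmx (E x)).
Proof. exact: mclass_CV. Qed.

Lemma mclass_C_conn i : mclass_C 1 U (conn g E i).
Proof.
apply: (@mclass_C_eq _ _ _ oU _ _ _
  (fun x => invmx (E x) *m (chr g i x *m E x - mpartial i E x))).
  by move=> x _; rewrite conn.unlock.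
apply: mclass_CM; [by []|exact/mclass_CW/mclass_C_invE|].
apply: mclass_CB; [by []| |exact: mclass_C_mpartial].
by apply: mclass_CM; [by []|exact: mclass_C_chr|exact: mclass_CW].
Qed.

(** Curvature is tensorial: differentiating chr E = dE + E conn once more and
    antisymmetrising removes the second derivatives of E. *)
Lemma riem_curv i j x : U x -> riem g i j x *m E x = E x *m curv g E i j x.
Proof.
move=> Ux.
have CE1 := mclass_CW CE.
have H k l : mpartial k (chr g l) x *m E x = mpartial k (mpartial l E) x
    + E x *m mpartial k (conn g E l) x
    + (chr g k x *m E x - E x *m conn g E k x) *m conn g E l x
    - chr g l x *m (chr g k x *m E x - E x *m conn g E k x).
  have e : forall y, U y -> chr g l y *m E y = mpartial l E y + E y *m conn g E l y.
    by move=> y Uy; rewrite coframe_mpartial// subrK.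
  have := mpartial_congr oU k e Ux.
  have Cc : mclass_C 1 U (chr g l) by exact: mclass_C_chr.
  have CK : mclass_C 1 U (conn g E l) by exact: mclass_C_conn.
  have CdE : mclass_C 1 U (mpartial l E) by exact: mclass_C_mpartial.
  have CEK : mclass_C 1 U (fun y => E y *m conn g E l y) by exact: mclass_CM.
  rewrite (mpartialM _ Cc CE1)// (mpartialD _ CdE CEK)//.
  rewrite (mpartialM _ CE1 CK)// coframe_mpartial//.
  move=> H; rewrite -[LHS](addrK (chr g l x *m (chr g k x *m E x - E x *m conn g E k x))).
  by rewrite H [X in _ + X - _]addrC addrA.
rewrite riem.unlock curv.unlock mulmxDl mulNmx mulmxDl mulmxBl !H.
rewrite (mpartialC oU i j CE Ux) !mulmxDr !mulmxN !mulmxBl !mulmxA.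
do ![move: (_ *m _) => ?]; move: (mpartial _ _ _) => ?.
by apply/matrixP => k l; rewrite !mxE; ring.
Qed.

Lemma curv_antisym_frame i j x : U x -> (curv g E i j x)^T = - curv g E i j x.
Proof.
move=> Ux.
have d k l : (mpartial k (conn g E l) x)^T = - mpartial k (conn g E l) x.
  rewrite -mpartialT -(mpartialN _ (mclass_C_conn l))//.
  by apply: (mpartial_congr oU) Ux => y Uy; exact: conn_antisym.
rewrite curv.unlock !linearD !linearN /= !trmx_mul !d !conn_antisym//.
rewrite !mulmxN !mulNmx !opprK.
do ![move: (_ *m _) => ?]; move: (mpartial _ _ _) (mpartial _ _ _) => ? ?.
by apply/matrixP => k l; rewrite !mxE; ring.
Qed.

Lemma curv_antisym i j x : curv g E j i x = - curv g E i j x.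
Proof.
rewrite curv.unlock; do ![move: (_ *m _) => ?]; move: (mpartial _ _ _) (mpartial _ _ _) => ? ?.
by apply/matrixP => k l; rewrite !mxE; ring.
Qed.

Lemma conn_fconn j x : U x -> conn g E j x = \sum_d E x j d *: fconn g E d x.
Proof.
move=> Ux; rewrite fconn.unlock.
under eq_bigr do rewrite scaler_sumr.
rewrite exchange_big /= (bigD1 j)//= [X in _ + X]big1 ?addr0 => [|i ij].
  under eq_bigr do rewrite scalerA.
  by rewrite -scaler_suml -mulmxE mulmxV ?uE// mxE eqxx scale1r.
under eq_bigr do rewrite scalerA.
by rewrite -scaler_suml -mulmxE mulmxV ?uE// mxE eq_sym (negPf ij) scale0r.
Qed.

Lemma fconn_antisym a x : U x -> (fconn g E a x)^T = - fconn g E a x.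
Proof.
move=> Ux; rewrite fconn.unlock linear_sum -sumrN; apply: eq_bigr => i _.
by rewrite linearZ /= conn_antisym// scalerN.
Qed.

Lemma mclass_C_fconn a : mclass_C 1 U (fconn g E a).
Proof.
apply/mclass_CP => j k; apply: (@class_C_eq _ _ _ _
    (fun x => \sum_i invmx (E x) a i * conn g E i x j k)) => //.
  move=> x _; rewrite fconn.unlock summxE.
  by apply: eq_bigr => i _; rewrite scalemxE.
apply: class_C_sum => // i; apply: class_CM => //.
  by move/mclass_CP: (mclass_CW mclass_C_invE).
by move/mclass_CP: (mclass_C_conn i).
Qed.

Lemma fcurv_antisym_frame a b x : U x -> (fcurv g E a b x)^T = - fcurv g E a b x.
Proof.
move=> Ux; rewrite fcurv.unlock linear_sum -sumrN; apply: eq_bigr => i _.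
rewrite linear_sum -sumrN; apply: eq_bigr => j _.
by rewrite linearZ /= curv_antisym_frame// scalerN.
Qed.

Lemma fcurv_antisym a b x : fcurv g E b a x = - fcurv g E a b x.
Proof.
rewrite fcurv.unlock exchange_big -sumrN; apply: eq_bigr => i _.
rewrite -sumrN; apply: eq_bigr => j _.
by rewrite curv_antisym scalerN mulrC.
Qed.

Lemma fcurvE a b c d x : U x -> fcurv g E a b x c d =
  \sum_i \sum_j \sum_k \sum_l invmx (E x) a i * invmx (E x) b j *
    invmx (E x) c k * E x l d * riem g i j x k l.
Proof.
move=> Ux; rewrite fcurv.unlock summxE; apply: eq_bigr => i _.
rewrite summxE; apply: eq_bigr => j _; rewrite scalemxE.
rewrite -[curv g E i j x](mulKmx (uE Ux)) -riem_curv// mulmxE mulr_sumr.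
apply: eq_bigr => k _; rewrite mulmxE mulr_sumr mulr_sumr.
by apply: eq_bigr => l _; ring.
Qed.

Lemma fcurv_bianchi a b c d x : U x ->
  fcurv g E a b x c d + fcurv g E b c x a d + fcurv g E c a x b d = 0.
Proof.
move=> Ux; pose F := invmx (E x).
have e1 : fcurv g E b c x a d = \sum_i \sum_j \sum_k \sum_l
    F a i * F b j * F c k * E x l d * riem g j k x i l.
  rewrite fcurvE// -/F; under eq_bigr do rewrite exchange_big /=.
  rewrite exchange_big /=; apply: eq_bigr => i _; apply: eq_bigr => j _.
  by apply: eq_bigr => k _; apply: eq_bigr => l _; ring.
have e2 : fcurv g E c a x b d = \sum_i \sum_j \sum_k \sum_l
    F a i * F b j * F c k * E x l d * riem g k i x j l.
  rewrite fcurvE// -/F exchange_big /=; apply: eq_bigr => i _.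
  rewrite exchange_big /=; apply: eq_bigr => j _.
  by apply: eq_bigr => k _; apply: eq_bigr => l _; ring.
rewrite fcurvE// e1 e2 -!big_split big1// => i _.
rewrite -!big_split big1// => j _; rewrite -!big_split big1// => k _.
rewrite -!big_split big1// => l _ /=.
by rewrite -!mulrDr (riem_bianchi oU sG)// mulr0.
Qed.

Lemma ricci_fcurv b c x : U x ->
  ricci g x (row b (invmx (E x))) (row c (invmx (E x))) =
  \sum_d fcurv g E d b x c d.
Proof.
move=> Ux; pose F := invmx (E x).
rewrite /ricci mulmxE.
transitivity (\sum_j \sum_k \sum_i F b j * F c k * riem g i j x k i).
  rewrite exchange_big; apply: eq_bigr => k _.
  rewrite mulmxE mulr_suml; apply: eq_bigr => j _.
  rewrite trmxE [row b _ _ _]mxE [row c _ _ _]mxE -/F.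
  rewrite ricci_mxE mulr_sumr mulr_suml; apply: eq_bigr => i _; ring.
symmetry; under eq_bigr do rewrite fcurvE//.
rewrite exchange_big /=; under eq_bigr do rewrite exchange_big /=.
rewrite exchange_big /=; apply: eq_bigr => j _.
under eq_bigr do rewrite exchange_big /=.
rewrite exchange_big /=; apply: eq_bigr => k _.
apply: eq_bigr => i _.
rewrite exchange_big /= (bigD1 i)//= [X in _ + X]big1 ?addr0 => [|l li].
  rewrite (eq_bigr (fun d => E x i d * F d i *
    (F b j * F c k * riem g i j x k i))); last by move=> d _; rewrite /F; ring.
  by rewrite -mulr_suml -mulmxE mulmxV ?uE// mxE eqxx mul1r.
rewrite (eq_bigr (fun d => E x l d * F d i *
  (F b j * F c k * riem g i j x k l))); last by move=> d _; rewrite /F; ring.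
by rewrite -mulr_suml -mulmxE mulmxV ?uE// mxE (negPf li) mul0r.
Qed.

(** Cartan's second structure equation. As the connection is torsion-free, the
    last sum is minus the connection along the bracket of the a-th and b-th frame
    vectors. *)
Lemma fcurv_structure a b x : U x ->
  fcurv g E a b x = fder E a (fconn g E b) x - fder E b (fconn g E a) x
    - fconn g E a x *m fconn g E b x + fconn g E b x *m fconn g E a x
    + \sum_d (fconn g E b x a d - fconn g E a x b d) *: fconn g E d x.
Proof.
move=> Ux; pose F := invmx (E x); pose T := fconn g E.
have CE1 := mclass_CW CE.
pose dE i j d := mpartial i E x j d.
have dconn i j : mpartial i (conn g E j) x =
    \sum_d (dE i j d *: T d x + E x j d *: mpartial i (T d) x).
  apply/matrixP => k l; rewrite summxE mpartialE.
  transitivity (partial i (\sum_d ((fun y => E y j d) * (fun y => T d y k l))) x).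
    apply: (partial_congr _ oU Ux) => y Uy; rewrite conn_fconn// summxE fct_sumE.
    by apply: eq_bigr => d _; rewrite scalemxE.
  have dA d : derivable (fun y => E y j d) x (delta_mx 0 i).
    by apply: (class_C_derivable (U := U) (m := 0)) => //; move/mclass_CP: CE1.
  have dB d : derivable (fun y => T d y k l) x (delta_mx 0 i).
    apply: (class_C_derivable (U := U) (m := 0)) => //.
    by move/mclass_CP: (mclass_C_fconn d).
  rewrite /partial derive_sum; last by move=> d; exact: derivableM.
  apply: eq_bigr => d _; rewrite deriveM// addmxE 2!scalemxE /dE 2!mpartialE.
  by rewrite addrC; congr (_ + _); exact: mulrC.
have half a' b' : \sum_i \sum_j (F a' i * F b' j) *: mpartial i (conn g E j) x =
    fder E a' (T b') x +
    \sum_d (\sum_i \sum_j F a' i * F b' j * dE i j d) *: T d x.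
  under eq_bigr => i _ do under eq_bigr => j _ do
    rewrite dconn scaler_sumr (eq_bigr _ (fun d _ => scalerDr _ _ _)) big_split /=.
  under eq_bigr => i _ do rewrite big_split /=.
  rewrite big_split /= addrC; congr (_ + _).
    rewrite fder.unlock; apply: eq_bigr => i _; rewrite exchange_big /=.
    rewrite (bigD1 b')//= [X in _ + X]big1 ?addr0 => [|d db].
      under eq_bigr do rewrite scalerA -mulrA.
      rewrite -scaler_suml -mulr_sumr -mulmxE mulVmx ?uE//.
      by rewrite mxE eqxx mulr1.
    under eq_bigr do rewrite scalerA -mulrA.
    rewrite -scaler_suml -mulr_sumr -mulmxE mulVmx ?uE//.
    by rewrite mxE eq_sym (negPf db) mulr0 scale0r.
  under eq_bigr => i _ do rewrite exchange_big /=.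
  rewrite exchange_big /=; apply: eq_bigr => d _.
  rewrite scaler_suml; apply: eq_bigr => i _.
  by rewrite scaler_suml; apply: eq_bigr => j _; rewrite scalerA.
have prod a' b' : \sum_i \sum_j (F a' i * F b' j) *: (conn g E i x *m conn g E j x)
    = T a' x *m T b' x.
  rewrite /T fconn.unlock mulmx_suml; apply: eq_bigr => i _.
  rewrite mulmx_sumr; apply: eq_bigr => j _.
  by rewrite -scalemxAl -scalemxAr scalerA.
have flip (X : 'I_n -> 'I_n -> 'M[R]_n) : \sum_i \sum_j (F a i * F b j) *: X j i =
    \sum_i \sum_j (F b i * F a j) *: X i j.
  rewrite exchange_big /=; apply: eq_bigr => i _; apply: eq_bigr => j _.
  by rewrite mulrC.
have dEF d : (\sum_i \sum_j F a i * F b j * dE i j d) -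
    (\sum_i \sum_j F b i * F a j * dE i j d) = T b x a d - T a x b d.
  have s a' b' : \sum_i \sum_j F a' i * F b' j * dE i j d =
      \sum_i \sum_j F a' i * F b' j * (chr g i x *m E x) j d - T a' x b' d.
    rewrite /T fconn.unlock summxE -sumrB; apply: eq_bigr => i _.
    rewrite /dE coframe_mpartial//.
    under eq_bigr do rewrite addmxE oppmxE mulrBr.
    rewrite sumrB; congr (_ - _).
    under eq_bigr do rewrite -mulrA.
    rewrite -mulr_sumr -mulmxE mulmxA mulVmx ?uE// mul1mx scalemxE.
    by [].
  rewrite !s; set P := (X in X - _ - _); set Q := (X in _ - (X - _)).
  have -> : P = Q.
    rewrite /P /Q exchange_big /=; apply: eq_bigr => i _; apply: eq_bigr => j _.
    rewrite mulrC [F b i * _]mulrC mulmxE mulmxE.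
    rewrite [RHS]mulrC; congr (_ * _); apply: eq_bigr => k _.
    by rewrite (chr_sym oU sG _ _ _ Ux).
  by rewrite opprB addrC addrA subrK addrC.
rewrite fcurv.unlock.
under eq_bigr => i _ do under eq_bigr => j _ do
  rewrite curv.unlock scalerDr 2!scalerBr.
under eq_bigr => i _ do rewrite big_split /= 2!sumrB.
rewrite big_split /= 2!sumrB half prod.
rewrite (flip (fun i j => mpartial i (conn g E j) x)) half.
rewrite (flip (fun i j => conn g E i x *m conn g E j x)) prod.
rewrite -/T -(eq_bigr _ (fun d _ => congr1 (fun c => c *: T d x) (dEF d))).
under [in RHS]eq_bigr do rewrite scalerBl.
rewrite sumrB.
do ![move: (_ *m _) => ?]; move: (fder _ _ _ _) (fder _ _ _ _) (bigop _ _ _) (bigop _ _ _).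
move=> ? ? ? ?.
by apply/matrixP => k l; rewrite !mxE; ring.
Qed.

End MovingFrame.

(** * Forms of low degree on tuples of vectors *)

Section Rows.
Context {R : nzRingType} {n : nat}.
Implicit Types (s : seq 'rV[R]_n) (X Y Z : 'rV[R]_n).

(** The arguments of a k-form, listed. *)
Definition mrows k s : 'M[R]_(k, n) := \matrix_(i, j) s`_i 0 j.

Lemma row_mrows k s (i : 'I_k) : row i (mrows k s) = s`_i.
Proof. by apply/rowP => j; rewrite !mxE. Qed.

Lemma mrows_row k (v : 'M[R]_(k, n)) :
  v = mrows k [seq row i v | i <- enum 'I_k].
Proof.
apply/row_matrixP => i; rewrite row_mrows (nth_map i) ?size_enum_ord//.
by rewrite nth_ord_enum.
Qed.

Lemma mrows1 X : mrows 1 [:: X] = X.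
Proof. by apply/rowP => j; rewrite !mxE. Qed.

Lemma col_mx_mrows X Y : col_mx X Y = mrows 2 [:: X; Y].
Proof.
apply/row_matrixP => i; rewrite row_mrows.
case: (split_ordP i) => j ->; rewrite (ord1 j).
  by rewrite rowKu row_id.
by rewrite rowKd row_id.
Qed.

Lemma row'_mrows k (i : 'I_k.+1) s : size s = k.+1 ->
  row' i (mrows k.+1 s) = mrows k (take i s ++ drop i.+1 s).
Proof.
move=> ss; apply/matrixP => p q; rewrite !mxE /= nth_cat size_take ss ltn_ord.
rewrite /bump; case: leqP => ip; first by rewrite nth_drop addSn subnKC.
by rewrite nth_take.
Qed.

Lemma lin_expand (f : 'rV[R]_n -> R) :
  (forall t X Y, f (t *: X + Y) = t * f X + f Y) ->
  forall X, f X = \sum_i X 0 i * f (delta_mx 0 i).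
Proof.
move=> fl X; rewrite {1}[X]row_sum_delta.
have f0 : f 0 = 0.
  by have := fl 1 0 0; rewrite scaler0 addr0 mul1r => /eqP; rewrite -subr_eq0
    opprD addrA subrr sub0r oppr_eq0 => /eqP.
elim: (index_enum _) => [|i r IH]; first by rewrite !big_nil.
by rewrite !big_cons fl IH.
Qed.

End Rows.

Section LowDegreeForms.
Context {R : realType} {n : nat}.

Definition mx_of_form1 (a : 'M[R]_(1, n) -> R) : 'cV[R]_n :=
  \matrix_(i, j) a (delta_mx 0 i).

Definition mx_of_form2 (w : 'M[R]_(2, n) -> R) : 'M[R]_n :=
  \matrix_(i, j) w (mrows 2 [:: delta_mx 0 i; delta_mx 0 j]).

Lemma form1E (a : 'M[R]_(1, n) -> R) X : multilinear_form a ->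
  a X = (X *m mx_of_form1 a) 0 0.
Proof.
move=> ma; rewrite mulmxE (@lin_expand _ _ a) => [|t Y Z].
  by apply: eq_bigr => i _; rewrite [mx_of_form1 _ _ _]mxE.
have sr (u : 'rV[R]_n) : set_row ord0 u (Y : 'M[R]_(1, n)) = u.
  by apply/rowP => j; rewrite mxE eqxx.
by have := ma ord0 Y t Y Z; rewrite !sr.
Qed.

Lemma form2_row (w : 'M[R]_(2, n) -> R) X Y : multilinear_form w ->
  w (mrows 2 [:: X; Y]) = (X *m mx_of_form2 w *m Y^T) 0 0.
Proof.
move=> mw.
have s0 (u X' Y' : 'rV_n) : set_row ord0 u (mrows 2 [:: X'; Y']) = mrows 2 [:: u; Y'].
  by apply/row_matrixP => -[[|[|//]] i]; apply/rowP => j; rewrite !mxE.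
have s1 (u X' Y' : 'rV_n) : set_row ord_max u (mrows 2 [:: X'; Y']) = mrows 2 [:: X'; u].
  by apply/row_matrixP => -[[|[|//]] i]; apply/rowP => j; rewrite !mxE.
rewrite (@lin_expand _ _ (fun X => w (mrows 2 [:: X; Y]))) => [|t X1 X2]; last first.
  by have := mw ord0 (mrows 2 [:: X1; Y]) t X1 X2; rewrite !s0.
rewrite -mulmxA mulmxE; apply: eq_bigr => i _; congr (_ * _).
rewrite (@lin_expand _ _ (fun Y => w (mrows 2 [:: delta_mx 0 i; Y]))) => [|t X1 X2]; last first.
  by have := mw ord_max (mrows 2 [:: delta_mx 0 i; X1]) t X1 X2; rewrite !s1.
by rewrite mulmxE; apply: eq_bigr => j _; rewrite trmxE mxE mulrC.
Qed.

Lemma form2_anti (w : 'M[R]_(2, n) -> R) X Y :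
  multilinear_form w -> alternating_form w ->
  w (mrows 2 [:: X; Y]) = - w (mrows 2 [:: Y; X]).
Proof.
move=> mw aw.
have az Z : w (mrows 2 [:: Z; Z]) = 0.
  by apply: (aw _ ord0 ord_max) => //; rewrite !row_mrows.
have := az (X + Y); rewrite form2_row// linearD /= !mulmxDl !mulmxDr !addmxE.
rewrite -!form2_row// !az add0r addr0 => /eqP.
by rewrite addr_eq0 => /eqP.
Qed.

Lemma mx_of_form2_anti (w : 'M[R]_(2, n) -> R) :
  multilinear_form w -> alternating_form w ->
  (mx_of_form2 w)^T = - mx_of_form2 w.
Proof.
by move=> mw aw; apply/matrixP => i j; rewrite trmxE oppmxE 2!mxE form2_anti.
Qed.

End LowDegreeForms.

Section PermutationSums.
Context {F : fieldType}.

(** Permutations are sorted by the image of i. With the sign of lift_perm this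
    computes alternating sums over S_k by recursion on k. *)
Lemma sum_perm_lift k (f : 'S_k.+1 -> F) (i : 'I_k.+1) :
  \sum_s f s = \sum_j \sum_s f (lift_perm i j s).
Proof.
pose h (u : 'I_k.+1 * 'S_k) := lift_perm i u.1 u.2.
have hi u : h u i = u.1 by rewrite /h lift_perm_id.
have inj_h : injective h.
  move=> u u' e; have e1 : u.1 = u'.1 by rewrite -!hi e.
  rewrite [u]surjective_pairing [u']surjective_pairing -e1; congr (_, _).
  apply/permP => l; apply: (@lift_inj _ u.1).
  by have := congr1 (fun s : 'S_k.+1 => s (lift i l)) e; rewrite /h -e1 !lift_perm_lift.
have card_h : #|'S_k.+1| = #|{: 'I_k.+1 * 'S_k}|.
  by rewrite card_prod card_ord !card_Sn factS.
have [h' hK h'K] := inj_card_bij inj_h (eq_leq card_h).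
rewrite (reindex h) /=; last by exists h' => u _.
by rewrite (pair_big xpredT xpredT).
Qed.

Lemma sum_S1 (h : 'I_1 -> F) : \sum_(s : 'S_1) (-1) ^+ s * h (s ord0) = h ord0.
Proof.
rewrite (bigD1 1%g)//= big1 ?addr0 ?odd_perm1 ?expr0 ?mul1r => [|s].
  by rewrite ord1.
by move=> /eqP[]; apply/permP => i; rewrite !ord1.
Qed.

Lemma sum_S2 (h : 'I_2 -> 'I_2 -> F) (i0 := ord0) (i1 := ord_max) :
  \sum_(s : 'S_2) (-1) ^+ s * h (s i0) (s i1) = h i0 i1 - h i1 i0.
Proof.
rewrite (sum_perm_lift _ ord0).
have e1 : i1 = lift ord0 ord0 by apply: val_inj.
have e (j : 'I_2) : \sum_(s : 'S_1) (-1) ^+ (lift_perm ord0 j s)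
      * h (lift_perm ord0 j s i0) (lift_perm ord0 j s i1) =
    (-1) ^+ j * h j (lift j ord0).
  rewrite -(sum_S1 (fun k => (-1) ^+ j * h j (lift j k))).
  apply: eq_bigr => s _.
  rewrite odd_lift_perm e1 lift_perm_id lift_perm_lift /= signr_addb signr_odd.
  by rewrite mulrCA mulrA.
under eq_bigr do rewrite e.
rewrite !big_ord_recl big_ord0 addr0 /= expr0 mul1r expr1 mulN1r.
by congr (h _ _ - h _ _); apply: val_inj.
Qed.

Lemma sum_sign_lift k (f : 'S_k.+1 -> F) (i : 'I_k.+1) :
  \sum_(s : 'S_k.+1) (-1) ^+ s * f s =
  \sum_(j < k.+1) (-1) ^+ (i + j) * \sum_(s : 'S_k) (-1) ^+ s * f (lift_perm i j s).
Proof.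
rewrite (sum_perm_lift _ i); apply: eq_bigr => j _.
rewrite mulr_sumr; apply: eq_bigr => s _.
by rewrite odd_lift_perm !signr_addb !signr_odd exprD !mulrA.
Qed.

Lemma sum_S3 (h : 'I_3 -> 'I_3 -> 'I_3 -> F)
    (i0 := @Ordinal 3 0 isT) (i1 := @Ordinal 3 1 isT) (i2 := @Ordinal 3 2 isT) :
  \sum_(s : 'S_3) (-1) ^+ s * h (s i0) (s i1) (s i2) =
  h i0 i1 i2 - h i0 i2 i1 - h i1 i0 i2 + h i1 i2 i0 + h i2 i0 i1 - h i2 i1 i0.
Proof.
rewrite (sum_sign_lift _ i0).
have e1 : i1 = lift i0 ord0 by apply: val_inj.
have e2 : i2 = lift i0 ord_max by apply: val_inj.
have e (j : 'I_3) : \sum_(s : 'S_2) (-1) ^+ s * h (lift_perm i0 j s i0)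
      (lift_perm i0 j s i1) (lift_perm i0 j s i2) =
    h j (lift j ord0) (lift j ord_max) - h j (lift j ord_max) (lift j ord0).
  rewrite -(sum_S2 (fun k l => h j (lift j k) (lift j l))).
  by apply: eq_bigr => s _; rewrite e1 e2 lift_perm_id !lift_perm_lift.
under eq_bigr do rewrite e.
rewrite !big_ord_recl big_ord0 /= addr0 ?add0n ?addn0.
have E (a b : 'I_3) : val a = val b -> a = b by exact: val_inj.
rewrite (E (lift ord0 ord0) i1)// (E (lift ord0 ord_max) i2)//.
rewrite (E (lift i1 ord0) i0)// (E (lift i1 ord_max) i2)//.
rewrite (E (lift ord0 (lift ord0 ord0)) i2)//.
rewrite (E (lift i2 ord0) i0)// (E (lift i2 ord_max) i1)// (E ord0 i0)//.
rewrite /bump /= ?add0n ?addn0 expr0 expr1 sqrrN expr1n; ring.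
Qed.

Lemma sum_S4 (h : 'I_4 -> 'I_4 -> 'I_4 -> 'I_4 -> F)
    (i0 := @Ordinal 4 0 isT) (i1 := @Ordinal 4 1 isT)
    (i2 := @Ordinal 4 2 isT) (i3 := @Ordinal 4 3 isT)
    (alt := fun a b c d => h a b c d - h a b d c - h a c b d + h a c d b
                           + h a d b c - h a d c b) :
  \sum_(s : 'S_4) (-1) ^+ s * h (s i0) (s i1) (s i2) (s i3) =
  alt i0 i1 i2 i3 - alt i1 i0 i2 i3 + alt i2 i0 i1 i3 - alt i3 i0 i1 i2.
Proof.
rewrite (sum_sign_lift _ i0).
pose k0 := @Ordinal 3 0 isT; pose k1 := @Ordinal 3 1 isT; pose k2 := @Ordinal 3 2 isT.
have e1 : i1 = lift i0 k0 by apply: val_inj.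
have e2 : i2 = lift i0 k1 by apply: val_inj.
have e3 : i3 = lift i0 k2 by apply: val_inj.
have e (j : 'I_4) : \sum_(s : 'S_3) (-1) ^+ s * h (lift_perm i0 j s i0)
      (lift_perm i0 j s i1) (lift_perm i0 j s i2) (lift_perm i0 j s i3) =
    alt j (lift j k0) (lift j k1) (lift j k2).
  apply: etrans (sum_S3 (fun k l m => h j (lift j k) (lift j l) (lift j m))).
  by apply: eq_bigr => s _; rewrite e1 e2 e3 lift_perm_id !lift_perm_lift.
under eq_bigr do rewrite e.
rewrite !big_ord_recl big_ord0 /= addr0 ?add0n ?addn0.
have E (a b : 'I_4) : val a = val b -> a = b by exact: val_inj.
rewrite (E (lift ord0 k0) i1)// (E (lift ord0 k1) i2)// (E (lift ord0 k2) i3)//.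
rewrite (E (lift ord0 ord0) i1)// (E (lift ord0 (lift ord0 ord0)) i2)//.
rewrite (E (lift ord0 (lift ord0 (lift ord0 ord0))) i3)// (E ord0 i0)//.
rewrite (E (lift i1 k0) i0)// (E (lift i1 k1) i2)// (E (lift i1 k2) i3)//.
rewrite (E (lift i2 k0) i0)// (E (lift i2 k1) i1)// (E (lift i2 k2) i3)//.
rewrite (E (lift i3 k0) i0)// (E (lift i3 k1) i1)// (E (lift i3 k2) i2)//.
rewrite /bump /= ?add0n ?addn0 expr0 expr1 sqrrN expr1n.
rewrite (exprS _ 2) sqrrN expr1n; ring.
Qed.

End PermutationSums.

Section Wedges.
Context {R : realType} {n : nat} {F : fieldType}.

Lemma wedge11 (a b : 'M[R]_(1, n) -> F) X Y :
  (a \w b) (mrows 2 [:: X; Y]) = a X * b Y - a Y * b X.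
Proof.
rewrite /wedge /= mul1n invr1 mul1r.
pose h (p q : 'I_2) := a (row p (mrows 2 [:: X; Y])) * b (row q (mrows 2 [:: X; Y])).
transitivity (\sum_(s : 'S_2) (-1) ^+ s * h (s ord0) (s ord_max)).
  apply: eq_bigr => s _; congr (_ * (a _ * b _)); apply/rowP => j; rewrite !mxE.
    by congr (fun_of_matrix (nth _ _ (nat_of_ord (s _))) _ _); apply: val_inj.
  by congr (fun_of_matrix (nth _ _ (nat_of_ord (s _))) _ _); apply: val_inj.
by rewrite sum_S2 /h !row_mrows /= mulrC.
Qed.

Lemma wedge21 (a : 'M[R]_(2, n) -> F) (b : 'M[R]_(1, n) -> F) X Y Z :
  2%:R != 0 :> F ->
  (forall X Y, a (mrows 2 [:: X; Y]) = - a (mrows 2 [:: Y; X])) ->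
  (a \w b) (mrows 3 [:: X; Y; Z]) =
  a (mrows 2 [:: X; Y]) * b Z - a (mrows 2 [:: X; Z]) * b Y
  + a (mrows 2 [:: Y; Z]) * b X.
Proof.
move=> F2 aa; rewrite /wedge.
pose V := mrows 3 [:: X; Y; Z].
pose h (p q r : 'I_3) := a (mrows 2 [:: row p V; row q V]) * b (row r V).
transitivity ((2`! * 1`!)%:R^-1 * \sum_(s : 'S_3) (-1) ^+ s *
   h (s (@Ordinal 3 0 isT)) (s (@Ordinal 3 1 isT)) (s (@Ordinal 3 2 isT))).
  congr (_ * _); apply: eq_bigr => s _; congr (_ * (a _ * b _)).
    apply/row_matrixP => -[[|[|//]] i]; apply/rowP => j; rewrite !mxE.
      by congr (fun_of_matrix (nth _ _ (nat_of_ord (s _))) _ _); apply: val_inj.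
    by congr (fun_of_matrix (nth _ _ (nat_of_ord (s _))) _ _); apply: val_inj.
  by apply/rowP => j; rewrite !mxE; congr (fun_of_matrix (nth _ _ (nat_of_ord (s _))) _ _); apply: val_inj.
rewrite sum_S3 /h !row_mrows /= (aa Y X) (aa Z X) (aa Z Y).
rewrite (_ : (2`! * 1`!)%N = 2%N)//.
by move: F2; move: (a _) (a _) (a _) (b _) (b _) (b _) => ? ? ? ? ? ? F2; field.
Qed.

Lemma wedge12 (a : 'M[R]_(1, n) -> F) (b : 'M[R]_(2, n) -> F) X Y Z :
  2%:R != 0 :> F ->
  (forall X Y, b (mrows 2 [:: X; Y]) = - b (mrows 2 [:: Y; X])) ->
  (a \w b) (mrows 3 [:: X; Y; Z]) =
  a X * b (mrows 2 [:: Y; Z]) - a Y * b (mrows 2 [:: X; Z])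
  + a Z * b (mrows 2 [:: X; Y]).
Proof.
move=> F2 aa; rewrite /wedge.
pose V := mrows 3 [:: X; Y; Z].
pose h (p q r : 'I_3) := a (row p V) * b (mrows 2 [:: row q V; row r V]).
transitivity ((1`! * 2`!)%:R^-1 * \sum_(s : 'S_3) (-1) ^+ s *
   h (s (@Ordinal 3 0 isT)) (s (@Ordinal 3 1 isT)) (s (@Ordinal 3 2 isT))).
  congr (_ * _); apply: eq_bigr => s _; congr (_ * (a _ * b _)).
    by apply/rowP => j; rewrite !mxE; congr (fun_of_matrix (nth _ _ (nat_of_ord (s _))) _ _); apply: val_inj.
  apply/row_matrixP => -[[|[|//]] i]; apply/rowP => j; rewrite !mxE.
    by congr (fun_of_matrix (nth _ _ (nat_of_ord (s _))) _ _); apply: val_inj.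
  by congr (fun_of_matrix (nth _ _ (nat_of_ord (s _))) _ _); apply: val_inj.
rewrite sum_S3 /h !row_mrows /= (aa Y X) (aa Z X) (aa Z Y).
rewrite (_ : (1`! * 2`!)%N = 2%N)//.
by move: F2; move: (b _) (b _) (b _) (a _) (a _) (a _) => ? ? ? ? ? ? F2; field.
Qed.

Lemma wedge_row_perm k l (a : 'M[R]_(k, n) -> F) (b : 'M[R]_(l, n) -> F) (t : 'S_(k + l)) v :
  (a \w b) (row_perm t v) = (-1) ^+ t * (a \w b) v.
Proof.
rewrite /wedge mulrCA; congr (_ * _).
rewrite [LHS](reindex_inj (mulIg t^-1%g)) mulr_sumr; apply: eq_bigr => s _ /=.
by rewrite -row_permM mulgKV odd_permM odd_permV signr_addb -mulrA mulrCA.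
Qed.

End Wedges.

Section RealWedges.
Context {R : realType} {n : nat}.

(** Twice the polarised Pfaffian of the 4 x 4 minor p, q, r, t. *)
Definition pf_polar m (W Z : 'M[R]_m) (p q r t : 'I_m) : R :=
  W p q * Z r t - W p r * Z q t + W p t * Z q r
  + W q r * Z p t - W q t * Z p r + W r t * Z p q.

Lemma wedge22 (w z : 'M[R]_(2, n) -> R) m (v : 'I_m -> 'rV[R]_n) (p q r t : 'I_m)
    (W := \matrix_(i, j) w (mrows 2 [:: v i; v j]))
    (Z := \matrix_(i, j) z (mrows 2 [:: v i; v j])) :
  (forall X Y, w (mrows 2 [:: X; Y]) = - w (mrows 2 [:: Y; X])) ->
  (forall X Y, z (mrows 2 [:: X; Y]) = - z (mrows 2 [:: Y; X])) ->
  (w \w z) (mrows 4 [:: v p; v q; v r; v t]) = pf_polar W Z p q r t.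
Proof.
move=> aw az; rewrite /wedge.
pose V := mrows 4 [:: v p; v q; v r; v t].
pose h (a b c d : 'I_4) := w (mrows 2 [:: row a V; row b V]) * z (mrows 2 [:: row c V; row d V]).
transitivity ((2`! * 2`!)%:R^-1 * \sum_(s : 'S_4) (-1) ^+ s *
   h (s (@Ordinal 4 0 isT)) (s (@Ordinal 4 1 isT))
     (s (@Ordinal 4 2 isT)) (s (@Ordinal 4 3 isT))).
  congr (_ * _); apply: eq_bigr => s _; congr (_ * (w _ * z _));
    apply/row_matrixP => -[[|[|//]] i]; apply/rowP => j; rewrite !mxE;
    by congr (fun_of_matrix (nth _ _ (nat_of_ord (s _))) _ _); apply: val_inj.
rewrite sum_S4 /h !row_mrows /= /pf_polar !mxE.
rewrite (aw (v q) (v p)) (aw (v r) (v p)) (aw (v t) (v p)) (aw (v r) (v q)).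
rewrite (aw (v t) (v q)) (aw (v t) (v r)).
rewrite (az (v q) (v p)) (az (v r) (v p)) (az (v t) (v p)) (az (v r) (v q)).
rewrite (az (v t) (v q)) (az (v t) (v r)).
rewrite (_ : (2`! * 2`!)%N = 4%N)//.
by do 6![move: (w _) => ?]; do 6![move: (z _) => ?]; field.
Qed.

Lemma wedge41 (w : 'M[R]_(4, n) -> R) (a : 'M[R]_(1, n) -> R) (X : 'M[R]_(5, n)) :
  (forall (s : 'S_4) Z, w (row_perm s Z) = (-1) ^+ s * w Z) ->
  (w \w a) X = \sum_(j < 5) (-1) ^+ j * (w (row' j X) * a (row j X)).
Proof.
move=> ws; rewrite /wedge.
rewrite (@sum_sign_lift _ 4 (fun s => w (@usubmx R 4 1 n (row_perm s X)) * a (@dsubmx R 4 1 n (row_perm s X))) ord_max).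
rewrite mulr_sumr; apply: eq_bigr => j _.
have e1 (s : 'S_4) : @usubmx R 4 1 n (row_perm (lift_perm ord_max j s) X) =
    row_perm s (row' j X).
  apply/matrixP => p q; rewrite !mxE.
  have -> : lshift 1 p = lift ord_max p by apply: val_inj; rewrite /= /bump leqNgt ltn_ord.
  by rewrite lift_perm_lift.
have e2 (s : 'S_4) : @dsubmx R 4 1 n (row_perm (lift_perm ord_max j s) X) =
    row j X.
  apply/matrixP => p q; rewrite !mxE (ord1 p).
  have -> : rshift 4 0 = ord_max :> 'I_5 by apply: val_inj.
  by rewrite lift_perm_id.
under eq_bigr => s _ do rewrite e1 e2 ws mulrA mulrA -expr2 sqrr_sign mul1r.
rewrite sumr_const (_ : #|_| = 4`!); last first.
  by rewrite -(card_Sn 4); apply: eq_card => s; rewrite !inE.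
rewrite exprD (exprM _ 2 2) sqrrN !expr1n mul1r mulrCA; congr (_ * _).
rewrite (_ : (4`! * 1`!)%N = 4`!)// -(mulr_natr (_ * _) 4`!).
have : 4`!%:R != 0 :> R by rewrite pnatr_eq0.
by move: (4`!%:R) => c c0; field.
Qed.

End RealWedges.

(** * Quaternionic relations and adapted coframes *)

Local Notation k1 := (@Ordinal 3 0 isT).
Local Notation k2 := (@Ordinal 3 1 isT).
Local Notation k3 := (@Ordinal 3 2 isT).

Lemma ord3_case (P : 'I_3 -> Prop) : P k1 -> P k2 -> P k3 -> forall k, P k.
Proof.
move=> p1 p2 p3 [[|[|[|//]]] i].
- by rewrite (_ : Ordinal i = k1)//; apply: val_inj.
- by rewrite (_ : Ordinal i = k2)//; apply: val_inj.
- by rewrite (_ : Ordinal i = k3)//; apply: val_inj.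
Qed.

(** With B_2 the negative of the inverse of A_2 this is - A_1 A_2^-1 A_3, the
    metric on the kernel of the 1-form determined by three 2-forms. *)
HB.lock Definition quat_metric (R : realType) (n : nat)
    (A B : 'I_3 -> 'M[R]_n) : 'M[R]_n := A k1 *m B k2 *m A k3.

Section Quaternions.
Context {R : realType} {n : nat}.

(** a, the A_k and r are the matrices of a 1-form, three 2-forms and a Reeb
    vector. The bivectors B_k are the inverses of the - A_k transversally to r,
    and by quat_swap the endomorphisms A_k B_l with k != l are complex
    structures there, as for the 2-forms of a quaternionic structure. *)
Record quaternionic (a : 'cV[R]_n) (A : 'I_3 -> 'M[R]_n)
    (r : 'rV[R]_n) (B : 'I_3 -> 'M[R]_n) : Prop := Quaternionic {
  quatA_anti : forall k, (A k)^T = - A k;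
  quatB_anti : forall k, (B k)^T = - B k;
  quat_rA : forall k, r *m A k = 0;
  quat_ra : r *m a = 1%:M;
  quat_Ba : forall k, B k *m a = 0;
  quat_sq : forall k, A k *m B k = a *m r - 1%:M;
  quat_swap : forall k l, k != l -> A k *m B l = - (A l *m B k) }.

Variables (a : 'cV[R]_n) (A : 'I_3 -> 'M[R]_n) (r : 'rV[R]_n) (B : 'I_3 -> 'M[R]_n).
Hypothesis Q : quaternionic a A r B.

Lemma quat_Art k : A k *m r^T = 0.
Proof.
have : (r *m A k)^T = 0 by rewrite (quat_rA Q) trmx0.
by rewrite trmx_mul (quatA_anti Q) mulNmx => /eqP; rewrite oppr_eq0 => /eqP.
Qed.

Lemma quat_sq_tr k : B k *m A k = (a *m r - 1%:M)^T.
Proof.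
rewrite -(quat_sq Q k) trmx_mul (quatA_anti Q) (quatB_anti Q).
by rewrite mulNmx mulmxN opprK.
Qed.

Lemma quat_swap_tr k l : k != l -> B k *m A l = - (B l *m A k).
Proof.
move=> kl; apply: trmx_inj; rewrite linearN /= !trmx_mul.
rewrite !(quatA_anti Q) !(quatB_anti Q) !mulNmx !mulmxN !opprK.
by rewrite (quat_swap Q) 1?eq_sym.
Qed.

Lemma quat_metric_cyc : quat_metric A B = A k2 *m B k3 *m A k1.
Proof.
rewrite quat_metric.unlock (quat_swap Q)// mulNmx -!mulmxA -mulmxN.
by congr (_ *m _); rewrite quat_swap_tr// opprK.
Qed.

Lemma quat_metric_cyc2 : quat_metric A B = A k3 *m B k1 *m A k2.
Proof.
rewrite quat_metric_cyc (quat_swap Q)// mulNmx -!mulmxA -mulmxN.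
by congr (_ *m _); rewrite quat_swap_tr// opprK.
Qed.

Lemma quat_metric_sym : (quat_metric A B)^T = quat_metric A B.
Proof.
rewrite {1}quat_metric_cyc !trmx_mul !(quatA_anti Q) (quatB_anti Q).
rewrite !(mulmxN, mulNmx) opprK (quat_swap_tr (_ : k3 != k2))//.
by rewrite mulmxN opprK mulmxA quat_metric.unlock.
Qed.

Lemma quat_right k l : A k *m B l *m (a *m r - 1%:M) = - (A k *m B l).
Proof.
by rewrite mulmxBr mulmx1 -mulmxA (mulmxA _ a) (quat_Ba Q) mul0mx mulmx0 sub0r.
Qed.

Lemma quat_metricB k : quat_metric A B *m B k =
  - (A (k + 1)%R *m B (k + 2)%R).
Proof.
elim/ord3_case: k.
- rewrite quat_metric_cyc -mulmxA (quat_sq Q) quat_right.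
  by congr (- (A _ *m B _)); apply: val_inj.
- rewrite quat_metric_cyc2 -mulmxA (quat_sq Q) quat_right.
  by congr (- (A _ *m B _)); apply: val_inj.
- rewrite quat_metric.unlock -mulmxA (quat_sq Q) quat_right.
  by congr (- (A _ *m B _)); apply: val_inj.
Qed.

(** A_k has the kernel spanned by r; adding a a^T makes it invertible, and the
    inverse has r^T r as the missing part. *)
Lemma quat_unit k : (A k + a *m a^T) *m (r^T *m r - B k) = 1%:M.
Proof.
rewrite mulmxBr !mulmxDl mulmxA quat_Art mul0mx add0r (quat_sq Q).
have aB : a^T *m B k = 0.
  apply: trmx_inj; rewrite trmx_mul trmxK (quatB_anti Q) mulNmx (quat_Ba Q).
  by rewrite oppr0 trmx0.
have art : a^T *m r^T = 1%:M by rewrite -trmx_mul (quat_ra Q) trmx1.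
by rewrite -!mulmxA aB mulmx0 addr0 (mulmxA a^T) art mul1mx opprB addrCA subrr addr0.
Qed.

Lemma quat_invmx k : invmx (A k + a *m a^T) = r^T *m r - B k.
Proof.
have [u _] := mulmx1_unit (quat_unit k).
by rewrite -[RHS](mulKmx u) quat_unit mulmx1.
Qed.

(** Here r and the B_k no longer occur: the metric is determined by the forms. *)
Lemma quat_metric_inv : quat_metric A B = - (A k1 *m invmx (A k2 + a *m a^T) *m A k3).
Proof.
rewrite quat_metric.unlock quat_invmx mulmxBr mulmxA quat_Art mul0mx sub0r.
by rewrite mulNmx opprK.
Qed.

End Quaternions.

(** The matrices of e^12 + e^34, e^13 - e^24 and e^14 + e^23. *)
Definition std_form {R : realType} (k : 'I_3) : 'M[R]_5 :=
  \matrix_(i, j) (nth 0 (nth [::] (nth [::] [::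
    [:: [:: 0; 1; 0; 0; 0]; [:: -1; 0; 0; 0; 0]; [:: 0; 0; 0; 1; 0];
        [:: 0; 0; -1; 0; 0]; [:: 0; 0; 0; 0; 0]];
    [:: [:: 0; 0; 1; 0; 0]; [:: 0; 0; 0; -1; 0]; [:: -1; 0; 0; 0; 0];
        [:: 0; 1; 0; 0; 0]; [:: 0; 0; 0; 0; 0]];
    [:: [:: 0; 0; 0; 1; 0]; [:: 0; 0; 1; 0; 0]; [:: 0; -1; 0; 0; 0];
        [:: -1; 0; 0; 0; 0]; [:: 0; 0; 0; 0; 0]]] k) i) j).

(** The columns of E are the covectors e^1, .., e^5. *)
Definition adapted {R : realType} (a : 'cV[R]_5) (A : 'I_3 -> 'M[R]_5)
    (E : 'M[R]_5) : Prop :=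
  [/\ E \in unitmx, a = col (@Ordinal 5 4 isT) E &
      forall k, A k = E *m std_form k *m E^T].

Section QuaternionicFrame.
Context {R : realType}.

Definition mcols n k (s : seq 'cV[R]_n) : 'M[R]_(n, k) := \matrix_(i, j) s`_j i 0.

Lemma mulmx_rows_cols n k l (s : seq 'rV[R]_n) (t : seq 'cV[R]_n) (i : 'I_k) (j : 'I_l) :
  (mrows k s *m mcols l t) i j = (s`_i *m t`_j) 0 0.
Proof. by rewrite !mxE; apply: eq_bigr => m _; rewrite !mxE. Qed.

Lemma mulmx_rows_form n k (s : seq 'rV[R]_n) (A : 'M[R]_n) (i j : 'I_k) :
  (mrows k s *m A *m (mrows k s)^T) i j = (s`_i *m A *m (s`_j)^T) 0 0.
Proof.
rewrite !mxE; apply: eq_bigr => m _; rewrite !mxE; congr (_ * _).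
by apply: eq_bigr => l _; rewrite !mxE.
Qed.

Lemma anti_form_diag n (V : 'rV[R]_n) (X : 'M[R]_n) :
  X^T = - X -> V *m X *m V^T = 0.
Proof.
move=> aX; have : (V *m X *m V^T)^T = - (V *m X *m V^T).
  by rewrite !trmx_mul trmxK aX mulNmx mulmxN mulmxA.
have -> : (V *m X *m V^T)^T = V *m X *m V^T.
  by apply/matrixP => i j; rewrite trmxE !ord1.
move/eqP; rewrite -addr_eq0 -mulr2n -scaler_nat scaler_eq0 pnatr_eq0 /=.
by move/eqP.
Qed.

Lemma ord5_case (P : 'I_5 -> Prop) :
  P (@Ordinal 5 0 isT) -> P (@Ordinal 5 1 isT) -> P (@Ordinal 5 2 isT) ->
  P (@Ordinal 5 3 isT) -> P (@Ordinal 5 4 isT) -> forall i, P i.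
Proof.
move=> p0 p1 p2 p3 p4 [[|[|[|[|[|//]]]]] i].
- by rewrite (_ : Ordinal i = @Ordinal 5 0 isT)//; apply: val_inj.
- by rewrite (_ : Ordinal i = @Ordinal 5 1 isT)//; apply: val_inj.
- by rewrite (_ : Ordinal i = @Ordinal 5 2 isT)//; apply: val_inj.
- by rewrite (_ : Ordinal i = @Ordinal 5 3 isT)//; apply: val_inj.
- by rewrite (_ : Ordinal i = @Ordinal 5 4 isT)//; apply: val_inj.
Qed.

Variables (a : 'cV[R]_5) (A : 'I_3 -> 'M[R]_5) (r : 'rV[R]_5) (B : 'I_3 -> 'M[R]_5).
Hypothesis Q : quaternionic a A r B.
Let g := quat_metric A B.

(** The covectors dual to V and to its images under the three complex
    structures, and the 1-form. *)
Definition quat_coframe (V : 'rV[R]_5) : 'M[R]_5 :=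
  mcols 5 [:: g *m V^T; - (A k1 *m V^T); - (A k2 *m V^T); - (A k3 *m V^T); a].

Definition quat_frame (V : 'rV[R]_5) : 'M[R]_5 :=
  mrows 5 [:: V - V *m a *m r; V *m g *m B k1; V *m g *m B k2; V *m g *m B k3; r].

Let gsym : g^T = g := quat_metric_sym Q.

Let rg : r *m g = 0.
Proof. by rewrite /g quat_metric.unlock !mulmxA (quat_rA Q) !mul0mx. Qed.

Let grt : g *m r^T = 0.
Proof. by rewrite -gsym -trmx_mul rg trmx0. Qed.

Let gB1 : g *m B k1 = - (A k2 *m B k3).
Proof. by rewrite (quat_metricB Q); congr (- (A _ *m B _)); apply: val_inj. Qed.

Let gB2 : g *m B k2 = - (A k3 *m B k1).
Proof. by rewrite (quat_metricB Q); congr (- (A _ *m B _)); apply: val_inj. Qed.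

Let gB3 : g *m B k3 = - (A k1 *m B k2).
Proof. by rewrite (quat_metricB Q); congr (- (A _ *m B _)); apply: val_inj. Qed.

Let anti_conj (Y X : 'M[R]_5) (V : 'rV[R]_5) : Y^T = Y \/ Y^T = - Y -> X^T = - X ->
  V *m (Y *m X *m Y) *m V^T = 0.
Proof.
move=> sY aX; apply: anti_form_diag; rewrite !trmx_mul aX.
by case: sY => ->; rewrite ?(mulNmx, mulmxN) ?opprK mulmxA.
Qed.

Let ABg k : A k *m B k *m g = - g.
Proof. by rewrite (quat_sq Q) mulmxBl mul1mx -mulmxA rg mulmx0 sub0r. Qed.

Let ABA k l : A k *m (B l *m A l) = - A k.
Proof.
rewrite (quat_sq_tr Q) linearB /= trmx1 trmx_mul mulmxBr mulmx1 mulmxA.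
by rewrite (quat_Art Q) mul0mx sub0r.
Qed.

Let gBA k : g *m B k *m A k = - g.
Proof.
rewrite -mulmxA (quat_sq_tr Q) linearB /= trmx1 trmx_mul mulmxBr mulmx1 mulmxA.
by rewrite grt mul0mx sub0r.
Qed.

Variable V : 'rV[R]_5.
Hypothesis V1 : V *m g *m V^T = 1%:M.

(** A product of the A_k and B_k with V on both ends reduces, by the quaternionic
    relations, either to V g V^T = 1 or to an antisymmetric form evaluated twice
    on V. The same dichotomy governs the next two facts. *)
Let VgBAV k l : V *m (g *m B k *m A l) *m V^T = - (k == l)%:R%:M.
Proof.
have same m : V *m (g *m B m *m A m) *m V^T = - 1%:M.
  by rewrite gBA mulmxN mulNmx V1.
have s2 x y z : g *m B x = - (A y *m B z) -> V *m (g *m B x *m A y) *m V^T = - 0%:M.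
  move=> ->; rewrite mulNmx mulmxN mulNmx anti_conj ?raddf0//.
    by right; exact: (quatA_anti Q).
  exact: (quatB_anti Q).
have s3 x y z : g *m B x = - (A y *m B z) -> V *m (g *m B x *m A z) *m V^T = - 0%:M.
  move=> ->; rewrite mulNmx -(mulmxA (A y)) ABA opprK anti_form_diag ?raddf0 ?oppr0//.
  exact: (quatA_anti Q).
elim/ord3_case: k; elim/ord3_case: l; rewrite ?eqxx //=;
  by [exact: same|exact: s2 gB1|exact: s2 gB2|exact: s2 gB3
     |exact: s3 gB1|exact: s3 gB2|exact: s3 gB3].
Qed.

Let VABgV k l : V *m (A k *m B l *m g) *m V^T = - (k == l)%:R%:M.
Proof.
have e : (V *m (g *m B l *m A k) *m V^T)^T = V *m (A k *m B l *m g) *m V^T.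
  rewrite 4!trmx_mul trmxK (quatA_anti Q) (quatB_anti Q) gsym.
  by rewrite !(mulNmx, mulmxN) opprK !mulmxA.
by rewrite -e VgBAV linearN /= tr_scalar_mx eq_sym.
Qed.

Let VgBABgV k l m : V *m (g *m B l *m A k *m B m *m g) *m V^T =
  - (std_form k (lift ord0 (widen_ord (leqnSn 3) l)) (lift ord0 (widen_ord (leqnSn 3) m)))%:M.
Proof.
have gBg x : V *m (g *m B x *m g) *m V^T = 0.
  by apply: anti_conj; [left|exact: (quatB_anti Q)].
have kl x y : V *m (g *m B x *m A x *m B y *m g) *m V^T = 0.
  by rewrite gBA !mulNmx mulmxN mulNmx gBg oppr0.
have km x y : V *m (g *m B x *m A y *m B y *m g) *m V^T = 0.
  rewrite -(mulmxA _ (A y)) -(mulmxA (g *m B x)) ABg mulmxN mulmxN mulNmx.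
  by rewrite gBg oppr0.
have sq x y : V *m (g *m B x *m A y *m B x *m g) *m V^T = 0.
  have -> : g *m B x *m A y *m B x *m g = g *m (B x *m A y *m B x) *m g.
    by rewrite !mulmxA.
  rewrite anti_conj//; first by left.
  rewrite 2!trmx_mul (quatA_anti Q) (quatB_anti Q).
  by rewrite !(mulNmx, mulmxN) opprK mulmxA.
have p x y z : g *m B x = - (A y *m B z) ->
    V *m (g *m B x *m A z *m B y *m g) *m V^T = - 1%:M.
  move=> ->; rewrite !mulNmx -(mulmxA (A y)) ABA !mulNmx opprK ABg.
  by rewrite mulmxN mulNmx V1.
have q x y z : y != z -> g *m B x = - (A y *m B z) ->
    V *m (g *m B x *m A y *m B z *m g) *m V^T = - (- 1)%:M.
  move=> yz ->; rewrite (quat_swap Q)// opprK -(mulmxA (A z)) ABA !mulNmx ABg.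
  by rewrite opprK V1 raddfN opprK.
elim/ord3_case: k; elim/ord3_case: l; elim/ord3_case: m;
  rewrite [std_form _ _ _]mxE /= ?raddf0 ?oppr0.
- exact: kl.
- exact: kl.
- exact: kl.
- exact: km.
- exact: sq.
- exact: p gB2.
- exact: km.
- exact: q gB3.
- exact: sq.
- exact: sq.
- exact: km.
- exact: q gB1.
- exact: kl.
- exact: kl.
- exact: kl.
- exact: p gB3.
- exact: km.
- exact: sq.
- exact: sq.
- exact: p gB1.
- exact: km.
- exact: q gB2.
- exact: sq.
- exact: km.
- exact: kl.
- exact: kl.
- exact: kl.
Qed.

Let f0 := V - V *m a *m r.

Let f0X (X : 'M[R]_5) : r *m X = 0 -> f0 *m X = V *m X.
Proof. by move=> rX; rewrite /f0 mulmxBl -(mulmxA (V *m a)) rX mulmx0 subr0. Qed.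

Let f0A k : f0 *m A k = V *m A k.
Proof. exact/f0X/(quat_rA Q). Qed.

Let VAV k : V *m A k *m V^T = 0.
Proof. exact/anti_form_diag/(quatA_anti Q). Qed.

Let VgBgV k : V *m g *m B k *m g *m V^T = 0.
Proof.
rewrite -(mulmxA V) -(mulmxA V); apply: anti_conj; first by left.
exact: (quatB_anti Q).
Qed.

Let Af0 k (X : 'rV[R]_5) : X *m A k *m f0^T = X *m A k *m V^T.
Proof.
rewrite /f0 linearB /= trmx_mul mulmxBr -!mulmxA (mulmxA (A k)).
by rewrite (quat_Art Q) mul0mx mulmx0 subr0.
Qed.

Let fT k : (V *m g *m B k)^T = - (B k *m g *m V^T).
Proof. by rewrite 2!trmx_mul (quatB_anti Q) gsym mulNmx mulmxA. Qed.

Lemma quat_frameK : quat_frame V *m quat_coframe V = 1%:M.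
Proof.
have h00 : f0 *m (g *m V^T) = 1%:M by rewrite mulmxA f0X.
have h0k k : f0 *m - (A k *m V^T) = 0 by rewrite mulmxN mulmxA f0A VAV oppr0.
have h04 : f0 *m a = 0.
  by rewrite /f0 mulmxBl -(mulmxA (V *m a)) (quat_ra Q) mulmx1 subrr.
have hk0 k : V *m g *m B k *m (g *m V^T) = 0 by rewrite mulmxA VgBgV.
have hkl k l : V *m g *m B k *m - (A l *m V^T) = (k == l)%:R%:M.
  by rewrite mulmxN mulmxA -(mulmxA V) -(mulmxA V) VgBAV opprK.
have hk4 k : V *m g *m B k *m a = 0 by rewrite -mulmxA (quat_Ba Q) mulmx0.
have h40 : r *m (g *m V^T) = 0 by rewrite mulmxA rg mul0mx.
have h4k k : r *m - (A k *m V^T) = 0.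
  by rewrite mulmxN mulmxA (quat_rA Q) mul0mx oppr0.
have h44 := quat_ra Q.
apply/matrixP => i j; rewrite mulmx_rows_cols.
elim/ord5_case: i; elim/ord5_case: j; rewrite /= -/f0
  ?h00 ?h0k ?h04 ?hk0 ?hkl ?hk4 ?h40 ?h4k ?h44 !mxE //.
Qed.

Lemma quat_frame_form k : quat_frame V *m A k *m (quat_frame V)^T = std_form k.
Proof.
have t00 : f0 *m A k *m f0^T = 0 by rewrite Af0 f0A VAV.
have t0l l : f0 *m A k *m (V *m g *m B l)^T = (k == l)%:R%:M.
  by rewrite f0A fT mulmxN !mulmxA -2!(mulmxA V) VABgV opprK.
have t04 (X : 'rV[R]_5) : X *m A k *m r^T = 0 by rewrite -mulmxA (quat_Art Q) mulmx0.
have tl0 l : V *m g *m B l *m A k *m f0^T = - (k == l)%:R%:M.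
  by rewrite Af0 -2!(mulmxA V) VgBAV eq_sym.
have tlm l m : V *m g *m B l *m A k *m (V *m g *m B m)^T =
    (std_form k (lift ord0 (widen_ord (leqnSn 3) l)) (lift ord0 (widen_ord (leqnSn 3) m)))%:M.
  by rewrite fT mulmxN !mulmxA -4!(mulmxA V) VgBABgV opprK.
have t4 (X : 'cV[R]_5) : r *m A k *m X = 0 by rewrite (quat_rA Q) mul0mx.
apply/matrixP => i j; rewrite mulmx_rows_form [RHS]mxE.
elim/ord3_case: k t00 t0l t04 tl0 tlm t4 => t00 t0l t04 tl0 tlm t4;
elim/ord5_case: i; elim/ord5_case: j; rewrite /= -/f0
  ?t00 ?t04 ?t4 ?t0l ?tl0 ?tlm !mxE ?oppr0 //=.
Qed.

Lemma quat_coframe_adapted : adapted a A (quat_coframe V).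
Proof.
have [uF uE] := mulmx1_unit quat_frameK.
have FE : quat_frame V = invmx (quat_coframe V).
  by rewrite -[LHS](mulmxK uE) quat_frameK mul1mx.
split=> // [|k]; first by apply/colP => i; rewrite !mxE.
rewrite -quat_frame_form FE !mulmxA mulmxV// mul1mx -mulmxA -trmx_mul mulmxV//.
by rewrite trmx1 mulmx1.
Qed.

End QuaternionicFrame.

(** * Normal forms, the metric and Pfaffians *)

Local Notation o0 := (@Ordinal 5 0 isT).
Local Notation o1 := (@Ordinal 5 1 isT).
Local Notation o2 := (@Ordinal 5 2 isT).
Local Notation o3 := (@Ordinal 5 3 isT).
Local Notation o4 := (@Ordinal 5 4 isT).

Lemma big_ord5 (V : nmodType) (F : 'I_5 -> V) :
  \sum_(i < 5) F i = F o0 + F o1 + F o2 + F o3 + F o4.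
Proof.
rewrite !big_ord_recr big_ord0 /= add0r.
by congr (F _ + F _ + F _ + F _ + F _); apply: val_inj.
Qed.

Section StandardForms.
Context {R : realType}.

Lemma std_form_anti k : (std_form k : 'M[R]_5)^T = - std_form k.
Proof.
apply/matrixP => i j; rewrite trmxE oppmxE !mxE.
by elim/ord3_case: k; elim/ord5_case: i; elim/ord5_case: j; rewrite /= ?oppr0 ?opprK.
Qed.

Lemma std_form_mul4 k : (std_form k : 'M[R]_5) *m delta_mx o4 (0 : 'I_1) = 0.
Proof.
apply/matrixP => i j; rewrite mulmxE big_ord5 (ord1 j) !mxE.
by elim/ord3_case: k; elim/ord5_case: i; rewrite /=; ring.
Qed.

Lemma std_form_sq k : (std_form k : 'M[R]_5) *m std_form k =
  delta_mx o4 o4 - 1%:M.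
Proof.
apply/matrixP => i j; rewrite mulmxE big_ord5 !mxE.
elim/ord3_case: k; elim/ord5_case: i; elim/ord5_case: j; rewrite /=; ring.
Qed.

Lemma std_form_swap k l : k != l ->
  (std_form k : 'M[R]_5) *m std_form l = - (std_form l *m std_form k).
Proof.
move=> kl; apply/matrixP => i j; rewrite oppmxE !mulmxE !big_ord5 !mxE.
elim/ord3_case: k kl; elim/ord3_case: l => kl //;
  by elim/ord5_case: i; elim/ord5_case: j; rewrite /=; ring.
Qed.

Lemma std_form_prod : (std_form k1 : 'M[R]_5) *m std_form k2 *m std_form k3 =
  1%:M - delta_mx o4 o4.
Proof.
apply/matrixP => i j; rewrite mulmxE big_ord5 !mulmxE !big_ord5 !mxE.
by elim/ord5_case: i; elim/ord5_case: j; rewrite /=; ring.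
Qed.

End StandardForms.

Section AdaptedCoframes.
Context {R : realType}.
Variables (a : 'cV[R]_5) (A : 'I_3 -> 'M[R]_5).

Lemma adapted_quaternionic E : adapted a A E ->
  quaternionic a A (row o4 (invmx E))
    (fun k => (invmx E)^T *m std_form k *m invmx E).
Proof.
move=> [uE aE AE]; set F := invmx E.
have FE : F *m E = 1%:M by rewrite mulVmx.
have EF : E *m F = 1%:M by rewrite mulmxV.
have ETFT : E^T *m F^T = 1%:M by rewrite -trmx_mul FE trmx1.
have {}aE : a = E *m delta_mx o4 0 by rewrite aE colE.
have ABE k l : A k *m (F^T *m std_form l *m F) = E *m (std_form k *m std_form l) *m F.
  by rewrite AE !mulmxA -(mulmxA _ E^T) ETFT mulmx1.
have rE : row o4 F = delta_mx 0 o4 *m F by rewrite rowE.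
have d4 k : delta_mx (0 : 'I_1) o4 *m (std_form k : 'M[R]_5) = 0.
  apply: trmx_inj; rewrite trmx_mul trmx_delta std_form_anti mulNmx std_form_mul4.
  by rewrite oppr0 trmx0.
split.
- by move=> k; rewrite AE !trmx_mul trmxK std_form_anti mulNmx mulmxN mulmxA.
- by move=> k; rewrite !trmx_mul trmxK std_form_anti mulNmx mulmxN mulmxA.
- by move=> k; rewrite rE AE !mulmxA -(mulmxA _ F) FE mulmx1 d4 mul0mx.
- rewrite rE aE mulmxA -(mulmxA _ F) FE mulmx1 mul_delta_mx.
  by apply/matrixP => i j; rewrite !ord1 !mxE.
- by move=> k; rewrite aE -!mulmxA (mulmxA F) FE mul1mx std_form_mul4 mulmx0.
- move=> k; rewrite ABE std_form_sq mulmxBr mulmxBl mulmx1 EF; congr (_ - _).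
  by rewrite rE aE !mulmxA -(mulmxA E) mul_delta_mx.
- by move=> k l kl; rewrite !ABE std_form_swap// mulmxN mulNmx.
Qed.

(** The right-hand side does not involve E, so that all adapted coframes give the
    same metric, and it is a smooth expression in the forms. *)
Lemma adapted_metric E : adapted a A E ->
  E *m E^T = a *m a^T - A k1 *m invmx (A k2 + a *m a^T) *m A k3.
Proof.
move=> aE; have Q := adapted_quaternionic aE; case: aE => uE aE AE.
rewrite -(quat_metric_inv Q) quat_metric.unlock !AE; set F := invmx E.
have FE : F *m E = 1%:M by rewrite mulVmx.
have ETFT : E^T *m F^T = 1%:M by rewrite -trmx_mul FE trmx1.
have -> : E *m std_form k1 *m E^T *m (F^T *m std_form k2 *m F) *m
    (E *m std_form k3 *m E^T) = E *m (std_form k1 *m std_form k2 *m std_form k3) *m E^T.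
  by rewrite !mulmxA -(mulmxA _ E^T) ETFT mulmx1 -(mulmxA _ F) FE mulmx1.
rewrite std_form_prod mulmxBr mulmxBl mulmx1 addrC aE colE trmx_mul trmx_delta.
by rewrite !mulmxA -(mulmxA E) mul_delta_mx subrK.
Qed.

End AdaptedCoframes.

Section PfaffianDuals.
Context {R : realType}.
Implicit Types (W Z : 'M[R]_5) (a : 'cV[R]_5).

(** The 4-form W ^ Z of a 5-space, as the vector whose contraction with the
    volume form it is. *)
Definition pf_vector W Z : 'rV[R]_5 := \row_j nth 0
  [:: pf_polar W Z o1 o2 o3 o4; - pf_polar W Z o0 o2 o3 o4;
      pf_polar W Z o0 o1 o3 o4; - pf_polar W Z o0 o1 o2 o4;
      pf_polar W Z o0 o1 o2 o3] j.

(** The bivector dual to the 3-form obtained by wedging W with a. *)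
Definition pf_dual W a : 'M[R]_5 :=
  let d l m n := W l m * a n 0 - W l n * a m 0 + W m n * a l 0 in
  \matrix_(i, j) nth 0 (nth [::]
  [:: [:: 0; d o2 o3 o4; - d o1 o3 o4; d o1 o2 o4; - d o1 o2 o3];
      [:: - d o2 o3 o4; 0; d o0 o3 o4; - d o0 o2 o4; d o0 o2 o3];
      [:: d o1 o3 o4; - d o0 o3 o4; 0; d o0 o1 o4; - d o0 o1 o3];
      [:: - d o1 o2 o4; d o0 o2 o4; - d o0 o1 o4; 0; d o0 o1 o2];
      [:: d o1 o2 o3; - d o0 o2 o3; d o0 o1 o3; - d o0 o1 o2; 0]] i) j.

Lemma anti5 W : W^T = - W ->
  (W o0 o0 = 0) * (W o1 o1 = 0) * (W o2 o2 = 0) * (W o3 o3 = 0) * (W o4 o4 = 0)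
  * (W o1 o0 = - W o0 o1) * (W o2 o0 = - W o0 o2) * (W o3 o0 = - W o0 o3)
  * (W o4 o0 = - W o0 o4) * (W o2 o1 = - W o1 o2) * (W o3 o1 = - W o1 o3)
  * (W o4 o1 = - W o1 o4) * (W o3 o2 = - W o2 o3) * (W o4 o2 = - W o2 o4)
  * (W o4 o3 = - W o3 o4).
Proof.
move=> aW; have e i j : W j i = - W i j by rewrite -oppmxE -aW trmxE.
have e0 i : W i i = 0.
  by have /eqP := e i i; rewrite -addr_eq0 -mulr2n mulrn_eq0 => /eqP.
by do !split.
Qed.

Lemma pf_dual_anti W a : (pf_dual W a)^T = - pf_dual W a.
Proof.
apply/matrixP => i j; rewrite trmxE oppmxE !mxE.
by elim/ord5_case: i; elim/ord5_case: j; rewrite /= ?oppr0 ?opprK.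
Qed.

Lemma pf_dual_mul W a : W^T = - W -> pf_dual W a *m a = 0.
Proof.
move=> aW; apply/colP => i; rewrite mulmxE big_ord5 !mxE.
by elim/ord5_case: i; rewrite /=; ring.
Qed.

Lemma pf_vector_mul W : W^T = - W -> pf_vector W W *m W = 0.
Proof.
move=> /anti5 aW; apply/rowP => i; rewrite mulmxE big_ord5 !mxE.
by elim/ord5_case: i; rewrite /= /pf_polar !aW; ring.
Qed.

(** The Leibniz rule for the contraction of W ^ Z ^ a with a vector, in terms of
    duals. When W ^ Z vanishes for distinct members of a triple of 2-forms, and
    does not depend on W for W = Z, this becomes the quaternionic relations. *)
Lemma pf_dual_clifford W Z a : W^T = - W -> Z^T = - Z ->
  W *m pf_dual Z a + Z *m pf_dual W a =
  a *m pf_vector W Z - (pf_vector W Z *m a) 0 0 *: 1%:M.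
Proof.
move=> /anti5 aW /anti5 aZ; apply/matrixP => i j.
rewrite !addmxE oppmxE scalemxE !mulmxE !big_ord5 big_ord_recl big_ord0 !mxE.
by elim/ord5_case: i; elim/ord5_case: j; rewrite /= /pf_polar !aW !aZ; ring.
Qed.

End PfaffianDuals.

(** * Existence of adapted coframes *)

Section Existence.
Context {R : realType}.

Lemma pf_quaternionic (a : 'cV[R]_5) (A : 'I_3 -> 'M[R]_5) (rho : 'rV[R]_5)
    (s := (rho *m a) 0 0) :
  (forall k, (A k)^T = - A k) ->
  (forall k l, pf_vector (A k) (A l) = if k == l then rho else 0) ->
  s != 0 ->
  quaternionic a A (s^-1 *: rho) (fun k => (2 / s) *: pf_dual (A k) a).
Proof.
move=> aA pfA s0; split.
- exact: aA.
- by move=> k; rewrite linearZ /= pf_dual_anti scalerN.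
- move=> k; rewrite -scalemxAl; have := pfA k k; rewrite eqxx => <-.
  by rewrite pf_vector_mul// scaler0.
- rewrite -scalemxAl; apply/matrixP => i j; rewrite !ord1 scalemxE -/s mulVf//.
  by rewrite mxE.
- by move=> k; rewrite -scalemxAl pf_dual_mul// scaler0.
- move=> k; have := pf_dual_clifford a (aA k) (aA k); rewrite pfA eqxx -/s.
  rewrite -mulr2n -scaler_nat => e.
  rewrite -scalemxAr [2 / s]mulrC -scalerA e scalerBr scalerA mulVf// scale1r.
  by rewrite scalemxAr.
- move=> k l kl; have := pf_dual_clifford a (aA k) (aA l).
  rewrite pfA (negPf kl) mul0mx mulmx0 mxE scale0r subrr => /eqP.
  by rewrite -!scalemxAr addr_eq0 => /eqP ->; rewrite scalerN.
Qed.

(** The relations do not depend on the basis, and they force the tuple X on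
    which they are tested to be one. *)
Lemma quaternionic_basis n (a : 'cV[R]_n) (A : 'I_3 -> 'M[R]_n) (X : 'M[R]_n)
    (r : 'rV[R]_n) (B : 'I_3 -> 'M[R]_n) : (forall k, (A k)^T = - A k) ->
  quaternionic (X *m a) (fun k => X *m A k *m X^T) r B ->
  quaternionic a A (r *m X) (fun k => X^T *m B k *m X).
Proof.
move=> aA Q.
have uX : X \in unitmx.
  have e : X *m (a *m r - A k1 *m X^T *m B k1) = 1%:M.
    rewrite mulmxBr !mulmxA (quat_sq Q).
    by rewrite opprB addrCA subrr addr0.
  by case: (mulmx1_unit e).
have uXT : X^T \in unitmx by rewrite unitmx_tr.
have ABE k l : A k *m (X^T *m B l *m X) = invmx X *m (X *m A k *m X^T *m B l) *m X.
  by rewrite !mulmxA mulVmx// mul1mx.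
split.
- exact: aA.
- by move=> k; rewrite !trmx_mul trmxK (quatB_anti Q) mulNmx mulmxN mulmxA.
- move=> k; apply: (can_inj (mulmxK uXT)).
  by rewrite mul0mx -!mulmxA (mulmxA X) (quat_rA Q).
- by rewrite -mulmxA (quat_ra Q).
- by move=> k; rewrite -!mulmxA (quat_Ba Q) mulmx0.
- move=> k; rewrite ABE (quat_sq Q) mulmxBr mulmxBl mulmx1 mulVmx//.
  by rewrite !mulmxA mulVmx// mul1mx.
- by move=> k l kl; rewrite !ABE (quat_swap Q)// mulmxN mulNmx.
Qed.

Lemma quadratic_form_eq0 n (G : 'M[R]_n) : G^T = G ->
  (forall V : 'rV[R]_n, V *m G *m V^T = 0) -> G = 0.
Proof.
move=> sG G0; apply/matrixP => i j; rewrite mxE.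
pose e (k : 'I_n) : 'rV[R]_n := delta_mx 0 k.
have ent k l : (e k *m G *m (e l)^T) 0 0 = G k l.
  by rewrite /e -rowE trmx_delta -colE !mxE.
have := G0 (e i + e j); rewrite linearD /= mulmxDl !mulmxDl !mulmxDr !G0.
rewrite add0r addr0 => /matrixP /(_ 0 0); rewrite addmxE !ent mxE.
rewrite -{2}sG trmxE => /eqP; rewrite -mulr2n mulrn_eq0 /= => /eqP ->.
by [].
Qed.

(** A vector of positive length, normalised, generates an adapted coframe. *)
Lemma quaternionic_adapted (a : 'cV[R]_5) (A : 'I_3 -> 'M[R]_5)
    (r : 'rV[R]_5) (B : 'I_3 -> 'M[R]_5) : quaternionic a A r B ->
  (forall V : 'rV[R]_5, 0 <= (V *m quat_metric A B *m V^T) 0 0) ->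
  exists E, adapted a A E.
Proof.
move=> Q g0; set g := quat_metric A B.
have [V gV] : exists V : 'rV[R]_5, 0 < (V *m g *m V^T) 0 0.
  apply: contrapT => /forallNP gN.
  (* If no vector has positive length then g = 0, whence A_1 = 0 and a r = 1,
     but a r has trace 1. *)
  have gz : g = 0.
    apply: quadratic_form_eq0 => [|V]; first exact: quat_metric_sym Q.
    apply/matrixP => i j; rewrite !ord1 [RHS]mxE; apply/eqP; rewrite eq_le.
    by apply/andP; split; [rewrite leNgt; apply/negP/gN|exact: g0].
  have : A k1 *m B k2 *m A k2 = 0.
    have := quat_metricB Q k3; rewrite -/g gz mul0mx => /eqP.
    rewrite eq_sym oppr_eq0 => /eqP e; rewrite -[RHS](mul0mx _ (A k2)) -e.
    by congr (A _ *m B _ *m _); apply: val_inj.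
  rewrite -mulmxA (quat_sq_tr Q) linearB /= trmx1 mulmxBr mulmx1 trmx_mul mulmxA.
  rewrite (quat_Art Q) mul0mx sub0r => /eqP; rewrite oppr_eq0 => /eqP A0.
  have := quat_sq Q k1; rewrite A0 mul0mx => /esym/eqP; rewrite subr_eq0 => /eqP e.
  have := congr1 mxtrace e; rewrite mxtrace_mulC (quat_ra Q) !mxtrace1 => /eqP.
  by rewrite eqr_nat.
pose W := (Num.sqrt ((V *m g *m V^T) 0 0))^-1 *: V.
exists (quat_coframe a A B W); apply: (quat_coframe_adapted Q).
rewrite /W linearZ /= -!scalemxAl -scalemxAr scalerA -invfM -expr2 sqr_sqrtr ?ltW//.
apply/matrixP => i j; rewrite !ord1 scalemxE mulVf ?gt_eqF//.
by rewrite mxE.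
Qed.

(** The pointwise content of the definition of an SU(2)-structure by forms: the
    wedge conditions, tested on a tuple X on which the volume does not vanish,
    give the quaternionic relations, and the positivity condition says that the
    metric is positive. *)
Lemma adapted_exists (a : 'cV[R]_5) (A : 'I_3 -> 'M[R]_5) (X : 'M[R]_5)
    (rho : 'rV[R]_5) :
  (forall k, (A k)^T = - A k) ->
  (forall k l, pf_vector (X *m A k *m X^T) (X *m A l *m X^T) =
               if k == l then rho else 0) ->
  (rho *m (X *m a)) 0 0 != 0 ->
  (forall V W : 'rV[R]_5, V *m A k1 = W *m A k2 -> 0 <= (V *m A k3 *m W^T) 0 0) ->
  exists E, adapted a A E.
Proof.
move=> aA pfA s0 pos.
have aXA k : (X *m A k *m X^T)^T = - (X *m A k *m X^T).
  by rewrite !trmx_mul trmxK aA mulNmx mulmxN mulmxA.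
have := quaternionic_basis aA (pf_quaternionic aXA pfA s0).
move: (_ *m X) (fun k => _) => r B Q.
apply: (quaternionic_adapted Q) => V.
(* V and W = - V A_1 B_2 are related as in the positivity condition. *)
have e : V *m A k1 = (- (V *m A k1 *m B k2)) *m A k2.
  rewrite mulNmx -[_ *m _ *m A k2]mulmxA (quat_sq_tr Q) linearB /= trmx1 trmx_mul.
  by rewrite mulmxBr mulmx1 mulmxA -(mulmxA V) (quat_Art Q) mulmx0 mul0mx sub0r opprK.
have := pos _ _ e; rewrite linearN /= 2!trmx_mul aA (quatB_anti Q).
rewrite (quat_metric_cyc Q) (quat_swap Q (_ : k2 != k3))//.
by rewrite !(mulNmx, mulmxN) ?opprK !mulmxA.
Qed.

End Existence.

(** * The matrices of an SU(2)-structure *)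

Lemma mulmx_row_form (R : pzRingType) k n (X : 'M[R]_(k, n)) (W : 'M[R]_n) i j :
  (X *m W *m X^T) i j = (row i X *m W *m (row j X)^T) 0 0.
Proof.
rewrite -row_mul !mulmxE; apply: eq_bigr => l _.
by rewrite [row _ _ _ _]mxE 2!trmxE [row _ _ _ _]mxE.
Qed.

Section MatricesOfStructure.
Context {R : realType} (M : smooth_manifold R 5) (S : su2_structure M).
Variable c : chart M.

Definition alpha_mx (x : 'rV[R]_5) : 'cV[R]_5 := mx_of_form1 (alpha S c x).

Definition omega_mx (k : 'I_3) (x : 'rV[R]_5) : 'M[R]_5 :=
  mx_of_form2 (omega S k c x).

Lemma open_chart_range : open (chart_range c).
Proof. exact: atlas_open_range (manifold_smooth M) c. Qed.

Lemma alpha_mxE x X : chart_range c x ->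
  alpha S c x X = (X *m alpha_mx x) 0 0.
Proof. by move=> cx; apply/form1E/form_multilinear. Qed.

Lemma omega_mxE k x X Y : chart_range c x ->
  omega S k c x (mrows 2 [:: X; Y]) = (X *m omega_mx k x *m Y^T) 0 0.
Proof. by move=> cx; apply/form2_row/form_multilinear. Qed.

Lemma omega_anti k x X Y : chart_range c x ->
  omega S k c x (mrows 2 [:: X; Y]) = - omega S k c x (mrows 2 [:: Y; X]).
Proof.
move=> cx; apply: form2_anti; [exact: form_multilinear|exact: form_alternating].
Qed.

Lemma omega_mx_anti k x : chart_range c x -> (omega_mx k x)^T = - omega_mx k x.
Proof.
by move=> cx; apply: mx_of_form2_anti; [exact: form_multilinear|exact: form_alternating].
Qed.

Lemma mclass_C_alpha_mx m : mclass_C m (chart_range c) alpha_mx.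
Proof.
apply/mclass_CP => i j.
apply: class_C_eq (class_C_smooth_on m (@form_smooth R 5 M 1 (alpha S) c (delta_mx 0 i))).
  exact: open_chart_range.
by move=> x _; rewrite mxE.
Qed.

Lemma mclass_C_omega_mx m k : mclass_C m (chart_range c) (omega_mx k).
Proof.
apply/mclass_CP => i j.
apply: class_C_eq (class_C_smooth_on m (@form_smooth R 5 M 2 (omega S k) c
   (mrows 2 [:: delta_mx 0 i; delta_mx 0 j]))).
  exact: open_chart_range.
by move=> x _; rewrite mxE.
Qed.

Lemma structure_adapted x : chart_range c x ->
  exists E, adapted (alpha_mx x) (omega_mx^~ x) E.
Proof.
move=> cx; have [v /(_ c x cx)[wv [X X0]]] := omega_wedge S.
pose u i := row i X.
have WE k : X *m omega_mx k x *m X^T =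
    \matrix_(i, j) omega S k c x (mrows 2 [:: u i; u j]).
  by apply/matrixP => i j; rewrite [RHS]mxE omega_mxE// mulmx_row_form.
have pfE k l p q s t : pf_polar (X *m omega_mx k x *m X^T) (X *m omega_mx l x *m X^T) p q s t =
    if k == l then v c x (mrows 4 [:: u p; u q; u s; u t]) else 0.
  rewrite -wv !WE -wedge22//; by move=> Y Z; exact: omega_anti.
have vE Z : v c x Z = (omega S k1 c x \w omega S k1 c x) Z by rewrite wv eqxx.
have XE : X = mrows 5 [:: u o0; u o1; u o2; u o3; u o4].
  by apply/row_matrixP; apply: ord5_case; rewrite row_mrows.
pose rho : 'rV[R]_5 := \row_j ((-1) ^+ j * v c x (row' j X)).
apply: (@adapted_exists _ _ _ X rho).
- by move=> k; exact: omega_mx_anti.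
- move=> k l; apply/rowP => j; rewrite mxE !pfE.
  have -> : (if k == l then rho else 0) 0 j = if k == l then rho 0 j else 0.
    by case: eqP => // _; rewrite mxE.
  case: eqP => _; last by elim/ord5_case: j; rewrite /= ?oppr0.
  rewrite [RHS]mxE {1}XE row'_mrows//.
  elim/ord5_case: j; rewrite /= ?expr0 ?expr1 ?sqrrN ?expr1n ?mul1r ?mulN1r //.
    by rewrite (exprS _ 2) sqrrN expr1n mulr1 mulN1r.
  by rewrite (exprM _ 2 2) sqrrN !expr1n mul1r.
- have <- : (v c x \w alpha S c x) X = (rho *m (X *m alpha_mx x)) 0 0; last by [].
  rewrite wedge41 => [|s Z]; last by rewrite !vE wedge_row_perm.
  rewrite mulmxE; apply: eq_bigr => j _; rewrite [rho _ _]mxE mulrA; congr (_ * _).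
  by rewrite alpha_mxE// -row_mul mxE.
- move=> V W e; have := omega_positive (s := S) cx (X := V) (Y := W).
  rewrite col_mx_mrows omega_mxE//; apply => Z; rewrite !col_mx_mrows.
  by rewrite !omega_mxE// e.
Qed.

Lemma std_form_rows (u w : 'rV[R]_5) (e := fun i j => u 0 i * w 0 j - w 0 i * u 0 j) :
  [/\ (u *m std_form k1 *m w^T) 0 0 = e o0 o1 + e o2 o3,
      (u *m std_form k2 *m w^T) 0 0 = e o0 o2 - e o1 o3 &
      (u *m std_form k3 *m w^T) 0 0 = e o0 o3 + e o1 o2].
Proof.
by split; rewrite mulmxE big_ord5 !mulmxE !big_ord5 !mxE /= /e; ring.
Qed.

Lemma adapted_rows x E k (X Y : 'rV[R]_5) :
  omega_mx k x = E *m std_form k *m E^T ->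
  (X *m omega_mx k x *m Y^T) 0 0 = ((X *m E) *m std_form k *m (Y *m E)^T) 0 0.
Proof. by move=> ->; rewrite trmx_mul !mulmxA. Qed.

Lemma adapted_coframe_mx x E : chart_range c x ->
  adapted_coframe S c x E <-> adapted (alpha_mx x) (omega_mx^~ x) E.
Proof.
move=> cx; split=> [[uE aE w1 w2 w3]|[uE aE wE]].
  have ome k :
      (forall X Y, omega S k c x (mrows 2 [:: X; Y]) =
        ((X *m E) *m std_form k *m (Y *m E)^T) 0 0) ->
      omega_mx k x = E *m std_form k *m E^T.
    move=> H; apply/matrixP => i j; rewrite mxE H mulmx_row_form.
    by rewrite -2!rowE.
  split=> //.
    apply/matrixP => i j; rewrite [LHS]mxE ord1 aE /covector -rowE.
    by rewrite !mxE.
  apply: ord3_case; apply: ome => X Y.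
  - have [-> _ _] := std_form_rows (X *m E) (Y *m E).
    by rewrite [LHS](congr1 (@^~ _) w1) /= !wedge11.
  - have [_ -> _] := std_form_rows (X *m E) (Y *m E).
    by rewrite [LHS](congr1 (@^~ _) w2) /= !wedge11.
  - have [_ _ ->] := std_form_rows (X *m E) (Y *m E).
    by rewrite [LHS](congr1 (@^~ _) w3) /= !wedge11.
have Zrow (Z : 'M[R]_(2, 5)) : Z = mrows 2 [:: row ord0 Z; row ord_max Z].
  by apply/row_matrixP => -[[|[|//]] i]; rewrite row_mrows /=; congr row; apply: val_inj.
split=> //.
- apply/funext => X; rewrite alpha_mxE// aE /covector !mulmxE.
  by apply: eq_bigr => i _; rewrite [col _ _ _ _]mxE.
- apply/funext => Z; rewrite [Z]Zrow [LHS]omega_mxE// (adapted_rows _ _ (wE k1)).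
  by have [-> _ _] := std_form_rows (row ord0 Z *m E) (row ord_max Z *m E); rewrite /= !wedge11.
- apply/funext => Z; rewrite [Z]Zrow [LHS]omega_mxE// (adapted_rows _ _ (wE k2)).
  by have [_ -> _] := std_form_rows (row ord0 Z *m E) (row ord_max Z *m E); rewrite /= !wedge11.
- apply/funext => Z; rewrite [Z]Zrow [LHS]omega_mxE// (adapted_rows _ _ (wE k3)).
  by have [_ _ ->] := std_form_rows (row ord0 Z *m E) (row ord_max Z *m E); rewrite /= !wedge11.
Qed.

Lemma coframe_adapted x : chart_range c x ->
  adapted (alpha_mx x) (omega_mx^~ x) (coframe S c x).
Proof.
move=> cx; have [E /(adapted_coframe_mx E cx) aE] := structure_adapted cx.
by apply/(adapted_coframe_mx _ cx); exact: (xgetPex 0 (ex_intro _ E aE)).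
Qed.

(** The metric of any adapted coframe at x. *)
Definition form_metric (x : 'rV[R]_5) : 'M[R]_5 :=
  alpha_mx x *m (alpha_mx x)^T -
  omega_mx k1 x *m invmx (omega_mx k2 x + alpha_mx x *m (alpha_mx x)^T)
    *m omega_mx k3 x.

Lemma metricE x X Y : chart_range c x ->
  metric S c x X Y = (X *m form_metric x *m Y^T) 0 0.
Proof.
move=> cx; rewrite /form_metric -(adapted_metric (coframe_adapted cx)) /metric.
by rewrite mulmxA -[_ *m _ *m Y^T]mulmxA -trmx_mul mulmxE; apply: eq_bigr => k _;
  rewrite trmxE.
Qed.

Lemma gram_metric x : chart_range c x -> gram (metric S c) x = form_metric x.
Proof.
move=> cx; apply/matrixP => i j; rewrite mxE metricE//.
by rewrite -rowE trmx_delta -colE !mxE.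
Qed.

Lemma metricTE x X Y : chart_range c x ->
  metricT S c x X Y = metric S c x X Y - alpha S c x X * alpha S c x Y.
Proof.
move=> cx; have /(adapted_coframe_mx _ cx)[_ aE _ _ _] := coframe_adapted cx.
rewrite /metric /metricT big_ord5 big_mkcond big_ord5 /= !aE.
by rewrite addr0 addrK.
Qed.

(** The vector that generates the coframe is a fixed vector divided by its
    transverse length, which depends smoothly on the point. The fixed vector is
    chosen of length 1 at x0, hence its length is positive near x0. *)
Lemma smooth_adapted_frame x0 : chart_range c x0 ->
  exists (U : set 'rV[R]_5) (E : 'rV[R]_5 -> 'M[R]_5),
    [/\ open U, U x0, U `<=` chart_range c, mclass_C 2 U E &
        forall x, U x -> adapted (alpha_mx x) (omega_mx^~ x) (E x)].
Proof.
move=> cx0; have aE0 := coframe_adapted cx0; set E0 := coframe S c x0 in aE0.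
pose g x := form_metric x - alpha_mx x *m (alpha_mx x)^T.
pose V := row o0 (invmx E0).
pose N x := (V *m g x *m V^T) 0 0.
have oc := open_chart_range.
have Ca : mclass_C 2 (chart_range c) alpha_mx by exact: mclass_C_alpha_mx.
have CA k : mclass_C 2 (chart_range c) (omega_mx k) by exact: mclass_C_omega_mx.
have Caa : mclass_C 2 (chart_range c) (fun x => alpha_mx x *m (alpha_mx x)^T).
  by apply: mclass_CM => //; exact: mclass_CT.
have quat x : chart_range c x -> exists r B,
    quaternionic (alpha_mx x) (omega_mx^~ x) r B.
  by move=> /structure_adapted[E /adapted_quaternionic Q]; eexists; eexists; exact: Q.
have gE x r B : quaternionic (alpha_mx x) (omega_mx^~ x) r B ->
    g x = quat_metric (omega_mx^~ x) B.
  by move=> Q; rewrite (quat_metric_inv Q) /g /form_metric addrAC subrr add0r.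
have Cg : mclass_C 2 (chart_range c) g.
  apply: (mclass_CB oc) => //; apply: (mclass_CB oc) => //.
  apply: (mclass_CM oc) => //; apply: (mclass_CM oc) => //.
  apply: (mclass_CV oc) => [x cx|]; last exact: mclass_CD.
  have [r [B Q]] := quat x cx.
  by case: (mulmx1_unit (quat_unit Q k2)).
have CN : class_C 2 (chart_range c) N.
  have /mclass_CP := mclass_CM oc (mclass_CM oc (mclass_C_cst _ 2 V) Cg)
                               (mclass_C_cst _ 2 V^T).
  exact.
have N0 : N x0 = 1.
  case: (aE0) => uE0 a0 _.
  have -> : N x0 = (V *m (E0 *m E0^T) *m V^T) 0 0 - (V *m alpha_mx x0) 0 0 ^+ 2.
    rewrite (adapted_metric aE0) -/(form_metric x0) /N /g mulmxBr mulmxBl.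
    rewrite addmxE oppmxE; congr (_ - _).
    have -> : V *m (alpha_mx x0 *m (alpha_mx x0)^T) *m V^T =
        (V *m alpha_mx x0) *m (V *m alpha_mx x0)^T by rewrite trmx_mul !mulmxA.
    by rewrite mulmxE big_ord1 trmxE expr2.
  have VE : V *m E0 = delta_mx 0 o0 by rewrite /V rowE -mulmxA mulVmx// mulmx1.
  have -> : V *m alpha_mx x0 = 0 by rewrite a0 colE mulmxA VE mul_delta_mx_0.
  rewrite [X in X ^+ 2]mxE expr0n subr0.
  by rewrite mulmxA -(mulmxA _ E0^T) -trmx_mul VE trmx_delta mul_delta_mx mxE.
(* As N is continuous at x0, the interior is a neighbourhood of x0. *)
pose U := (chart_range c `&` [set x | 0 < N x])°.
exists U, (fun x => mcols 5 [:: g x *m ((Num.sqrt (N x))^-1 *: V)^T;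
   - (omega_mx k1 x *m ((Num.sqrt (N x))^-1 *: V)^T);
   - (omega_mx k2 x *m ((Num.sqrt (N x))^-1 *: V)^T);
   - (omega_mx k3 x *m ((Num.sqrt (N x))^-1 *: V)^T); alpha_mx x]).
have oU : open U by exact: open_interior.
have UN x : U x -> chart_range c x /\ 0 < N x by move=> /interior_subset[].
have Uc : U `<=` chart_range c by move=> x /UN[].
have CU m p q (f : 'rV[R]_5 -> 'M[R]_(p, q)) :
    mclass_C m (chart_range c) f -> mclass_C m U f.
  by move=> /mclass_CP Cf; apply/mclass_CP => i j; apply: class_CS (Cf i j).
split=> //.
- apply: filterI; first exact: open_nbhs_nbhs.
  have : N @ x0 --> N x0 by exact: class_C_continuous CN cx0.
  rewrite N0 => cN; apply: (cN [set t | 0 < t]).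
  by apply: open_nbhs_nbhs; split; [exact: open_gt|exact: ltr01].
- have CW : mclass_C 2 U (fun x => ((Num.sqrt (N x))^-1 *: V)^T).
    apply: mclass_CT => //; apply: mclass_CZ => //; last exact: mclass_C_cst.
    apply: class_CV => [//|x /UN[_ Nx]|]; first by rewrite gt_eqF// sqrtr_gt0.
    by apply: class_C_sqrt => [//|x /UN[]|]; last exact: class_CS CN.
  have CAW k : mclass_C 2 U (fun x => - (omega_mx k x *m ((Num.sqrt (N x))^-1 *: V)^T)).
    by apply: mclass_CN => //; apply: mclass_CM => //; exact: CU.
  have CgW : mclass_C 2 U (fun x => g x *m ((Num.sqrt (N x))^-1 *: V)^T).
    by apply: mclass_CM => //; exact: CU.
  apply/mclass_CP => i j.
  apply: (@class_C_eq _ _ _ _ (fun x => (nth (fun=> 0)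
     [:: fun x => g x *m ((Num.sqrt (N x))^-1 *: V)^T;
         fun x => - (omega_mx k1 x *m ((Num.sqrt (N x))^-1 *: V)^T);
         fun x => - (omega_mx k2 x *m ((Num.sqrt (N x))^-1 *: V)^T);
         fun x => - (omega_mx k3 x *m ((Num.sqrt (N x))^-1 *: V)^T); alpha_mx] j) x i 0)) => //.
    by move=> x _; rewrite [RHS]mxE; elim/ord5_case: j.
  have := CgW; have := CAW k1; have := CAW k2; have := CAW k3; have := CU _ _ _ _ Ca.
  by move=> /mclass_CP h1 /mclass_CP h2 /mclass_CP h3 /mclass_CP h4 /mclass_CP h5;
    elim/ord5_case: j.
- move=> x /UN[cx Nx]; have [r [B Q]] := quat x cx.
  rewrite (gE _ _ _ Q); apply: (quat_coframe_adapted Q).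
  rewrite linearZ /= -scalemxAr -!scalemxAl scalerA -invfM -expr2 sqr_sqrtr ?ltW//.
  apply/matrixP => i j; rewrite !ord1 scalemxE -(gE _ _ _ Q) -/(N x) mulVf ?gt_eqF//.
  by rewrite mxE.
Qed.

End MatricesOfStructure.

(** * Differential equations from the cone *)

Section ExteriorDerivativeRows.
Context {R : realType} {n : nat}.
Implicit Types X Y Z T : 'rV[R]_n.

Lemma ext_deriv_rows2 (w : 'rV[R]_n -> 'M[R]_(1, n) -> R) x X Y :
  ext_deriv w x (mrows 2 [:: X; Y]) =
  'D_X (fun y => w y Y) x - 'D_Y (fun y => w y X) x.
Proof.
rewrite /ext_deriv !big_ord_recl big_ord0 /= !row_mrows /= !row'_mrows//= !mrows1.
by rewrite expr0 expr1 mul1r mulN1r addr0.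
Qed.

Lemma ext_deriv_rows3 (w : 'rV[R]_n -> 'M[R]_(2, n) -> R) x X Y Z :
  ext_deriv w x (mrows 3 [:: X; Y; Z]) =
  'D_X (fun y => w y (mrows 2 [:: Y; Z])) x
  - 'D_Y (fun y => w y (mrows 2 [:: X; Z])) x
  + 'D_Z (fun y => w y (mrows 2 [:: X; Y])) x.
Proof.
rewrite /ext_deriv !big_ord_recl big_ord0 /= !row_mrows /= !row'_mrows//=.
by rewrite expr0 expr1 sqrrN expr1n !mul1r mulN1r addr0 addrA.
Qed.

Lemma ext_deriv_rows4 (w : 'rV[R]_n -> 'M[R]_(3, n) -> R) x X Y Z T :
  ext_deriv w x (mrows 4 [:: X; Y; Z; T]) =
  'D_X (fun y => w y (mrows 3 [:: Y; Z; T])) x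
  - 'D_Y (fun y => w y (mrows 3 [:: X; Z; T])) x
  + 'D_Z (fun y => w y (mrows 3 [:: X; Y; T])) x
  - 'D_T (fun y => w y (mrows 3 [:: X; Y; Z])) x.
Proof.
rewrite /ext_deriv !big_ord_recl big_ord0 /= !row_mrows /= !row'_mrows//=.
rewrite expr0 expr1 sqrrN expr1n (exprS _ 2) sqrrN expr1n !mul1r mulr1 !mulN1r addr0.
by rewrite !addrA.
Qed.

(** Directional derivatives only depend on the restriction to a line, which
    turns those on the cone into derivatives on the base or in t. *)
Lemma derive_affine (V W : normedModType R) (f : V -> R) (g : W -> R) x v y w :
  (forall h : R, f (h *: v + x) = g (h *: w + y)) -> 'D_v f x = 'D_w g y.
Proof.
move=> fg; rewrite /derive; have fx : f x = g y.
  by have := fg 0; rewrite !scale0r !add0r.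
set g1 := fun h => h^-1 *: _; set g2 := fun h => h^-1 *: _.
suff -> : g1 = g2 by [].
by rewrite funeqE /g1 /g2 => h /=; rewrite fg fx.
Qed.

Lemma derive_monomial (a : R) m : 'D_1 (fun t : R => t ^+ m * a) 1 = m%:R * a.
Proof.
rewrite (_ : (fun t : R => t ^+ m * a) = a \o* (fun t : R => t ^+ m)); last first.
  by apply/funext => t /=.
rewrite deriveMr; last by apply: exprn_derivable.
by rewrite exp_derive expr1n [X in _ * X]mulr1 [X in _ * X]mulr1 mulrC.
Qed.

End ExteriorDerivativeRows.

Section ConeEquations.
Local Open Scope complex_scope.
Context {R : realType} (M : smooth_manifold R 5) (S : su2_structure M).
Variable c : chart M.
Implicit Types X Y Z T : 'rV[R]_5.

Definition cone_vec X (s : R) : 'rV[R]_(5 + 1) := row_mx X (s%:M : 'M[R]_1).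

Lemma cone_point_range x : chart_range c x ->
  @chart_range R 6 _ (cone M) c (cone_vec x 1).
Proof. by move=> [p cp <-]; exists (p, 1) => //; split=> //=; exact: ltr01. Qed.

Lemma lsubmx_mrows k (s : seq 'rV[R]_(5 + 1)) :
  lsubmx (mrows k s) = mrows k [seq lsubmx P | P <- s].
Proof.
apply/matrixP => i j; rewrite !mxE.
have [si|si] := ltnP i (size s); first by rewrite (nth_map 0)// mxE.
by rewrite !nth_default ?size_map// !mxE.
Qed.

Lemma cone_vecD h X x s t :
  h *: cone_vec X s + cone_vec x t = cone_vec (h *: X + x) (h * s + t).
Proof. by rewrite /cone_vec scale_row_mx add_row_mx scale_scalar_mx -raddfD. Qed.

Lemma cone_vec_l X s : lsubmx (cone_vec X s) = X.
Proof. by rewrite row_mxKl. Qed.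

Lemma cone_vec_r X s : rsubmx (cone_vec X s) 0 0 = s.
Proof. by rewrite row_mxKr mxE eqxx mulr1n. Qed.

Lemma cone_kappa_rows x t X Y (s u : R) :
  cone_kappa S c (cone_vec x t) (mrows 2 [:: cone_vec X s; cone_vec Y u]) =
  t ^+ 2 * omega1 S c x (mrows 2 [:: X; Y]) +
  t * (alpha S c x X * u - alpha S c x Y * s).
Proof.
rewrite /cone_kappa /cone_t (cone_vec_r x t); congr (_ * _ + _ * _).
  by rewrite /cone_pullback (cone_vec_l x t) (@lsubmx_mrows 2 [:: cone_vec X s; cone_vec Y u]) /= !cone_vec_l.
rewrite (@wedge11 R _ R).
by rewrite /cone_pullback /cone_dt !cone_vec_l !cone_vec_r.
Qed.

Lemma cone_eps_rows x t X Y Z (s u r : R) : chart_range c x ->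
  complex.Re (cone_eps S c (cone_vec x t) (mrows 3 [:: cone_vec X s; cone_vec Y u; cone_vec Z r])) =
  t ^+ 3 * (omega2 S c x (mrows 2 [:: X; Y]) * alpha S c x Z
            - omega2 S c x (mrows 2 [:: X; Z]) * alpha S c x Y
            + omega2 S c x (mrows 2 [:: Y; Z]) * alpha S c x X)
  - t ^+ 2 * (omega3 S c x (mrows 2 [:: X; Y]) * r
              - omega3 S c x (mrows 2 [:: X; Z]) * u
              + omega3 S c x (mrows 2 [:: Y; Z]) * s).
Proof.
move=> cx; rewrite /cone_eps /cone_t (cone_vec_r x t).
have F2 : 2%:R != 0 :> R[i] by rewrite pnatr_eq0.
rewrite (@wedge21 R 6 R[i] _ _ _ _ _ F2) => [|P Q]; last first.
  rewrite /cone_pullback !(cone_vec_l x t) (@lsubmx_mrows 2 [:: P; Q])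
    (@lsubmx_mrows 2 [:: Q; P]) /=.
  by rewrite /omega2 /omega3 (omega_anti S k2 (@lsubmx R 1 5 1 P) _ cx)
    (omega_anti S k3 (@lsubmx R 1 5 1 P) _ cx).
rewrite /cone_pullback /cone_dt (cone_vec_l x t).
rewrite (@lsubmx_mrows 2 [:: cone_vec X s; cone_vec Y u]).
rewrite (@lsubmx_mrows 2 [:: cone_vec X s; cone_vec Z r]).
rewrite (@lsubmx_mrows 2 [:: cone_vec Y u; cone_vec Z r]) /= !cone_vec_l !cone_vec_r.
rewrite /=; ring.
Qed.

Lemma cone_derive_horizontal (f : 'rV[R]_(5 + 1) -> R) (g : 'rV[R]_5 -> R) x X :
  chart_range c x -> (forall z, chart_range c z -> f (cone_vec z 1) = g z) ->
  'D_(cone_vec X 0 : 'rV[R]_6) (f : 'rV[R]_6 -> R) (cone_vec x 1) = 'D_X g x.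
Proof.
move=> cx fg; transitivity ('D_X (fun z => f (cone_vec z 1)) x).
  apply: (@derive_affine R 'rV[R]_6 'rV[R]_5) => h.
  by rewrite (cone_vecD h X x 0 1) mulr0 add0r.
exact/near_eq_derive/(open_near_eq (@open_chart_range R M c) cx fg).
Qed.

Lemma cone_derive_radial (f : 'rV[R]_(5 + 1) -> R) x (a : R) m :
  (forall t, f (cone_vec x t) = t ^+ m * a) ->
  'D_(cone_vec 0 1 : 'rV[R]_6) (f : 'rV[R]_6 -> R) (cone_vec x 1) = m%:R * a.
Proof.
move=> fa; rewrite -derive_monomial; apply: (@derive_affine R 'rV[R]_6 R) => h.
rewrite (cone_vecD h 0 x 1 1) scaler0 add0r mulr1 fa.
by congr (_ ^+ m * a); rewrite [h *: _]mulr1.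
Qed.

Hypothesis shf : symplectic_half_flat (cone_kappa S) (cone_J S) (cone_eps S).
Variable x : 'rV[R]_5.
Hypothesis cx : chart_range c x.

Lemma omega_derivable k v V : derivable (fun z => omega S k c z v) x V.
Proof.
have [] // := is_derive_class_C1 V (@open_chart_range R M c)
  (class_C_smooth_on 1 (@form_smooth R 5 M 2 (omega S k) c v)) cx.
Qed.

Lemma alpha_derivable v V : derivable (fun z => alpha S c z v) x V.
Proof.
have [] // := is_derive_class_C1 V (@open_chart_range R M c)
  (class_C_smooth_on 1 (@form_smooth R 5 M 1 (alpha S) c v)) cx.
Qed.

Let dkappa v : ext_deriv (cone_kappa S c) (cone_vec x 1) v = 0.
Proof. by have [+ _ _] := shf (cone_point_range cx). Qed.

Let deps v : ext_deriv (fun z u => complex.Re (cone_eps S c z u)) (cone_vec x 1) v = 0.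
Proof. by have [_ _ +] := shf (cone_point_range cx). Qed.

Let om0l k z X : chart_range c z -> omega S k c z (mrows 2 [:: 0; X]) = 0.
Proof. by move=> cz; rewrite omega_mxE// !mul0mx mxE. Qed.

Let om0r k z X : chart_range c z -> omega S k c z (mrows 2 [:: X; 0]) = 0.
Proof. by move=> cz; rewrite omega_anti// om0l// oppr0. Qed.

Let al0 z : chart_range c z -> alpha S c z 0 = 0.
Proof. by move=> cz; rewrite alpha_mxE// mul0mx mxE. Qed.

(** The dt-component of d kappa = 0 at t = 1; the radial derivative of t^2
    accounts for the factor 2. *)
Lemma cone_dalpha X Y : ext_deriv (alpha S c) x (mrows 2 [:: X; Y]) =
  - 2 * omega1 S c x (mrows 2 [:: X; Y]).
Proof.
have := dkappa (mrows 3 [:: cone_vec X 0; cone_vec Y 0; cone_vec 0 1]).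
rewrite ext_deriv_rows3 ext_deriv_rows2.
have e (V W : 'rV[R]_5) : 'D_(cone_vec V 0 : 'rV[R]_6) (fun z : 'rV[R]_6 =>
    cone_kappa S c z (mrows 2 [:: cone_vec W 0; cone_vec 0 1])) (cone_vec x 1)
    = 'D_V (fun z => alpha S c z W) x.
  apply: cone_derive_horizontal cx _ => z cz; rewrite cone_kappa_rows.
  by rewrite /omega1 om0r// al0//; ring.
have r : 'D_(cone_vec 0 1 : 'rV[R]_6) (fun z : 'rV[R]_6 =>
    cone_kappa S c z (mrows 2 [:: cone_vec X 0; cone_vec Y 0])) (cone_vec x 1)
    = 2 * omega1 S c x (mrows 2 [:: X; Y]).
  apply: (@cone_derive_radial _ _ _ 2) => t; rewrite cone_kappa_rows; ring.
rewrite [X in X - _ + _]e [X in _ - X + _]e [X in _ + X]r => /eqP.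
by rewrite addr_eq0 mulNr => /eqP.
Qed.

(** The component of d kappa = 0 without dt. *)
Lemma cone_domega1 X Y Z : ext_deriv (omega1 S c) x (mrows 3 [:: X; Y; Z]) = 0.
Proof.
have := dkappa (mrows 3 [:: cone_vec X 0; cone_vec Y 0; cone_vec Z 0]).
rewrite !ext_deriv_rows3 => <-.
have e (V W W' : 'rV[R]_5) : 'D_(cone_vec V 0 : 'rV[R]_6) (fun z : 'rV[R]_6 =>
    cone_kappa S c z (mrows 2 [:: cone_vec W 0; cone_vec W' 0])) (cone_vec x 1)
    = 'D_V (fun z => omega1 S c z (mrows 2 [:: W; W'])) x.
  by apply: cone_derive_horizontal cx _ => z cz; rewrite cone_kappa_rows; ring.
by symmetry; congr (_ - _ + _); exact: e.
Qed.

Let wa z (V W W' : 'rV[R]_5) := omega2 S c z (mrows 2 [:: V; W]) * alpha S c z W'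
  - omega2 S c z (mrows 2 [:: V; W']) * alpha S c z W
  + omega2 S c z (mrows 2 [:: W; W']) * alpha S c z V.

(** The dt-component of d Re eps = 0 at t = 1; the radial derivative of t^3
    accounts for the factor 3. *)
Lemma cone_domega3 X Y Z : ext_deriv (omega3 S c) x (mrows 3 [:: X; Y; Z]) =
  - 3 * (alpha S c x \w omega2 S c x) (mrows 3 [:: X; Y; Z]).
Proof.
have := deps (mrows 4 [:: cone_vec X 0; cone_vec Y 0; cone_vec Z 0; cone_vec 0 1]).
rewrite ext_deriv_rows4 ext_deriv_rows3.
have e (V W W' : 'rV[R]_5) : 'D_(cone_vec V 0 : 'rV[R]_6) (fun z : 'rV[R]_6 =>
    complex.Re (cone_eps S c z (mrows 3 [:: cone_vec W 0; cone_vec W' 0; cone_vec 0 1])))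
    (cone_vec x 1) = - 'D_V (fun z => omega3 S c z (mrows 2 [:: W; W'])) x.
  transitivity ('D_V (fun z => - omega3 S c z (mrows 2 [:: W; W'])) x); last first.
    by apply: (@deriveN _ _ _ (fun z => omega3 S c z (mrows 2 [:: W; W'])));
      exact: omega_derivable.
  apply: cone_derive_horizontal cx _ => z cz; rewrite cone_eps_rows//.
  by rewrite /omega2 /omega3 !om0r// al0//; ring.
have r : 'D_(cone_vec 0 1 : 'rV[R]_6) (fun z : 'rV[R]_6 =>
    complex.Re (cone_eps S c z (mrows 3 [:: cone_vec X 0; cone_vec Y 0; cone_vec Z 0])))
    (cone_vec x 1) = 3 * wa x X Y Z.
  apply: (@cone_derive_radial _ _ _ 3) => t; rewrite cone_eps_rows// /wa; ring.
rewrite [X in X - _ + _ - _]e [X in _ - X + _ - _]e [X in _ + X - _]e [X in _ - X]r.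
have F2 : 2%:R != 0 :> R by rewrite pnatr_eq0.
rewrite (wedge12 _ _ _ _ F2) => [|V W]; last exact: omega_anti.
rewrite /wa /omega2 /omega3 => h.
move: h; do 3![move: ('D__ _ _) => ?]; do 3![move: (omega S k2 c x _) => ?].
do 3![move: (alpha S c x _) => ?]; lra.
Qed.

(** The component of d Re eps = 0 without dt, which is d (omega_2 ^ alpha) = 0
    with the product rule carried out. *)
Lemma cone_domega2_alpha X Y Z T
  (D := fun V A B C => 'D_V (fun z => omega2 S c z (mrows 2 [:: A; B])) x * alpha S c x C
     + omega2 S c x (mrows 2 [:: A; B]) * 'D_V (fun z => alpha S c z C) x)
  (d := fun V A B C => D V A B C - D V A C B + D V B C A) :
  d X Y Z T - d Y X Z T + d Z X Y T - d T X Y Z = 0.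
Proof.
have := deps (mrows 4 [:: cone_vec X 0; cone_vec Y 0; cone_vec Z 0; cone_vec T 0]).
rewrite ext_deriv_rows4 => <-.
have e (V A B C : 'rV[R]_5) : 'D_(cone_vec V 0 : 'rV[R]_6) (fun z : 'rV[R]_6 =>
    complex.Re (cone_eps S c z (mrows 3 [:: cone_vec A 0; cone_vec B 0; cone_vec C 0])))
    (cone_vec x 1) = d V A B C.
  transitivity ('D_V (fun z => wa z A B C) x).
    by apply: cone_derive_horizontal cx _ => z cz; rewrite cone_eps_rows// /wa; ring.
  have dM A' B' C' : is_derive x V (fun z => omega2 S c z (mrows 2 [:: A'; B']) * alpha S c z C')
      (D V A' B' C').
    have d1 : derivable (fun z => omega2 S c z (mrows 2 [:: A'; B'])) x V.
      exact: omega_derivable.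
    have d2 : derivable (fun z => alpha S c z C') x V by exact: alpha_derivable.
    have := is_deriveM (derivableP d1) (derivableP d2).
    by move/is_derive_eq; apply; rewrite /D addrC; congr (_ + _); exact: mulrC.
  by case: (is_deriveD (is_deriveB (dM A B C) (dM A C B)) (dM B C A)).
by symmetry; congr (_ - _ + _ - _); exact: e.
Qed.

End ConeEquations.

(** * The linear system for the torsion *)

Section Torsion.
Context {R : realType}.
Implicit Types T : 'I_5 -> 'M[R]_5.

Definition comm_std T (k : 'I_3) (a : 'I_5) : 'M[R]_5 :=
  T a *m std_form k - std_form k *m T a.

Definition cyclic_comm T k a b d : R :=
  comm_std T k a b d + comm_std T k b d a + comm_std T k d a b.

(** What the cone equations say about the connection matrices T_a: teq_omega2 is
    d (omega_2 ^ alpha) = 0 with the Reeb field inserted, where the Sasaki-Einstein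
    equations would give a condition for all a, b, d. *)
Record torsion_equations T : Prop := TorsionEquations {
  teq_anti : forall a, (T a)^T = - T a;
  teq_alpha : forall a b, T b a o4 - T a b o4 = - 2 * std_form k1 a b;
  teq_omega1 : forall a b d, cyclic_comm T k1 a b d = 0;
  teq_omega2 : forall a b d, a != o4 -> b != o4 -> d != o4 ->
    cyclic_comm T k2 a b d = 0;
  teq_omega3 : forall a b d, cyclic_comm T k3 a b d =
    3 * ((a == o4)%:R * std_form k2 b d - (b == o4)%:R * std_form k2 a d
         + (d == o4)%:R * std_form k2 a b) }.

(** The solutions: the self-dual part of the horizontal block is known, the
    anti-self-dual part is free, and the entries T_a(b,4) depend on the three
    parameters T_0(0,4), T_0(1,4), T_0(3,4), of which the Sasaki-Einstein values
    are 0, 1, 0. *)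
Record torsion_solution T : Prop := TorsionSolution {
  tsol_anti : forall a, (T a)^T = - T a;
  tsol_sd1 : forall a, T a o0 o1 + T a o2 o3 = (a == o4)%:R;
  tsol_sd2 : forall a, T a o0 o2 - T a o1 o3 = 0;
  tsol_sd3 : forall a, T a o0 o3 + T a o1 o2 = 0;
  tsol_geodesic : forall b, T o4 b o4 = 0;
  tsol_11 : T o1 o1 o4 + T o0 o0 o4 = 0;
  tsol_22 : T o2 o2 o4 - T o0 o0 o4 = 0;
  tsol_33 : T o3 o3 o4 + T o0 o0 o4 = 0;
  tsol_10 : T o1 o0 o4 - T o0 o1 o4 = - 2;
  tsol_23 : T o2 o3 o4 + T o0 o1 o4 = 2;
  tsol_32 : T o3 o2 o4 + T o0 o1 o4 = 0;
  tsol_12 : T o1 o2 o4 - T o0 o3 o4 = 0;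
  tsol_21 : T o2 o1 o4 - T o0 o3 o4 = 0;
  tsol_30 : T o3 o0 o4 - T o0 o3 o4 = 0;
  tsol_02 : T o0 o2 o4 = 0;
  tsol_20 : T o2 o0 o4 = 0;
  tsol_13 : T o1 o3 o4 = 0;
  tsol_31 : T o3 o1 o4 = 0 }.

Lemma mul_std1 (X : 'M[R]_5) b :
  ((X *m std_form k1) b o0 = - X b o1) * ((X *m std_form k1) b o1 = X b o0)
  * ((X *m std_form k1) b o2 = - X b o3) * ((X *m std_form k1) b o3 = X b o2)
  * ((X *m std_form k1) b o4 = 0).
Proof. by do !split; rewrite mulmxE big_ord5 !mxE /=; ring. Qed.

Lemma mul_std2 (X : 'M[R]_5) b :
  ((X *m std_form k2) b o0 = - X b o2) * ((X *m std_form k2) b o1 = X b o3)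
  * ((X *m std_form k2) b o2 = X b o0) * ((X *m std_form k2) b o3 = - X b o1)
  * ((X *m std_form k2) b o4 = 0).
Proof. by do !split; rewrite mulmxE big_ord5 !mxE /=; ring. Qed.

Lemma mul_std3 (X : 'M[R]_5) b :
  ((X *m std_form k3) b o0 = - X b o3) * ((X *m std_form k3) b o1 = - X b o2)
  * ((X *m std_form k3) b o2 = X b o1) * ((X *m std_form k3) b o3 = X b o0)
  * ((X *m std_form k3) b o4 = 0).
Proof. by do !split; rewrite mulmxE big_ord5 !mxE /=; ring. Qed.

Lemma comm_stdE T k a b d : (T a)^T = - T a ->
  comm_std T k a b d = (T a *m std_form k) b d - (T a *m std_form k) d b.
Proof.
move=> aT; rewrite /comm_std addmxE oppmxE; congr (_ - _).
rewrite -[RHS]trmxE trmx_mul aT std_form_anti mulNmx mulmxN opprK.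
by [].
Qed.

(** The equations are linear, and each line of the solution is a combination of
    a few of their components; a component is named after its indices. *)
Lemma torsion_solve T : torsion_equations T -> torsion_solution T.
Proof.
case=> aT Ta Tw1 Tw2 Tw3.
have T0 a := anti5 (aT a).
have {}Ta a b : T b a o4 - T a b o4 = - 2 * std_form k1 a b by [].
have w1 a b d : (T a *m std_form k1) b d - (T a *m std_form k1) d b +
  ((T b *m std_form k1) d a - (T b *m std_form k1) a d) +
  ((T d *m std_form k1) a b - (T d *m std_form k1) b a) = 0.
  by have := Tw1 a b d; rewrite /cyclic_comm !comm_stdE.
have w2 a b d : a != o4 -> b != o4 -> d != o4 ->
  (T a *m std_form k2) b d - (T a *m std_form k2) d b +
  ((T b *m std_form k2) d a - (T b *m std_form k2) a d) +
  ((T d *m std_form k2) a b - (T d *m std_form k2) b a) = 0.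
  by move=> a4 b4 d4; have := Tw2 a b d a4 b4 d4; rewrite /cyclic_comm !comm_stdE.
have w3 a b d : (T a *m std_form k3) b d - (T a *m std_form k3) d b +
  ((T b *m std_form k3) d a - (T b *m std_form k3) a d) +
  ((T d *m std_form k3) a b - (T d *m std_form k3) b a) =
    3 * ((a == o4)%:R * std_form k2 b d - (b == o4)%:R * std_form k2 a d
         + (d == o4)%:R * std_form k2 a b).
  by have := Tw3 a b d; rewrite /cyclic_comm !comm_stdE.
have da01 := Ta o0 o1. have da02 := Ta o0 o2. have da03 := Ta o0 o3.
have da04 := Ta o0 o4. have da12 := Ta o1 o2. have da13 := Ta o1 o3.
have da14 := Ta o1 o4. have da23 := Ta o2 o3. have da24 := Ta o2 o4.
have da34 := Ta o3 o4.
have w1_012 := w1 o0 o1 o2. have w1_013 := w1 o0 o1 o3. have w1_014 := w1 o0 o1 o4.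
have w1_023 := w1 o0 o2 o3. have w1_024 := w1 o0 o2 o4. have w1_034 := w1 o0 o3 o4.
have w1_123 := w1 o1 o2 o3. have w1_134 := w1 o1 o3 o4.
have w2_012 := w2 o0 o1 o2 isT isT isT. have w2_013 := w2 o0 o1 o3 isT isT isT.
have w2_023 := w2 o0 o2 o3 isT isT isT. have w2_123 := w2 o1 o2 o3 isT isT isT.
have w3_012 := w3 o0 o1 o2. have w3_013 := w3 o0 o1 o3. have w3_014 := w3 o0 o1 o4.
have w3_023 := w3 o0 o2 o3. have w3_024 := w3 o0 o2 o4. have w3_034 := w3 o0 o3 o4.
have w3_123 := w3 o1 o2 o3. have w3_124 := w3 o1 o2 o4. have w3_134 := w3 o1 o3 o4.
have w3_234 := w3 o2 o3 o4.
clear Ta Tw1 Tw2 Tw3 w1 w2 w3.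
rewrite !mul_std1 !T0 in w1_012 w1_013 w1_014 w1_023 w1_024 w1_034 w1_123 w1_134.
rewrite !mul_std2 !T0 in w2_012 w2_013 w2_023 w2_123.
rewrite !mul_std3 !T0 in w3_012 w3_013 w3_014 w3_023 w3_024 w3_034 w3_123 w3_124 w3_134 w3_234.
rewrite !mxE /= ?(mul0r, mulr0, mul1r, subr0, addr0, add0r) in w3_012 w3_013 w3_014 w3_023 w3_024 w3_034 w3_123 w3_124 w3_134 w3_234.
rewrite !mxE /= ?T0 in da01 da02 da03 da04 da12 da13 da14 da23 da24 da34.
split=> //.
- apply: ord5_case; rewrite /=.
  + by move: w2_012 w1_123 w3_013; clear; lra.
  + by move: w2_013 w1_023 w3_012; clear; lra.
  + by move: w2_023 w3_123 w1_013; clear; lra.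
  + by move: w2_123 w1_012 w3_023; clear; lra.
  + by move: w3_134 da23 da01 w3_024; clear; lra.
- apply: ord5_case; rewrite /=.
  + by move: w3_023 w2_123 w1_012; clear; lra.
  + by move: w1_013 w3_123 w2_023; clear; lra.
  + by move: w3_012 w2_013 w1_023; clear; lra.
  + by move: w3_013 w2_012 w1_123; clear; lra.
  + by move: da13 w3_014 da02 w3_234; clear; lra.
- apply: ord5_case; rewrite /=.
  + by move: w3_123 w2_023 w1_013; clear; lra.
  + by move: w1_012 w3_023 w2_123; clear; lra.
  + by move: w1_123 w3_013 w2_012; clear; lra.
  + by move: w1_023 w3_012 w2_013; clear; lra.
  + by move: w1_024 da03 da12 w1_134; clear; lra.
- apply: ord5_case; rewrite ?T0//.
  + by move: da04; clear; lra.
  + by move: da14; clear; lra.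
  + by move: da24; clear; lra.
  + by move: da34; clear; lra.
- by move: w1_014; clear; lra.
- by move: w1_014 w3_124; clear; lra.
- by move: w3_034; clear; lra.
- by move: da01; clear; lra.
- by move: w3_024 w3_134 da23 da01; clear; lra.
- by move: w3_024 w3_134 da23 da01; clear; lra.
- by move: da03 w1_134 w1_024 da12; clear; lra.
- by move: da03 w1_134 w1_024 da12; clear; lra.
- by move: da03; clear; lra.
- by move: da02 w3_234 w1_034; clear; lra.
- by move: da02 w3_234 w1_034; clear; lra.
- by move: w3_014 da13 w1_034; clear; lra.
- by move: w3_014 da13 w1_034; clear; lra.
Qed.

End Torsion.

(** * Differentiating the forms in an adapted frame *)

Section StructureInFrame.
Context {R : realType} (M : smooth_manifold R 5) (S : su2_structure M).
Variables (c : chart M) (U : set 'rV[R]_5) (E : 'rV[R]_5 -> 'M[R]_5).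
Hypothesis oU : open U.
Hypothesis Uc : U `<=` chart_range c.
Hypothesis CE : mclass_C 2 U E.
Hypothesis aE : forall x, U x -> adapted (alpha_mx S c x) (omega_mx S c ^~ x) (E x).

Let g := metric S c.

Lemma frame_unit x : U x -> E x \in unitmx.
Proof. by move=> /aE[]. Qed.

Lemma frame_gram x : U x -> gram g x = E x *m (E x)^T.
Proof.
move=> Ux; rewrite gram_metric; last exact: Uc.
by rewrite /form_metric -(adapted_metric (aE Ux)).
Qed.

Let uE := frame_unit.
Let gE := frame_gram.

Definition frame_vec x (a : 'I_5) : 'rV[R]_5 := row a (invmx (E x)).

Lemma frame_vecE x a : U x -> frame_vec x a *m E x = delta_mx 0 a.
Proof. by move=> Ux; rewrite /frame_vec rowE -mulmxA mulVmx ?uE// mulmx1. Qed.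

Lemma alpha_frame x a : U x -> alpha S c x (frame_vec x a) = (a == o4)%:R.
Proof.
move=> Ux; rewrite alpha_mxE; last exact: Uc.
case: (aE Ux) => _ -> _; rewrite colE mulmxA frame_vecE// mul_delta_mx_cond.
by case: (a == o4); rewrite !mxE.
Qed.

Lemma omega_frame x k a b : U x ->
  omega S k c x (mrows 2 [:: frame_vec x a; frame_vec x b]) = std_form k a b.
Proof.
move=> Ux; rewrite omega_mxE; last exact: Uc.
rewrite (adapted_rows _ _ (E := E x)); last by case: (aE Ux).
by rewrite !frame_vecE// -rowE trmx_delta -colE !mxE.
Qed.

(** The derivative of the coframe along the frame is this part, symmetric in the
    first two indices since the connection is torsion-free, minus the connection
    matrix. Exterior derivatives only see the latter. *)
Definition chr_frame x (a : 'I_5) : 'M[R]_5 :=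
  \sum_i invmx (E x) a i *: (invmx (E x) *m chr g i x *m E x).

Lemma chr_frame_sym x a b d : U x -> chr_frame x a b d = chr_frame x b a d.
Proof.
move=> Ux.
have e a' b' : chr_frame x a' b' d = \sum_i \sum_j \sum_l
    invmx (E x) a' i * invmx (E x) b' j * chr g i x j l * E x l d.
  rewrite /chr_frame summxE; apply: eq_bigr => i _.
  rewrite scalemxE -mulmxA mulmxE mulr_sumr; apply: eq_bigr => j _.
  by rewrite mulmxE !mulr_sumr; apply: eq_bigr => l _; ring.
rewrite !e exchange_big; apply: eq_bigr => i _; apply: eq_bigr => j _.
apply: eq_bigr => l _.
rewrite (chr_sym oU (frame_gram_sym gE) _ _ _ Ux); ring.
Qed.

Definition frame_dE x a := chr_frame x a - fconn g E a x.

Lemma fder_coframe x a : U x -> fder E a E x = E x *m frame_dE x a.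
Proof.
move=> Ux; rewrite fder.unlock /frame_dE /chr_frame fconn.unlock -sumrB.
rewrite mulmx_sumr; apply: eq_bigr => i _.
by rewrite -scalerBr -scalemxAr mulmxBr !mulmxA mulmxV ?uE// mul1mx (coframe_mpartial g uE).
Qed.

Lemma derive_mx (p q : nat) (A : 'rV[R]_5 -> 'M[R]_(p, q)) x a j k :
  mclass_C 1 U A -> U x ->
  'D_(frame_vec x a) (fun y => A y j k) x = fder E a A x j k.
Proof.
move=> /mclass_CP CA Ux; rewrite (derive_class_C1 _ oU (CA j k) Ux).
rewrite fder.unlock summxE; apply: eq_bigr => i _.
by rewrite scalemxE mpartialE [frame_vec _ _ _ _]mxE.
Qed.

Lemma fder_mulmx p q r (A : 'rV[R]_5 -> 'M[R]_(p, q)) (B : 'rV[R]_5 -> 'M[R]_(q, r)) a x :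
  mclass_C 1 U A -> mclass_C 1 U B -> U x ->
  fder E a (fun y => A y *m B y) x = fder E a A x *m B x + A x *m fder E a B x.
Proof.
move=> CA CB Ux; rewrite fder.unlock mulmx_suml mulmx_sumr -big_split.
apply: eq_bigr => i _ /=.
by rewrite (mpartialM _ CA CB)// scalerDr scalemxAl scalemxAr.
Qed.

Lemma fder_cst p q (A : 'M[R]_(p, q)) a x : fder E a (fun=> A) x = 0.
Proof.
by rewrite fder.unlock big1// => i _; rewrite mpartial_cst scaler0.
Qed.

Lemma fder_tr p q (A : 'rV[R]_5 -> 'M[R]_(p, q)) a x :
  fder E a (fun y => (A y)^T) x = (fder E a A x)^T.
Proof.
rewrite fder.unlock linear_sum; apply: eq_bigr => i _.
by rewrite linearZ /= mpartialT.
Qed.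

Let CE1 := mclass_CW CE.

Lemma derive_alpha_frame x a b : U x ->
  'D_(frame_vec x a) (fun y => alpha S c y (frame_vec x b)) x = frame_dE x a b o4.
Proof.
move=> Ux; pose A y := frame_vec x b *m (E y *m delta_mx o4 (0 : 'I_1)).
have CEd : mclass_C 1 U (fun y => E y *m delta_mx o4 (0 : 'I_1)).
  by apply: mclass_CM => //; exact: mclass_C_cst.
have CA : mclass_C 1 U A by apply: mclass_CM => //; exact: mclass_C_cst.
transitivity ('D_(frame_vec x a) (fun y => A y 0 0) x).
  apply/near_eq_derive/(open_near_eq oU Ux) => y Uy.
  rewrite alpha_mxE; last exact: Uc.
  by case: (aE Uy) => _ -> _; rewrite colE.
rewrite derive_mx// fder_mulmx//; last exact: mclass_C_cst.
rewrite fder_cst mul0mx add0r fder_mulmx//; last exact: mclass_C_cst.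
rewrite fder_cst mulmx0 addr0 fder_coframe// !mulmxA frame_vecE//.
by rewrite -mulmxA -colE -rowE !mxE.
Qed.

Lemma derive_omega_frame x k a b d : U x ->
  'D_(frame_vec x a) (fun y => omega S k c y (mrows 2 [:: frame_vec x b; frame_vec x d])) x =
  (frame_dE x a *m std_form k + std_form k *m (frame_dE x a)^T) b d.
Proof.
move=> Ux; pose W y := E y *m std_form k *m (E y)^T.
pose A y := frame_vec x b *m W y *m (frame_vec x d)^T.
have CET : mclass_C 1 U (fun y => (E y)^T) by exact: mclass_CT.
have CEk : mclass_C 1 U (fun y => E y *m std_form k).
  by apply: mclass_CM => //; exact: mclass_C_cst.
have CW : mclass_C 1 U W by exact: mclass_CM.
have CbW : mclass_C 1 U (fun y => frame_vec x b *m W y).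
  by apply: mclass_CM => //; exact: mclass_C_cst.
have CA : mclass_C 1 U A by apply: mclass_CM => //; exact: mclass_C_cst.
transitivity ('D_(frame_vec x a) (fun y => A y 0 0) x).
  apply/near_eq_derive/(open_near_eq oU Ux) => y Uy.
  rewrite omega_mxE; last exact: Uc.
  by rewrite /A /W; case: (aE Uy) => _ _ <-.
rewrite derive_mx// fder_mulmx//; last exact: mclass_C_cst.
rewrite fder_cst mulmx0 addr0 fder_mulmx//; last exact: mclass_C_cst.
rewrite fder_cst mul0mx add0r fder_mulmx// fder_mulmx//; last exact: mclass_C_cst.
rewrite fder_cst mulmx0 addr0 fder_tr fder_coframe// trmx_mul.
have -> : frame_vec x b *m (E x *m frame_dE x a *m std_form k *m (E x)^T +
     E x *m std_form k *m ((frame_dE x a)^T *m (E x)^T)) *m (frame_vec x d)^T =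
   (frame_vec x b *m E x) *m (frame_dE x a *m std_form k + std_form k *m (frame_dE x a)^T)
     *m (frame_vec x d *m E x)^T.
  by rewrite trmx_mul !(mulmxDr, mulmxDl) !mulmxA.
by rewrite !frame_vecE// -rowE trmx_delta -colE !mxE.
Qed.

End StructureInFrame.

(** * The alpha-Einstein condition *)

Section CurvatureTorsion.
Context {R : realType}.
Variables (T : 'I_5 -> 'M[R]_5) (D Om : 'I_5 -> 'I_5 -> 'M[R]_5) (l : R).

Hypothesis sT : torsion_solution T.

(* D d a is the derivative of T a along the d-th frame vector. *)
Hypothesis D_sd3 : forall d a, D d a o0 o3 + D d a o1 o2 = 0.
Hypothesis D_geodesic : forall d b, D d o4 b o4 = 0.
Hypothesis D_11 : D o4 o1 o1 o4 + D o4 o0 o0 o4 = 0.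
Hypothesis D_22 : D o4 o2 o2 o4 - D o4 o0 o0 o4 = 0.
Hypothesis D_33 : D o4 o3 o3 o4 + D o4 o0 o0 o4 = 0.
Hypothesis D_23 : D o4 o2 o3 o4 + D o4 o0 o1 o4 = 0.
Hypothesis D_02 : D o4 o0 o2 o4 = 0.
Hypothesis D_13 : D o4 o1 o3 o4 = 0.

Hypothesis OmE : forall a b, Om a b = D a b - D b a - T a *m T b + T b *m T a
  + \sum_d (T b a d - T a b d) *: T d.
Hypothesis Om_frame : forall a b, (Om a b)^T = - Om a b.
Hypothesis Om_anti : forall a b, Om b a = - Om a b.
Hypothesis Om_bianchi : forall a b i j, Om a b i j + Om b i a j + Om i a b j = 0.
Hypothesis ric_diag : forall b, b != o4 -> \sum_d Om d b b d = l.
Hypothesis ric_off : forall b i, b != i -> b != o4 -> i != o4 -> \sum_d Om d b i d = 0.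

Let frame_anti a b i j : Om a b j i = - Om a b i j.
Proof. by rewrite -oppmxE -Om_frame trmxE. Qed.

Let anti a b i j : Om b a i j = - Om a b i j.
Proof. by rewrite Om_anti oppmxE. Qed.

(** A formal consequence of the two antisymmetries and of four instances of the
    first Bianchi identity. *)
Lemma pair_symmetry a b i j : Om a b i j = Om i j a b.
Proof.
have := Om_bianchi a b i j; have := Om_bianchi b i j a.
have := Om_bianchi i j a b; have := Om_bianchi j a b i.
have := frame_anti a b i j; have := frame_anti b i a j.
have := frame_anti i a b j; have := frame_anti i j a b.
have := frame_anti b j i a; have := frame_anti a j i b.
have := anti i j a b; have := anti b i a j; have := anti i a b j.
have := anti j b i a; have := anti a j i b; have := anti j a i b.
have := anti a b i j; have := anti b j i a.
have := frame_anti j b i a; have := frame_anti j a b i; have := frame_anti j a i b.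
have := frame_anti i a j b; have := anti j b a i; have := frame_anti j b a i.
have := anti a j b i; have := frame_anti b i j a.
have := anti i a j b; have := anti b i j a.
lra.
Qed.

(** The self-dual part of the horizontal block of T is constant, so in the
    structure equation its derivatives vanish. Its values are multiples of a
    single self-dual form, different from the one considered here, so that
    neither the commutator of two horizontal blocks nor the last sum contributes,
    and only the products of entries with index 4 remain. *)
Lemma curvature_sd3 a b : Om a b o0 o3 + Om a b o1 o2 =
  T a o0 o4 * T b o3 o4 - T b o0 o4 * T a o3 o4
  + T a o1 o4 * T b o2 o4 - T b o1 o4 * T a o2 o4.
Proof.
have aT d := anti5 (tsol_anti sT d).
have t23 d : T d o2 o3 = (d == o4)%:R - T d o0 o1.
  by rewrite -(tsol_sd1 sT) addrC addKr.
have t13 d : T d o1 o3 = T d o0 o2.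
  by apply/eqP; rewrite eq_sym -subr_eq0 (tsol_sd2 sT).
have t12 d : T d o1 o2 = - T d o0 o3.
  by apply/eqP; rewrite -addr_eq0 addrC (tsol_sd3 sT).
have dab d e : D d e o0 o3 = - D d e o1 o2.
  by apply/eqP; rewrite -addr_eq0 D_sd3.
have sum0 : (\sum_d (T b a d - T a b d) *: T d) o0 o3 = -
    (\sum_d (T b a d - T a b d) *: T d) o1 o2.
  rewrite 2!summxE -sumrN; apply: eq_bigr => d _.
  by rewrite 2!scalemxE t12 mulrN opprK.
rewrite OmE; move: sum0; move: (\sum_d _) => Z sum0.
rewrite !(addmxE, oppmxE) !mulmxE !big_ord5 sum0 !dab !aT !t23 !t13 !t12.
ring.
Qed.

(** With p, q, r the three torsion parameters, pair symmetry rewrites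
    Ric_00 - Ric_11 - Ric_22 + Ric_33, Ric_01 + Ric_23 and Ric_02 - Ric_13 in
    terms of the curvature components known from curvature_sd3 and of mixed ones,
    in which the derivatives of p, q, r cancel. These three combinations form
    the anti-self-dual form obtained from the trace-free Ricci tensor by
    contraction with one self-dual form, and they are multiples of q - 1, p, r.
    No quadratic terms are left: p, q - 1, r are themselves the components of an
    anti-self-dual form, and the only equivariant product with values in such
    forms is the commutator, which vanishes on equal arguments. *)
Lemma torsion_vanishes : [/\ T o0 o0 o4 = 0, T o0 o1 o4 = 1 & T o0 o3 o4 = 0].
Proof.
have aT d := anti5 (tsol_anti sT d).
pose p : R := T o0 o0 o4; pose q : R := T o0 o1 o4; pose r : R := T o0 o3 o4.
have t11 : T o1 o1 o4 = - p by have := tsol_11 sT; rewrite -/p; lra.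
have t22 : T o2 o2 o4 = p by have := tsol_22 sT; rewrite -/p; lra.
have t33 : T o3 o3 o4 = - p by have := tsol_33 sT; rewrite -/p; lra.
have t10 : T o1 o0 o4 = q - 2 by have := tsol_10 sT; rewrite -/q; lra.
have t23 : T o2 o3 o4 = 2 - q by have := tsol_23 sT; rewrite -/q; lra.
have t32 : T o3 o2 o4 = - q by have := tsol_32 sT; rewrite -/q; lra.
have t12 : T o1 o2 o4 = r by have := tsol_12 sT; rewrite -/r; lra.
have t21 : T o2 o1 o4 = r by have := tsol_21 sT; rewrite -/r; lra.
have t30 : T o3 o0 o4 = r by have := tsol_30 sT; rewrite -/r; lra.
have t00 : T o0 o0 o4 = p by []. have t01 : T o0 o1 o4 = q by [].
have t03 : T o0 o3 o4 = r by [].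
have tE := (t00, t01, t03, t11, t22, t33, t10, t23, t32, t12, t21, t30,
  tsol_02 sT, tsol_20 sT, tsol_13 sT, tsol_31 sT, tsol_geodesic sT).
pose x : R := T o4 o0 o1; pose y : R := T o4 o0 o2; pose z : R := T o4 o0 o3.
have f23 : T o4 o2 o3 = 1 - x by have := tsol_sd1 sT o4; rewrite -/x /=; lra.
have f13 : T o4 o1 o3 = y by have := tsol_sd2 sT o4; rewrite -/y /=; lra.
have f12 : T o4 o1 o2 = - z by have := tsol_sd3 sT o4; rewrite -/z /=; lra.
have f01 : T o4 o0 o1 = x by []. have f02 : T o4 o0 o2 = y by [].
have f03 : T o4 o0 o3 = z by [].
have fE := (f01, f02, f03, f23, f13, f12).
clearbody p q r x y z.
(* By tsol_geodesic, T_4(b,4) vanishes identically, and so does one of the two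
   derivatives. *)
have V b i : Om o4 b i o4 = D o4 b i o4 - \sum_e T o4 i e * T b e o4
    + \sum_e T b i e * T o4 e o4 + \sum_d (T b o4 d - T o4 b d) * T d i o4.
  rewrite OmE !(addmxE, oppmxE) D_geodesic !mulmxE subr0; congr (_ + _).
  by rewrite summxE; apply: eq_bigr => d _; rewrite scalemxE.
have sd := curvature_sd3.
have om0 a i j : Om a a i j = 0 by have := anti a a i j; lra.
have om := (anti o0 o1, anti o0 o2, anti o0 o3, anti o0 o4, anti o1 o2,
  anti o1 o3, anti o1 o4, anti o2 o3, anti o2 o4, anti o3 o4, om0).
have omf a b := anti5 (Om_frame a b).
have A : 2 * (Om o1 o2 o0 o3 + Om o1 o2 o1 o2 - (Om o0 o3 o0 o3 + Om o0 o3 o1 o2))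
    + (Om o4 o0 o0 o4 - Om o4 o1 o1 o4 - Om o4 o2 o2 o4 + Om o4 o3 o3 o4) = 0.
  have r0 := ric_diag (isT : o0 != o4); have r1 := ric_diag (isT : o1 != o4).
  have r2 := ric_diag (isT : o2 != o4); have r3 := ric_diag (isT : o3 != o4).
  have ps := pair_symmetry o0 o3 o1 o2.
  by rewrite !big_ord5 ?om ?omf in r0 r1 r2 r3; rewrite ?om ?omf; lra.
have B : Om o4 o0 o1 o4 + Om o4 o2 o3 o4 =
    Om o0 o2 o0 o3 + Om o0 o2 o1 o2 + (Om o1 o3 o0 o3 + Om o1 o3 o1 o2).
  have r0 := ric_off (isT : o0 != o1) isT isT.
  have r1 := ric_off (isT : o2 != o3) isT isT.
  have ps := pair_symmetry o0 o3 o1 o3; have ps' := pair_symmetry o1 o2 o1 o3.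
  by rewrite !big_ord5 ?om ?omf in r0 r1; rewrite ?om ?omf; lra.
have C : Om o4 o0 o2 o4 - Om o4 o1 o3 o4 =
    Om o2 o3 o0 o3 + Om o2 o3 o1 o2 - (Om o0 o1 o0 o3 + Om o0 o1 o1 o2).
  have r0 := ric_off (isT : o0 != o2) isT isT.
  have r1 := ric_off (isT : o1 != o3) isT isT.
  have ps := pair_symmetry o0 o3 o2 o3; have ps' := pair_symmetry o1 o2 o2 o3.
  by rewrite !big_ord5 ?om ?omf in r0 r1; rewrite ?om ?omf; lra.
have d11 : D o4 o1 o1 o4 = - D o4 o0 o0 o4 by have := D_11; lra.
have d22 : D o4 o2 o2 o4 = D o4 o0 o0 o4 by have := D_22; lra.
have d33 : D o4 o3 o3 o4 = - D o4 o0 o0 o4 by have := D_33; lra.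
have d23 : D o4 o2 o3 o4 = - D o4 o0 o1 o4 by have := D_23; lra.
rewrite !V !sd !big_ord5 !aT !tE !fE ?D_02 ?D_13 ?d11 ?d22 ?d33 ?d23 in A B C.
split.
- by rewrite t00; move: B; lra.
- by rewrite t01; move: A; lra.
- by rewrite t03; move: C; lra.
Qed.

End CurvatureTorsion.

(** * The torsion of a half-flat SU(2)-structure *)

Section TorsionOfStructure.
Context {R : realType} (M : smooth_manifold R 5) (S : su2_structure M).
Hypothesis shf : symplectic_half_flat (cone_kappa S) (cone_J S) (cone_eps S).
Variables (c : chart M) (U : set 'rV[R]_5) (E : 'rV[R]_5 -> 'M[R]_5).
Hypothesis oU : open U.
Hypothesis Uc : U `<=` chart_range c.
Hypothesis CE : mclass_C 2 U E.
Hypothesis aE : forall x, U x -> adapted (alpha_mx S c x) (omega_mx S c ^~ x) (E x).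

Let g := metric S c.
Let uE := frame_unit aE.
Let gE := frame_gram Uc aE.
Let T x a := fconn g E a x.
Let f x a := frame_vec E x a.

Let T_anti x a : U x -> (T x a)^T = - T x a.
Proof. exact: (fconn_antisym oU CE uE gE). Qed.

(** The symmetric part chr_frame of the derivative of the coframe drops out of
    the cyclic sum. *)
Lemma frame_domega x k a b d (A := fun a b d => 'D_(f x a) (fun y =>
    omega S k c y (mrows 2 [:: f x b; f x d])) x) : U x ->
  A a b d - A b a d + A d a b = - cyclic_comm (T x) k a b d.
Proof.
move=> Ux; pose n a' b' d' := (chr_frame S c E x a' *m std_form k) b' d'.
have AE a' b' d' : A a' b' d' = n a' b' d' - n a' d' b' - comm_std (T x) k a' b' d'.
  rewrite /A (derive_omega_frame oU Uc CE aE)// comm_stdE ?T_anti// addmxE.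
  have -> : (std_form k *m (frame_dE S c E x a')^T) b' d' =
      - (frame_dE S c E x a' *m std_form k) d' b'.
    by rewrite -(trmxE (_ *m std_form k) b' d') trmx_mul std_form_anti mulNmx oppmxE opprK.
  by rewrite /frame_dE mulmxBl 2!addmxE 2!oppmxE /n /T; ring.
have ns a' b' d' : n a' b' d' = n b' a' d'.
  rewrite /n !mulmxE; apply: eq_bigr => e _.
  by rewrite (chr_frame_sym oU Uc aE).
rewrite !AE /cyclic_comm (ns b a d) (ns d a b) (ns d b a).
have anti a' b' d' : comm_std (T x) k a' b' d' = - comm_std (T x) k a' d' b'.
  by rewrite !comm_stdE ?T_anti// opprB.
rewrite (anti b d a); ring.
Qed.

Lemma frame_torsion_equations x : U x -> torsion_equations (T x).
Proof.
move=> Ux; have cx := Uc Ux.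
have dA a b : 'D_(f x a) (fun y => alpha S c y (f x b)) x -
    'D_(f x b) (fun y => alpha S c y (f x a)) x = T x b a o4 - T x a b o4.
  rewrite !(derive_alpha_frame oU Uc CE aE)// /frame_dE !addmxE !oppmxE.
  by rewrite (chr_frame_sym oU Uc aE _ _ _ Ux) /T; ring.
have al a : alpha S c x (f x a) = (a == o4)%:R by exact: (alpha_frame Uc aE).
have om k a b : omega S k c x (mrows 2 [:: f x a; f x b]) = std_form k a b.
  exact: (omega_frame Uc aE).
have F2 : 2%:R != 0 :> R by rewrite pnatr_eq0.
have tA a b : T x b a o4 - T x a b o4 = - 2 * std_form k1 a b.
  rewrite -dA -ext_deriv_rows2 (cone_dalpha shf cx).
  by rewrite /omega1 om.
split=> //.
- by move=> a; exact: T_anti.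
- move=> a b d; apply/eqP; rewrite -oppr_eq0; apply/eqP.
  rewrite -frame_domega//; have := cone_domega1 shf cx (f x a) (f x b) (f x d).
  by rewrite ext_deriv_rows3.
- move=> a b d a4 b4 d4.
  pose K a b d := 'D_(f x a) (fun y =>
    omega S k2 c y (mrows 2 [:: f x b; f x d])) x.
  pose L a b := 'D_(f x a) (fun y => alpha S c y (f x b)) x.
  pose w a b := omega S k2 c x (mrows 2 [:: f x a; f x b]).
  pose al' a := alpha S c x (f x a).
  pose d' v i j l := K v i j * al' l + w i j * L v l
    - (K v i l * al' j + w i l * L v j) + (K v j l * al' i + w j l * L v i).
  have h : d' a b d o4 - d' b a d o4 + d' d a b o4 - d' o4 a b d = 0.
    exact: (cone_domega2_alpha shf cx (f x a) (f x b) (f x d) (f x o4)).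
  have e : K a b d - K b a d + K d a b = - cyclic_comm (T x) k2 a b d by exact: frame_domega.
  (* The Reeb field annihilates d alpha and omega_2, so only d omega_2 is left
     when it is inserted. *)
  have L4 i : L i o4 = L o4 i.
    apply/eqP; rewrite -subr_eq0 /L dA tA mxE.
    by elim/ord5_case: i; rewrite /= mulr0.
  have w4 i : w i o4 = 0.
    by rewrite /w om mxE; elim/ord5_case: i.
  have alE i : i != o4 -> al' i = 0 by rewrite /al' al => /negPf ->.
  have al4 : al' o4 = 1 by rewrite /al' al eqxx.
  move: h e; rewrite /d' al4 (alE a)// (alE b)// (alE d)// !w4 !L4.
  by clearbody K L w; lra.
- move=> a b d; apply: oppr_inj; rewrite -frame_domega//.
  have := cone_domega3 shf cx (f x a) (f x b) (f x d).
  rewrite ext_deriv_rows3 => ->.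
  rewrite (wedge12 _ _ _ _ F2) => [|V W]; last exact: omega_anti.
  by rewrite !al /omega2 !om; ring.
Qed.

Lemma frame_torsion x : U x -> torsion_solution (T x).
Proof. by move=> /frame_torsion_equations/torsion_solve. Qed.

(** The relations of torsion_solution hold at all points of U, so that they may
    be differentiated along the frame. *)
Let fder_rel x e a i j b k l (s m : R) : U x ->
  (forall y, U y -> T y a i j + s * T y b k l = m) ->
  fder E e (T^~ a) x i j + s * fder E e (T^~ b) x k l = 0.
Proof.
move=> Ux H; have CT a' : mclass_C 1 U (T^~ a') by exact: (mclass_C_fconn oU CE uE gE).
have dmx a' p q : fder E e (T^~ a') x p q =
    'D_(frame_vec E x e) (fun y => T y a' p q) x.
  by rewrite (derive_mx E oU).
rewrite !dmx.
have d1 : derivable (fun y => T y a i j) x (frame_vec E x e).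
  by have /mclass_CP CTa := CT a; have [] := is_derive_class_C1 (frame_vec E x e) oU (CTa i j) Ux.
have d2 : derivable (fun y => T y b k l) x (frame_vec E x e).
  by have /mclass_CP CTb := CT b; have [] := is_derive_class_C1 (frame_vec E x e) oU (CTb k l) Ux.
transitivity ('D_(frame_vec E x e) (fun y => T y a i j + s * T y b k l) x).
  have d3 : derivable (fun y => s * T y b k l) x (frame_vec E x e).
    exact: derivableZ.
  have <- : 'D_(frame_vec E x e) (fun y => s * T y b k l) x =
      s * 'D_(frame_vec E x e) (fun y => T y b k l) x by exact: deriveZ.
  by symmetry; exact: deriveD.
rewrite -(derive_cst m x (frame_vec E x e)).
exact/near_eq_derive/(open_near_eq oU Ux H).
Qed.

(** On ker alpha the alpha-Einstein condition makes the Ricci tensor a multiple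
    of the identity matrix in the adapted frame. *)
Lemma frame_torsion_vanishes x : alpha_Einstein S -> U x ->
  [/\ T x o0 o0 o4 = 0, T x o0 o1 o4 = 1 & T x o0 o3 o4 = 0].
Proof.
move=> ein Ux; have cx := Uc Ux.
have ricE b d : b != o4 -> d != o4 ->
    \sum_i fcurv g E i b x d i = ric_lambda S c x / 4%:R * (b == d)%:R.
  move=> b4 d4; rewrite -(ricci_fcurv oU CE uE gE)//.
  have /eqP := ein c x cx (frame_vec E x b) (frame_vec E x d).
  rewrite /ric0 subr_eq0 => /eqP e; apply: etrans e _.
  rewrite !(alpha_frame Uc aE)// (negPf b4) mul0r mulr0 addr0; congr (_ * _).
  rewrite metricTE// !(alpha_frame Uc aE)// (negPf b4) mul0r subr0 metricE//.
  rewrite -gram_metric// (gE Ux) mulmxA (frame_vecE aE)// -mulmxA -trmx_mul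
    (frame_vecE aE)//.
  by rewrite trmx_delta mul_delta_mx_cond; case: (b == d); rewrite !mxE.
have sol y (Uy : U y) := frame_torsion Uy.
apply: (@torsion_vanishes _ (T x) (fun e a => fder E e (T^~ a) x)
  (fun a b => fcurv g E a b x) (ric_lambda S c x / 4%:R)).
- exact: sol.
- move=> e a; have := @fder_rel x e a o0 o3 a o1 o2 1 0 Ux; rewrite mul1r; apply.
  by move=> y Uy; rewrite mul1r (tsol_sd3 (sol y Uy)).
- move=> e b; have := @fder_rel x e o4 b o4 o4 b o4 0 0 Ux; rewrite mul0r addr0; apply.
  by move=> y Uy; rewrite mul0r addr0 (tsol_geodesic (sol y Uy)).
- have := @fder_rel x o4 o1 o1 o4 o0 o0 o4 1 0 Ux; rewrite mul1r; apply.
  by move=> y Uy; rewrite mul1r (tsol_11 (sol y Uy)).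
- have := @fder_rel x o4 o2 o2 o4 o0 o0 o4 (-1) 0 Ux; rewrite mulN1r; apply.
  by move=> y Uy; rewrite mulN1r (tsol_22 (sol y Uy)).
- have := @fder_rel x o4 o3 o3 o4 o0 o0 o4 1 0 Ux; rewrite mul1r; apply.
  by move=> y Uy; rewrite mul1r (tsol_33 (sol y Uy)).
- have := @fder_rel x o4 o2 o3 o4 o0 o1 o4 1 2 Ux; rewrite mul1r; apply.
  by move=> y Uy; rewrite mul1r (tsol_23 (sol y Uy)).
- have := @fder_rel x o4 o0 o2 o4 o0 o2 o4 0 0 Ux; rewrite mul0r addr0; apply.
  by move=> y Uy; rewrite mul0r addr0 (tsol_02 (sol y Uy)).
- have := @fder_rel x o4 o1 o3 o4 o1 o3 o4 0 0 Ux; rewrite mul0r addr0; apply.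
  by move=> y Uy; rewrite mul0r addr0 (tsol_13 (sol y Uy)).
- by move=> a b; exact: (fcurv_structure oU CE uE gE).
- by move=> a b; exact: (fcurv_antisym_frame oU CE uE gE).
- by move=> a b; exact: fcurv_antisym.
- by move=> a b i j; exact: (fcurv_bianchi oU CE uE gE).
- by move=> b b4; rewrite ricE// eqxx mulr1.
- by move=> b i bi b4 i4; rewrite ricE// (negPf bi) mulr0.
Qed.

End TorsionOfStructure.

(** * The Sasaki-Einstein equations *)

Section SasakiEinstein.
Context {R : realType}.

(** At the three parameter values of the hypotheses the solution of the torsion
    equations is the one of a Sasaki-Einstein structure, up to the free
    anti-self-dual part, which commutes with the self-dual matrix std_form k2. *)
Lemma cyclic_comm_omega2 (T : 'I_5 -> 'M[R]_5) : torsion_solution T ->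
  T o0 o0 o4 = 0 -> T o0 o1 o4 = 1 -> T o0 o3 o4 = 0 ->
  forall a b d, cyclic_comm T k2 a b d =
    - 3 * ((a == o4)%:R * std_form k3 b d - (b == o4)%:R * std_form k3 a d
           + (d == o4)%:R * std_form k3 a b).
Proof.
move=> sT p0 q1 r0 a b d.
have aT e := anti5 (tsol_anti sT e).
have t23 e : T e o2 o3 = (e == o4)%:R - T e o0 o1.
  by rewrite -(tsol_sd1 sT) addrC addKr.
have t13 e : T e o1 o3 = T e o0 o2.
  by apply/eqP; rewrite eq_sym -subr_eq0 (tsol_sd2 sT).
have t12 e : T e o1 o2 = - T e o0 o3.
  by apply/eqP; rewrite -addr_eq0 addrC (tsol_sd3 sT).
have t11 : T o1 o1 o4 = 0 by have := tsol_11 sT; rewrite p0; lra.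
have t22 : T o2 o2 o4 = 0 by have := tsol_22 sT; rewrite p0; lra.
have t33 : T o3 o3 o4 = 0 by have := tsol_33 sT; rewrite p0; lra.
have t10 : T o1 o0 o4 = - 1 by have := tsol_10 sT; rewrite q1; lra.
have t23' : T o2 o3 o4 = 1 by have := tsol_23 sT; rewrite q1; lra.
have t32 : T o3 o2 o4 = - 1 by have := tsol_32 sT; rewrite q1; lra.
have u12 : T o1 o2 o4 = 0 by have := tsol_12 sT; rewrite r0; lra.
have u21 : T o2 o1 o4 = 0 by have := tsol_21 sT; rewrite r0; lra.
have u30 : T o3 o0 o4 = 0 by have := tsol_30 sT; rewrite r0; lra.
have tE := (p0, q1, r0, t11, t22, t33, t10, t23', t32, u12, u21, u30,
  tsol_02 sT, tsol_20 sT, tsol_13 sT, tsol_31 sT, tsol_geodesic sT).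
rewrite /cyclic_comm !comm_stdE; try exact: (tsol_anti sT).
by elim/ord5_case: a; elim/ord5_case: b; elim/ord5_case: d;
  rewrite !mul_std2 ?aT ?tE ?t23 ?t13 ?t12 !mxE /=; ring.
Qed.

Lemma linear_on_frame n (E : 'M[R]_n) (phi : 'rV[R]_n -> R) :
  E \in unitmx -> (forall t X Y, phi (t *: X + Y) = t * phi X + phi Y) ->
  (forall a, phi (row a (invmx E)) = 0) -> forall X, phi X = 0.
Proof.
move=> uE lphi phi0 X; rewrite -(mulmxKV uE X).
have lE Y : phi (Y *m invmx E) = \sum_i Y 0 i * phi (delta_mx 0 i *m invmx E).
  apply: (@lin_expand _ _ (fun Y => phi (Y *m invmx E))) => t Z W.
  by rewrite mulmxDl -scalemxAl lphi.
rewrite -[X *m _ *m _](_ : (X *m E) *m invmx E = _); last first.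
  by rewrite mulmxK// mulmxKV.
rewrite lE big1// => i _.
by rewrite -rowE phi0 mulr0.
Qed.

Variables (M : smooth_manifold R 5) (S : su2_structure M).
Hypothesis shf : symplectic_half_flat (cone_kappa S) (cone_J S) (cone_eps S).
Hypothesis ein : alpha_Einstein S.
Variables (c : chart M) (x : 'rV[R]_5).
Hypothesis cx : chart_range c x.
Implicit Types X Y Z : 'rV[R]_5.

Let oc : open (chart_range c) := open_chart_range (c := c).

Let der X Y Z := 'D_X (fun y => omega2 S c y (mrows 2 [:: Y; Z])) x.

Let derE X Y Z : der X Y Z =
  \sum_i X 0 i * (Y *m mpartial i (omega_mx S c k2) x *m Z^T) 0 0.
Proof.
have /mclass_CP CW := mclass_C_omega_mx S c 1 k2.
have CW' := mclass_C_omega_mx S c 1 k2.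
pose A y := Y *m omega_mx S c k2 y *m Z^T.
have CY : mclass_C 1 (chart_range c) (fun y => Y *m omega_mx S c k2 y).
  by apply: mclass_CM => //; exact: mclass_C_cst.
have CA : mclass_C 1 (chart_range c) A.
  by apply: mclass_CM => //; exact: mclass_C_cst.
transitivity ('D_X (fun y => A y 0 0) x).
  apply/near_eq_derive/(open_near_eq oc cx) => y cy.
  exact: omega_mxE.
have /mclass_CP CA0 := CA.
rewrite (derive_class_C1 X oc (CA0 0 0) cx); apply: eq_bigr => i _.
rewrite -mpartialE (mpartialM i CY (mclass_C_cst _ 1 Z^T) cx) mpartial_cst mulmx0 addr0.
by rewrite (mpartialM i (mclass_C_cst _ 1 Y) CW' cx) mpartial_cst mul0mx add0r.
Qed.

Let der_lin1 t X X' Y Z : der (t *: X + X') Y Z = t * der X Y Z + der X' Y Z.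
Proof.
rewrite !derE mulr_sumr -big_split; apply: eq_bigr => i _ /=.
by rewrite addmxE scalemxE; ring.
Qed.

Let der_lin2 t X Y Y' Z : der X (t *: Y + Y') Z = t * der X Y Z + der X Y' Z.
Proof.
rewrite !derE mulr_sumr -big_split; apply: eq_bigr => i _ /=.
by rewrite !mulmxDl -!scalemxAl addmxE scalemxE; ring.
Qed.

Let der_lin3 t X Y Z Z' : der X Y (t *: Z + Z') = t * der X Y Z + der X Y Z'.
Proof.
rewrite !derE mulr_sumr -big_split; apply: eq_bigr => i _ /=.
by rewrite linearD linearZ /= mulmxDr -scalemxAr addmxE scalemxE; ring.
Qed.

Let al X := alpha S c x X.
Let w X Y := omega3 S c x (mrows 2 [:: X; Y]).

Let al_lin t X X' : al (t *: X + X') = t * al X + al X'.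
Proof. by rewrite /al !alpha_mxE// mulmxDl -scalemxAl addmxE scalemxE. Qed.

Let w_lin1 t X X' Y : w (t *: X + X') Y = t * w X Y + w X' Y.
Proof.
by rewrite /w /omega3 !omega_mxE// !mulmxDl -!scalemxAl addmxE scalemxE.
Qed.

Let w_lin2 t X Y Y' : w X (t *: Y + Y') = t * w X Y + w X Y'.
Proof.
by rewrite /w /omega3 !omega_mxE// linearD linearZ /= mulmxDr -scalemxAr addmxE scalemxE.
Qed.

(** Both sides are trilinear, so it suffices to compare them on a frame, where
    the torsion is known. *)
Lemma domega2_eq X Y Z : ext_deriv (omega2 S c) x (mrows 3 [:: X; Y; Z]) =
  3 * (alpha S c x \w omega3 S c x) (mrows 3 [:: X; Y; Z]).
Proof.
have [U [E [oU Ux Uc CE aE]]] := smooth_adapted_frame S cx.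
have F2 : 2%:R != 0 :> R by rewrite pnatr_eq0.
rewrite ext_deriv_rows3 (wedge12 _ _ _ _ F2) => [|V W]; last exact: omega_anti.
pose phi X Y Z := der X Y Z - der Y X Z + der Z X Y
  - 3 * (al X * w Y Z - al Y * w X Z + al Z * w X Y).
suff : phi X Y Z = 0.
  by rewrite /phi => /eqP; rewrite subr_eq0 => /eqP.
have uE := frame_unit aE Ux.
pose f a := frame_vec E x a.
have frame a b d : phi (f a) (f b) (f d) = 0.
  have [p0 q1 r0] := frame_torsion_vanishes shf oU Uc CE aE ein Ux.
  have sT := frame_torsion shf oU Uc CE aE Ux.
  rewrite /phi (frame_domega oU Uc CE aE k2 a b d Ux).
  rewrite (cyclic_comm_omega2 sT p0 q1 r0) /al /w /omega3.
  rewrite !(alpha_frame Uc aE)// !(omega_frame Uc aE)//.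
  by move: (std_form _ _ _) (std_form _ _ _) (std_form _ _ _) => *; ring.
have lin3 a b Z' : phi (f a) (f b) Z' = 0.
  apply: (@linear_on_frame _ _ (phi (f a) (f b)) uE) => [t V W|d]; last exact: frame.
  by rewrite /phi !der_lin3 der_lin1 !w_lin2 al_lin; ring.
have lin2 a Y' Z' : phi (f a) Y' Z' = 0.
  apply: (@linear_on_frame _ _ (fun V => phi (f a) V Z') uE) => [t V W|b].
    by rewrite /phi der_lin2 der_lin1 der_lin3 w_lin1 al_lin w_lin2; ring.
  exact: lin3.
apply: (@linear_on_frame _ _ (fun V => phi V Y Z) uE) => [t V W|a].
  by rewrite /phi der_lin1 !der_lin2 al_lin !w_lin1; ring.
exact: lin2.
Qed.

End SasakiEinstein.

Theorem corollary4p4 (R : realType) (M : smooth_manifold R 5)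
    (S : su2_structure M)
    (shf : symplectic_half_flat (cone_kappa S) (cone_J S) (cone_eps S))
    (einstein : alpha_Einstein S) :
  sasaki_einstein S.
Proof.
have rows k (X : 'M[R]_(k, 5)) : exists s, X = mrows k s /\ size s = k.
  exists [seq row i X | i <- enum 'I_k]; split; first exact: mrows_row.
  by rewrite size_map size_enum_ord.
move=> c x cx; split=> X.
- have [s [-> ss]] := rows 2 X.
  by case: s ss => [|X0 [|X1 [|? ?]]] // _; exact: (cone_dalpha shf).
- have [s [-> ss]] := rows 3 X.
  by case: s ss => [|X0 [|X1 [|X2 [|? ?]]]] // _; exact: (domega2_eq shf einstein).
- have [s [-> ss]] := rows 3 X.
  by case: s ss => [|X0 [|X1 [|X2 [|? ?]]]] // _; exact: (cone_domega3 shf).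
Qed.
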